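(* Let $a_1,a_2$ be positive integers, $\ell=a_1+a_2$, $p_1=a_1/\ell$, $p_2=a_2/\ell$, and let $\lambda=((a_1+a_2)^{a_1},a_1^{a_2})$ (a fat hook of length $\ell$). Then: (i) The Cauchy transform $G^{\lambda}(z)$ of $F^{\lambda}$ satisfies $L^{\lambda}(G^{\lambda}(z),z)=0$ for $z\in\mathbb{C}\setminus\mathbb{R}$, where $$L^{\lambda}(G,z)=z^2G^3+z(p_1-p_2-2z)G^2+z(2p_2+z)G+(p_1^2-z).$$ (ii) The $R$-transform of $F^{\lambda}$ is given (in a neighbourhood of $z=0$, with the branch of the square root equal to $1$ at $z=0$) by $$R^{\lambda}(z)=\frac{p_1}{1-z}+\frac{1}{2z}\left(\sqrt{\frac{1-(p_2-p_1)^2z}{1-z}}-1\right).$$ (iii) The measure $\mathrm{d}F^{\lambda}$ can be expressed as $$\mathrm{d}F^{\lambda}=\mathrm{MP}(p_1^{-1},p_1)\boxplus\big(\mathrm{MP}(p_1^{-1},p_1)\boxtimes\mathrm{Ber}(p_2)\big)=\mathrm{MP}(p_1^{-1},p_1)\boxplus\big(\mathrm{MP}(p_2^{-1},p_2)\boxtimes\mathrm{Ber}(p_1)\big).$$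
   Context: The notation $((a_1+a_2)^{a_1},a_1^{a_2})$ denotes the partition with $a_1$ parts equal to $a_1+a_2$ followed by $a_2$ parts equal to $a_1$. A partition $\lambda$ with $\ell$ positive parts is identified with its Young diagram $\{(i,j)\in\mathbb{Z}^2:1\le i\le\ell,\ 1\le j\le\lambda_i\}$; the fat hook is self-conjugate (its diagram is invariant under $(i,j)\mapsto(j,i)$). A plane tree is a rooted tree in which the children of every vertex are linearly ordered. A $\lambda$-plane tree is a pair $(T,c)$, where $T$ is a plane tree with vertex set $V$ and edge set $E$ and $c:V\to\{1,\dots,\ell\}$ satisfies $(c(u),c(v))\in\lambda$ whenever $\{u,v\}\in E$. $C_k^{\lambda}$ is the number of $\lambda$-plane trees on $k+1$ vertices (up to isomorphism preserving root, order of children, and labels). $F^{\lambda}$ is the (unique) probability distribution on $[0,\infty)$ with moments $\int_0^\infty x^k\,\mathrm{d}F^{\lambda}(x)=C_k^{\lambda}/\ell^{k+1}$ for $k\ge0$. It has compact support, and it is the almost sure limiting spectral distribution of $\frac{1}{N\ell}X_NX_N^*$ as $N\to\infty$, where $X_N$ is the $(N\ell)\times(N\ell)$ matrix with i.i.d. centred unit-variance complex entries at the positions of the dilated diagram $N\lambda$ (each box of $\lambda$ replaced by an $N\times N$ grid of boxes) and zeros elsewhere. For a compactly supported probability distribution $F$, the Cauchy transform is $G(z)=\int\frac{1}{z-x}\,\mathrm{d}F(x)$, $z\in\mathbb{C}\setminus\mathbb{R}$, extended analytically to a neighbourhood of infinity. The $R$-transform $R(z)=\sum_{k\ge0}R_{k+1}z^k$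 is the function analytic near $0$ with $G(R(z)+1/z)=z$ for small $z\neq0$. For a measure supported in $[0,\infty)$ (not $\delta_0$), the $S$-transform is defined near $0$ by $S(z)R(zS(z))=1$. The additive free convolution $F_1\boxplus F_2$ is the probability distribution with $R$-transform $R_1+R_2$; the multiplicative free convolution $F_1\boxtimes F_2$ is the probability distribution with $S$-transform $S_1S_2$ (the same notation is used for the corresponding measures). For $\alpha,\beta>0$, the Marchenko–Pastur distribution is $$\mathrm{MP}(\alpha,\beta)=\max\Big(1-\frac1\alpha,0\Big)\delta_0+\frac{\sqrt{(\gamma_+-x)(x-\gamma_-)}}{2\pi\alpha\beta x}\mathbf{1}_{[\gamma_-,\gamma_+]}(x)\,\mathrm{d}x,\qquad \gamma_\pm=\beta(1\pm\sqrt\alpha)^2.$$ For $p\in[0,1]$, $\mathrm{Ber}(p)=(1-p)\delta_0+p\,\delta_1$. *)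

(* Defs.v *)
From HB Require Import structures.
From mathcomp Require Import all_boot all_order all_algebra.
From mathcomp Require Import finmap.
From mathcomp Require Import all_classical all_reals all_analysis.
From mathcomp Require Import measurable_realfun.
From mathcomp Require Import complex.

Set Implicit Arguments.
Unset Strict Implicit.
Unset Printing Implicit Defensive.

Import Order.TTheory GRing.Theory Num.Theory.
Import numFieldNormedType.Exports.

Local Open Scope classical_set_scope.
Local Open Scope ring_scope.
Local Open Scope complex_scope.

(* Indices of boxes and vertex labels start from 1. *)
Definition in_diagram (lam : seq nat) (i j : nat) : bool :=
  ((0 < i <= size lam) && (0 < j <= nth 0 lam i.-1))%N.

Definition fat_hook (a1 a2 : nat) : seq nat :=
  nseq a1 (a1 + a2)%N ++ nseq a2 a1.

(* A plane tree whose vertices carry labels; two plane trees related by an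
   isomorphism that preserves the root, the order of the children and the
   labels are the same term, so that counting terms counts isomorphism
   classes. *)
Inductive labelled_tree : Type :=
  LNode of nat & seq labelled_tree.

Definition root_label (t : labelled_tree) : nat := let: LNode i _ := t in i.

Fixpoint nb_vertices (t : labelled_tree) : nat :=
  let: LNode _ ts := t in (sumn (map nb_vertices ts)).+1.

(* Edges are unordered, so both orders of the labels of an edge are tested. *)
Fixpoint is_lambda_tree (lam : seq nat) (t : labelled_tree) : bool :=
  let: LNode i ts := t in
  (0 < i <= size lam)%N &&
  all (fun s => [&& in_diagram lam i (root_label s),
                    in_diagram lam (root_label s) i
                  & is_lambda_tree lam s]) ts.

Section labelled_tree_choice.

Fixpoint labelled_tree_encode (t : labelled_tree) : GenTree.tree void :=
  let: LNode i ts := t in GenTree.Node i (map labelled_tree_encode ts).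

Fixpoint labelled_tree_decode (t : GenTree.tree void) : labelled_tree :=
  match t with
  | GenTree.Leaf x => of_void labelled_tree x
  | GenTree.Node i ts => LNode i (map labelled_tree_decode ts)
  end.

Lemma labelled_tree_encodeK : cancel labelled_tree_encode labelled_tree_decode.
Proof.
rewrite /cancel; fix IH 1; case=> i ts /=; congr LNode.
by elim: ts => //= t ts ->; rewrite IH.
Qed.

HB.instance Definition _ :=
  Countable.copy labelled_tree (can_type labelled_tree_encodeK).

End labelled_tree_choice.

Definition lambda_trees (lam : seq nat) (n : nat) : set labelled_tree :=
  [set t | is_lambda_tree lam t && (nb_vertices t == n)].

Definition nb_lambda_trees (lam : seq nat) (k : nat) : nat :=
  #|` fset_set (lambda_trees lam k.+1)|.

Section measures_on_the_line.
Context {R : realType}.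
Implicit Types mu nu : {measure set (measurableTypeR R) -> \bar R}.

Definition nonneg_supported mu : Prop := mu `]-oo, 0[%classic = 0%E.

Definition compactly_supported mu : Prop :=
  exists M : R, mu (~` `[- M, M]%classic) = 0%E.

Definition has_tree_moments (lam : seq nat) mu : Prop :=
  forall k : nat,
    (\int[mu]_x (x ^+ k)%:E)%E =
    ((nb_lambda_trees lam k)%:R / (size lam)%:R ^+ k.+1)%:E.

(* At most one probability distribution on [0, +oo[ has these moments, so the
   predicate determines F^lambda. *)
Definition is_F_lambda (lam : seq nat)
    (F : probability (measurableTypeR R) R) : Prop :=
  nonneg_supported F /\ has_tree_moments lam F.

(* The integral is taken separately on real and imaginary parts. For a
   compactly supported measure the same formula, at every z outside a disk that
   contains the support, is the analytic extension to a neighbourhood of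
   infinity. *)
Definition cauchy_transform mu (z : R[i]) : R[i] :=
  (\int[mu]_x complex.Re (z - x%:C)^-1) +i* (\int[mu]_x complex.Im (z - x%:C)^-1).

(* derivable is over the field R[i]: f is holomorphic on a neighbourhood of 0. *)
Definition analytic_near0 (f : R[i]^o -> R[i]^o) : Prop :=
  \forall z \near (0 : R[i]^o), derivable f z 1.

(* The transforms are germs at 0, hence relations between a measure and a
   function that only constrain the function near 0. *)
Definition is_R_transform mu (r : R[i]^o -> R[i]^o) : Prop :=
  [/\ mu setT = 1%E,
      compactly_supported mu,
      analytic_near0 r
    & \forall z \near (0 : R[i]^o)^', cauchy_transform mu (r z + z^-1) = z].

Definition is_S_transform mu (s : R[i]^o -> R[i]^o) : Prop :=
  [/\ nonneg_supported mu,
      mu `]0, +oo[%classic != 0%E,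
      analytic_near0 s
    & exists2 r, is_R_transform mu r &
        \forall z \near (0 : R[i]^o), s z * r (z * s z) = 1].

(* A compactly supported probability measure is determined by the germ of its
   R-transform (and by that of its S-transform when it has one), so these
   relations determine nu from mu1 and mu2. *)
Definition is_free_add_conv mu1 mu2 nu : Prop :=
  exists r1 r2, [/\ is_R_transform mu1 r1, is_R_transform mu2 r2
                  & is_R_transform nu (fun z => r1 z + r2 z)].

Definition is_free_mul_conv mu1 mu2 nu : Prop :=
  exists s1 s2, [/\ is_S_transform mu1 s1, is_S_transform mu2 s2
                  & is_S_transform nu (fun z => s1 z * s2 z)].

End measures_on_the_line.

Lemma measurable_invr {R : realType} : measurable_fun [set: R] (@GRing.inv R).
Proof.
rewrite -(setUv [set (0 : R)]); apply/measurable_funU => //.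
  exact: measurableC.
split; first exact: measurable_fun_set1.
apply: open_continuous_measurable_fun.
  by rewrite openC; exact: closed_eq.
by move=> x /set_mem /= /eqP x0; exact: inv_continuous.
Qed.

Section marchenko_pastur.
Context {R : realType}.
Variables alpha beta : {posnum R}.

Local Notation a := (alpha%:num).
Local Notation b := (beta%:num).

Definition mp_left : R := b * (1 - Num.sqrt a) ^+ 2.
Definition mp_right : R := b * (1 + Num.sqrt a) ^+ 2.

Definition mp_density : R -> R :=
  (fun x => Num.sqrt ((mp_right - x) * (x - mp_left)) / (2 * pi * a * b * x))
  \_ `[mp_left, mp_right].

Lemma mp_density_ge0 x : 0 <= mp_density x.
Proof.
apply: restrict_ge0 => {}x /=; rewrite in_itv/= => /andP[lx _].
have x0 : 0 <= x by apply: le_trans lx; rewrite mulr_ge0// sqr_ge0.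
by rewrite divr_ge0 ?sqrtr_ge0// !mulr_ge0// pi_ge0.
Qed.

Lemma measurable_mp_density : measurable_fun [set: R] mp_density.
Proof.
apply/measurable_restrict => //; apply: measurable_funTS.
apply: measurable_funM.
  apply: (@measurableT_comp _ _ _ _ _ _ (@Num.sqrt R)).
    by apply: continuous_measurable_fun; exact: sqrt_continuous.
  by apply: measurable_funM; apply: measurable_funB.
apply: (@measurableT_comp _ _ _ _ _ _ (@GRing.inv R)).
  exact: measurable_invr.
by apply: measurable_funM.
Qed.

Definition mp_abs_cont (A : set (measurableTypeR R)) : \bar R :=
  (\int[lebesgue_measure]_(x in A) (mp_density x)%:E)%E.

Let mp_abs_cont0 : mp_abs_cont set0 = 0%E.
Proof. by rewrite /mp_abs_cont integral_set0. Qed.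

Let mp_abs_cont_ge0 A : (0 <= mp_abs_cont A)%E.
Proof. by apply: integral_ge0 => x _; rewrite lee_fin mp_density_ge0. Qed.

Let mp_abs_cont_sigma_additive : semi_sigma_additive mp_abs_cont.
Proof.
move=> /= F mF tF mUF; rewrite /mp_abs_cont; apply: cvg_toP.
  apply: ereal_nondecreasing_is_cvgn => m n mn.
  by apply: lee_sum_nneg_natr => // k _ _; exact: mp_abs_cont_ge0.
rewrite ge0_integral_bigcup//=.
- by apply/measurable_funTS/measurableT_comp => //; exact: measurable_mp_density.
- by move=> x _; rewrite lee_fin mp_density_ge0.
Qed.

HB.instance Definition _ := isMeasure.Build _ _ _ mp_abs_cont
  mp_abs_cont0 mp_abs_cont_ge0 mp_abs_cont_sigma_additive.

Definition marchenko_pastur : {measure set (measurableTypeR R) -> \bar R} :=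
  measure_add
    (mscale (Num.max (1 - a^-1) 0)%:nng (\d_(0 : measurableTypeR R)))
    mp_abs_cont.

End marchenko_pastur.

Section bernoulli_real.
Context {R : realType}.
Variable p : R.

(* Ber(p) on the line, as the image of the library's measure on bool under
   false |-> 0, true |-> 1; like bernoulli_prob it is Ber(p) for 0 <= p <= 1
   and \d_0 for the other values of p. *)
Definition bernoulli_real : set (measurableTypeR R) -> \bar R :=
  pushforward (bernoulli_prob p) (fun c : bool => c%:R : measurableTypeR R).

Let measurable_natr :
  measurable_fun [set: bool] (fun c : bool => c%:R : measurableTypeR R).
Proof. by []. Qed.

Let bernoulli_real0 : bernoulli_real set0 = 0%E.
Proof. by rewrite /bernoulli_real /pushforward preimage_set0 measure0. Qed.

Let bernoulli_real_ge0 A : (0 <= bernoulli_real A)%E.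
Proof. exact: measure_ge0. Qed.

Let bernoulli_real_sigma_additive : semi_sigma_additive bernoulli_real.
Proof. exact: (measure_semi_sigma_additive (s := pushforward _ _)). Qed.

HB.instance Definition _ := isMeasure.Build _ _ _ bernoulli_real
  bernoulli_real0 bernoulli_real_ge0 bernoulli_real_sigma_additive.

End bernoulli_real.

(* Main.v *)
Require Import Defs.
From HB Require Import structures.
From mathcomp Require Import all_boot all_order all_algebra.
From mathcomp Require Import finmap.
From mathcomp Require Import all_classical all_reals all_analysis.
From mathcomp Require Import measurable_realfun.
From mathcomp Require Import complex.
From mathcomp Require Import zify ring lra.

Set Implicit Arguments.
Unset Strict Implicit.
Unset Printing Implicit Defensive.

Import Order.TTheory GRing.Theory Num.Theory.
Import numFieldNormedType.Exports.

Local Open Scope classical_set_scope.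
Local Open Scope ring_scope.
Local Open Scope complex_scope.

(** The diagram of a fat hook forbids only the edges between two labels of short
    rows. Let [A] and [B] be the generating series, by number of vertices, of the
    trees whose root has one given label of a long, respectively short, row.
    Cutting off the first branch at the root gives
      [A = w + (a1 A + a2 B) A] and [B = w + a1 A B]
    ([nb_long_rec], [nb_short_rec]). The moments of the distribution are, up to
    powers of [l = a1 + a2], the coefficients of [a1 A + a2 B], so for large [z]
    the Cauchy transform is the value of this series at [w = 1 / (l z)].
    Eliminating [A] and [B] yields the cubic equation for large [z]
    ([hook_cubic_far]). The recursions also bound the numbers of trees, hence the
    moments, and force a compact support ([hook_distribution_compact]). The cubic
    propagates to all nonreal [z] by the identity theorem, applied to Taylor
    expansions at points high above the real axis, whose discs of convergence
    fill the half-plane ([cubic_off_axis]).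

    For the R-transform, [z] is a root of the cubic at the point
    [R z + 1 / z], where [R] is the function of the theorem; this is an algebraic
    identity ([hook_cubic_R]). Far from the support the cubic has a single small
    root, and the Cauchy transform is small there, so the two agree
    ([hook_R_transform]).

    For the convolutions, the first summand [p1 / (1 - z)] of the R-transform is
    that of MP(1 / p1, p1). The second one, [compressed_R], is the R-transform of
    the explicit measure [p1 MP(p1 / p2, p2) + p2 delta_0], called [compressed_mp].
    Its S-transform is
      [(1 + z) / ((p1 + z) (p2 + z))],
    the product of the S-transforms [1 / (p1 + z)] of MP(1 / p1, p1) and
    [(1 + z) / (p2 + z)] of Ber(p2); the symmetry in [p1] and [p2] explains why the
    two expressions of the theorem agree. It remains to compute the transforms of
    the Marchenko-Pastur distributions from their densities. The substitution
    [x = c - d cos t] turns the Cauchy transform of a semicircle into the integral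
    of [sin^2 t / (1 - 2 v cos t + v^2)], which the expansion of the kernel in sines
    evaluates ([poisson_integral], [semicircle_cauchy]); the mass of the density is
    obtained from the same formula at points approaching 0 from the left
    ([semicircle_over_x], [marchenko_pastur_cauchy]). *)

(** * Recursions for the numbers of labelled plane trees *)

Definition graft (s t : labelled_tree) : labelled_tree :=
  let: LNode i ts := t in LNode i (s :: ts).

(** Cutting off the first branch at the root splits a tree on at least two
    vertices into two smaller trees; all the recursions below come from this.
    [f] is fuel: every [f >= n] gives the same trees. *)
Fixpoint enum_trees (lam : seq nat) (f n i : nat) : seq labelled_tree :=
  match f with
  | 0 => [::]
  | f'.+1 =>
    if n == 1%N then [:: LNode i [::]]
    else [seq graft st.1 st.2
         | mj <- [seq (m, j) | m <- iota 1 n.-1,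
                 j <- [seq j <- iota 1 (size lam) |
                       in_diagram lam i j && in_diagram lam j i]],
           st <- [seq (s, t) | s <- enum_trees lam f' mj.1 mj.2,
                               t <- enum_trees lam f' (n - mj.1)%N i]]
  end.

Lemma nb_vertices_gt0 t : (0 < nb_vertices t)%N.
Proof. by case: t. Qed.

Lemma graft_inj s s' t t' : graft s t = graft s' t' -> s = s' /\ t = t'.
Proof. by case: t t' => [i ts] [i' ts'] /= [-> -> ->]. Qed.

Lemma mem_enum_trees lam f n i t : (0 < i <= size lam)%N -> (0 < n <= f)%N ->
  (t \in enum_trees lam f n i) =
  [&& is_lambda_tree lam t, root_label t == i & nb_vertices t == n].
Proof.
elim: f n i t => [|f IH] n i t hi; first by case: n.
move=> /andP[n0 nf] /=; case: ifPn => [/eqP ->|n1].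
  rewrite inE; case: t => j [|s ts]; last first.
    have s0 := nb_vertices_gt0 s.
    apply/eqP/idP => [//|/and3P[_ _ /= /eqP]]; lia.
  apply/eqP/idP => [[->]|/=]; first by rewrite /= hi !eqxx.
  by rewrite !andbT => /andP[_ /eqP ->].
have lab j : in_diagram lam i j && in_diagram lam j i -> (0 < j <= size lam)%N.
  by case/andP => _ /andP[].
apply/allpairsPdep/idP.
  move=> [[m j] [[s u] []]] /allpairsPdep[m' [j' []]].
  rewrite mem_iota mem_filter mem_iota => hm /andP[hij hj] [-> ->] /=.
  move=> /allpairsPdep[s' [u' []]].
  rewrite IH ?lab//; last by lia.
  rewrite IH//; last by lia.
  move=> /and3P[ls /eqP rs /eqP ns] /and3P[lu /eqP ru /eqP nu] [-> ->] ->.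
  case: u' ru nu lu => k us /= -> nu /andP[_ lu].
  case/andP: hij => h1 h2.
  rewrite hi eqxx ls rs h1 h2 lu /= ns; apply/eqP; lia.
case: t => k [|s us] /=; first by move=> /and3P[_ _ /eqP]; lia.
move=> /and3P[/andP[_ /andP[/and3P[h1 h2 h3] h4]] /eqP hk /eqP hn].
have s0 := nb_vertices_gt0 s.
exists (nb_vertices s, root_label s), (s, LNode i us); split => /=; last by rewrite hk.
- apply/allpairsPdep; exists (nb_vertices s), (root_label s); split => //.
    by rewrite mem_iota; lia.
  by rewrite mem_filter -hk h1 h2 /= mem_iota; move: h2 => /andP[]; lia.
- apply/allpairsPdep; exists s, (LNode i us); split => //.
    rewrite IH ?h3 ?eqxx//; last by lia.
    by move: h2 => /andP[].
  rewrite IH//; last by lia.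
  rewrite /= hi eqxx -hk h4 /=; lia.
Qed.

Lemma uniq_enum_trees lam f n i : (0 < i <= size lam)%N -> (0 < n <= f)%N ->
  uniq (enum_trees lam f n i).
Proof.
elim: f n i => [//|f IH] n i hi /andP[n0 nf] /=; case: ifPn => [//|n1].
set P := [seq (m, j) | m <- iota 1 n.-1,
                 j <- [seq j <- iota 1 (size lam) |
                       in_diagram lam i j && in_diagram lam j i]].
have hP mj : mj \in P -> [/\ (0 < mj.1 <= f)%N, (0 < n - mj.1 <= f)%N &
    (0 < mj.2 <= size lam)%N].
  move=> /allpairsPdep[m' [j' []]].
  rewrite mem_iota mem_filter mem_iota => hm /andP[/andP[_ hij] hj] -> /=.
  by split; lia.
apply: allpairs_uniq_dep.
- apply: allpairs_uniq; rewrite ?filter_uniq ?iota_uniq//.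
  by move=> [a b] [c d] _ _ [-> ->].
- move=> mj /hP[h1 h2 h3]; apply: allpairs_uniq; rewrite ?IH//.
  by move=> [a b] [c d] _ _ [-> ->].
- move=> p p' /allpairsPdep[mj [st [hmj + ->]]].
  have [h1 h2 h3] := hP _ hmj.
  move=> /allpairsPdep[s [t [+ _ ->]]].
  rewrite mem_enum_trees// => /and3P[_ /eqP rs /eqP ns].
  move=> /allpairsPdep[mj' [st' [hmj' + ->]]].
  have [h1' h2' h3'] := hP _ hmj'.
  move=> /allpairsPdep[s' [t' [+ _ ->]]].
  rewrite mem_enum_trees// => /and3P[_ /eqP rs' /eqP ns'].
  move=> /= /graft_inj[ess ett]; subst s' t'.
  by rewrite (_ : mj = mj')// [LHS]surjective_pairing [RHS]surjective_pairing
    -ns -rs ns' rs'.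
Qed.

Lemma nb_lambda_trees_enum lam k : nb_lambda_trees lam k =
  (\sum_(i <- iota 1 (size lam)) size (enum_trees lam k.+1 k.+1 i))%N.
Proof.
pose s := flatten [seq enum_trees lam k.+1 k.+1 i | i <- iota 1 (size lam)].
have hs t : (t \in s) = is_lambda_tree lam t && (nb_vertices t == k.+1).
  apply/flatten_mapP/idP.
    move=> [l]; rewrite mem_iota => hl; rewrite mem_enum_trees//; last by lia.
    by move=> /and3P[-> _ ->].
  move=> /andP[lt nt]; have hi : (0 < root_label t <= size lam)%N.
    by case: t lt {nt} => i ts /= /andP[].
  exists (root_label t); first by rewrite mem_iota; lia.
  by rewrite mem_enum_trees ?lt ?nt ?eqxx//; lia.
have us : uniq s.
  suff H l : uniq l -> {subset l <= iota 1 (size lam)} ->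
      uniq (flatten [seq enum_trees lam k.+1 k.+1 i | i <- l]).
    by apply: H; rewrite ?iota_uniq.
  elim: l => [//|i l IH] /andP[il ul] sl.
  have hi j : j \in i :: l -> (0 < j <= size lam)%N.
    by move/sl; rewrite mem_iota; lia.
  rewrite map_cons -[flatten _]/(_ ++ flatten _) cat_uniq; apply/and3P; split.
  - by rewrite uniq_enum_trees ?hi ?mem_head//; lia.
  - apply/hasPn => t /flatten_mapP[j jl].
    have hj : j \in i :: l by rewrite inE jl orbT.
    rewrite !mem_enum_trees ?hi ?mem_head//; try lia.
    move=> /and3P[_ /eqP tj _]; apply: contra il => /and3P[_ /eqP <- _].
    by rewrite tj.
  - by apply: IH => // j jl; apply: sl; rewrite inE jl orbT.
rewrite /nb_lambda_trees.
have -> : lambda_trees lam k.+1 = [set` seq_fset tt s].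
  by apply/seteqP; split => t /=; rewrite /lambda_trees /= (seq_fsetE tt) hs.
rewrite set_fsetK size_seq_fset undup_id// size_flatten /shape -map_comp.
by rewrite sumnE big_map.
Qed.

Definition nb_rooted (lam : seq nat) (n i : nat) : nat :=
  size (enum_trees lam n n i).

Arguments nb_rooted : simpl never.

Lemma nb_rooted0 lam i : nb_rooted lam 0 i = 0%N.
Proof. by []. Qed.

Lemma size_enum_trees lam f n i : (0 < i <= size lam)%N -> (0 < n <= f)%N ->
  size (enum_trees lam f n i) = nb_rooted lam n i.
Proof.
move=> hi /andP[n0 nf]; apply/perm_size/uniq_perm.
- by rewrite uniq_enum_trees// n0.
- by rewrite uniq_enum_trees// n0 /=.
- by move=> t; rewrite !mem_enum_trees// n0 /=.
Qed.

(** There is no tree without vertices, so the sum may run over all of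
    [0 <= m <= n]; in this form it is a coefficient of a product of power
    series. *)
Lemma nb_rooted_rec lam n i : (0 < i <= size lam)%N ->
  nb_rooted lam n i = ((n == 1) + \sum_(m < n.+1)
    (\sum_(j <- iota 1 (size lam) | in_diagram lam i j && in_diagram lam j i)
       nb_rooted lam m j) * nb_rooted lam (n - m) i)%N.
Proof.
move=> hi; case: n => [|n].
  by rewrite big_ord1 subnn !nb_rooted0 muln0.
rewrite big_ord_recl big_ord_recr /= subnn nb_rooted0 muln0.
rewrite big1 ?mul0n ?add0n ?addn0//.
rewrite [in LHS]/nb_rooted /=; case: ifPn => [/eqP[->]|n1].
  by rewrite big_ord0.
rewrite add0n size_allpairs_dep sumnE big_map big_allpairs_dep /=.
rewrite -[1%N]/(1 + 0)%N iotaDl big_map.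
have -> : iota 0 n = index_iota 0 n by rewrite /index_iota subn0.
rewrite big_mkord; apply: eq_bigr => m _.
rewrite big_filter big_distrl /=.
rewrite big_seq_cond [RHS]big_seq_cond; apply: eq_bigr => j /andP[].
rewrite mem_iota => hj _.
have mn := ltn_ord m; rewrite size_allpairs /bump /= !add1n.
by rewrite !size_enum_trees//; lia.
Qed.

Section fat_hook_trees.
Variables a1 a2 : nat.
Let lam := fat_hook a1 a2.

Lemma size_fat_hook : size lam = (a1 + a2)%N.
Proof. by rewrite size_cat !size_nseq. Qed.

Lemma in_diagram_fat_hook i j : in_diagram lam i j && in_diagram lam j i =
  [&& (0 < i <= a1 + a2)%N, (0 < j <= a1 + a2)%N & (i <= a1)%N || (j <= a1)%N].
Proof.
rewrite /in_diagram size_fat_hook /lam /fat_hook !nth_cat !nth_nseq size_nseq.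
by case: ifP; case: ifP; try case: ifP; try case: ifP; lia.
Qed.

(** The labels up to [a1] index the long rows of the diagram and may be joined to
    every label; the labels above [a1] index the short rows and may only be
    joined to long ones. The labels [1] and [a1.+1] represent the two blocks. *)
Definition nb_long (n : nat) : nat := nb_rooted lam n 1.
Definition nb_short (n : nat) : nat := nb_rooted lam n a1.+1.

Lemma big_blocks (T : Type) (idx : T) (op : Monoid.com_law idx) (F : nat -> T) (P : pred nat) :
  \big[op/idx]_(j <- iota 1 (a1 + a2) | P j) F j =
  op (\big[op/idx]_(j <- iota 1 a1 | P j) F j) (\big[op/idx]_(j <- iota a1.+1 a2 | P j) F j).
Proof. by rewrite iotaD big_cat add1n. Qed.

(** Two labels of the same block have the same neighbours, so the recursions for
    their numbers of trees coincide term by term. *)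
Lemma nb_rooted_block n i : (0 < i <= a1 + a2)%N ->
  nb_rooted lam n i = if (i <= a1)%N then nb_long n else nb_short n.
Proof.
elim/ltn_ind: n i => n IH i hi.
have key i' : (0 < i' <= a1 + a2)%N -> (i <= a1)%N = (i' <= a1)%N ->
    nb_rooted lam n i = nb_rooted lam n i'.
  move=> hi' ii'; rewrite !nb_rooted_rec ?size_fat_hook//; congr (_ + _)%N.
  apply: eq_bigr => m _; have := ltn_ord m; rewrite ltnS leq_eqVlt => /predU1P[->|mn].
    by rewrite subnn !nb_rooted0 !muln0.
  case: (posnP m) => [->|m0].
    by rewrite big1 // big1.
  congr (_ * _)%N.
    apply: eq_bigl => j; rewrite !in_diagram_fat_hook; lia.
  by rewrite !IH ?ii'//; lia.
case: ifP => ia; apply: key; lia.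
Qed.

Lemma sum_iota_cst p q c (P : pred nat) F :
    (forall j, (p <= j < p + q)%N -> P j /\ F j = c) ->
  (\sum_(j <- iota p q | P j) F j)%N = (q * c)%N.
Proof.
elim: q p => [|q IH] p h /=; first by rewrite big_nil.
have [Pp Fp] := h p ltac:(lia).
by rewrite big_cons Pp Fp IH ?mulSn// => j hj; apply: h; lia.
Qed.

Lemma nb_long_rec n : (0 < a1)%N -> nb_long n = ((n == 1) + \sum_(m < n.+1)
  (a1 * nb_long m + a2 * nb_short m) * nb_long (n - m))%N.
Proof.
move=> a10; rewrite {1}/nb_long nb_rooted_rec ?size_fat_hook; last by lia.
congr (_ + _)%N; apply: eq_bigr => m _; congr (_ * _)%N; rewrite big_blocks /=.
congr (_ + _)%N; apply: sum_iota_cst => j hj; rewrite in_diagram_fat_hook.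
  by rewrite nb_rooted_block; [case: ifP; lia|lia].
by rewrite nb_rooted_block; [case: ifP; lia|lia].
Qed.

Lemma nb_short_rec n : (0 < a2)%N -> nb_short n = ((n == 1) + \sum_(m < n.+1)
  a1 * nb_long m * nb_short (n - m))%N.
Proof.
move=> a20; rewrite {1}/nb_short nb_rooted_rec ?size_fat_hook; last by lia.
congr (_ + _)%N; apply: eq_bigr => m _; congr (_ * _)%N; rewrite big_blocks /=.
rewrite [X in (_ + X)%N]big_seq_cond [X in (_ + X)%N]big1 ?addn0; last first.
  move=> j; rewrite mem_iota in_diagram_fat_hook; lia.
apply: sum_iota_cst => j hj; rewrite in_diagram_fat_hook.
by rewrite nb_rooted_block; [case: ifP; lia|lia].
Qed.

Lemma nb_lambda_trees_fat_hook k :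
  nb_lambda_trees lam k = (a1 * nb_long k.+1 + a2 * nb_short k.+1)%N.
Proof.
rewrite nb_lambda_trees_enum size_fat_hook.
under eq_bigr => j _ do rewrite -/(nb_rooted lam k.+1 j).
rewrite big_blocks /=.
congr (_ + _)%N; apply: (@sum_iota_cst _ _ _ xpredT) => j hj; split => //;
  rewrite nb_rooted_block; try case: ifP; lia.
Qed.

End fat_hook_trees.

(** * Moduli, majorants and limits of complex sequences *)

Section complex_modulus.
Context {R : realType}.
Implicit Types x y z : R[i].

(** The norm of the field [R[i]] takes its values in [R[i]] itself; real-valued
    moduli can be compared by real arithmetic. *)
Definition cmod x : R := Normc.normc x.

Arguments cmod : simpl never.

Lemma cmodE x : `|x| = (cmod x)%:C. Proof. by case: x. Qed.
Lemma cmod_ge0 x : 0 <= cmod x. Proof. by case: x => a b; rewrite sqrtr_ge0. Qed.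
Lemma cmod0 : cmod 0 = 0. Proof. exact: Normc.normc0. Qed.
Lemma cmod1 : cmod 1 = 1. Proof. exact: Normc.normc1. Qed.
Lemma cmodM x y : cmod (x * y) = cmod x * cmod y. Proof. exact: Normc.normcM. Qed.
Lemma cmodV x : cmod x^-1 = (cmod x)^-1. Proof. exact: Normc.normcV. Qed.
Lemma cmodN x : cmod (- x) = cmod x. Proof. exact: normcN. Qed.
Lemma cmodD x y : cmod (x + y) <= cmod x + cmod y. Proof. exact: le_normcD. Qed.
Lemma cmodB x y : cmod (x - y) <= cmod x + cmod y.
Proof. by rewrite -(cmodN y) cmodD. Qed.
Lemma cmodX x n : cmod (x ^+ n) = cmod x ^+ n.
Proof. by elim: n => [|n IH]; rewrite ?expr0 ?cmod1// !exprS cmodM IH. Qed.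
Lemma cmodR (a : R) : cmod a%:C = `|a|.
Proof. by rewrite /cmod /= expr0n addr0 sqrtr_sqr. Qed.
Lemma cmod_nat n : cmod n%:R = n%:R.
Proof. by rewrite -(rmorph_nat (real_complex R)) cmodR normr_nat. Qed.
Lemma cmod_eq0 x : (cmod x == 0) = (x == 0).
Proof. by apply/eqP/eqP => [/Normc.eq0_normc//|->]; exact: cmod0. Qed.
Lemma cmod_gt0 x : (0 < cmod x) = (x != 0).
Proof. by rewrite lt_neqAle cmod_ge0 andbT eq_sym cmod_eq0. Qed.
Lemma cmod_sum I (r : seq I) (P : pred I) (F : I -> R[i]) :
  cmod (\sum_(j <- r | P j) F j) <= \sum_(j <- r | P j) cmod (F j).
Proof.
elim/big_ind2: _ => [|x1 x2 y1 y2 h1 h2|//]; first by rewrite cmod0.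
by apply: le_trans (cmodD _ _) _; exact: lerD.
Qed.
Lemma ler_Re_cmod x : `|complex.Re x| <= cmod x.
Proof. by rewrite -lecR -cmodE; exact: normc_ge_Re. Qed.
Lemma ler_Im_cmod x : `|complex.Im x| <= cmod x.
Proof.
case: x => a b; rewrite /cmod /= -sqrtr_sqr ler_sqrt ?lerDr ?sqr_ge0//.
by rewrite addr_ge0 ?sqr_ge0.
Qed.
Lemma ler_cmod_ReIm x : cmod x <= `|complex.Re x| + `|complex.Im x|.
Proof.
rewrite [in cmod x](complexE x); apply: le_trans (cmodD _ _) _.
by rewrite cmodM !cmodR [cmod 'i]/cmod /= expr0n add0r expr1n sqrtr1 mul1r.
Qed.
Lemma ler_cmod_sub x y : cmod x - cmod y <= cmod (x - y).
Proof. by rewrite lerBlDr -{1}(subrK y x) cmodD. Qed.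

Lemma cvg_cmod_geom (u : nat -> R[i]^o) (l : R[i]^o) (K q : R) : 0 <= q < 1 ->
  (forall n, cmod (u n - l) <= K * q ^+ n) -> u n @[n --> \oo] --> l.
Proof.
move=> /andP[q0 q1] h.
have h0 : (K * q ^+ n) @[n --> \oo] --> (0 : R).
  rewrite -[X in _ --> X](mulr0 K); apply: cvgMr; apply: cvg_expr; by rewrite ger0_norm.
apply/cvgrPdist_lt => -[e e'] /=; rewrite ltcE /= => /andP[/eqP -> e0].
move/cvgrPdist_lt : h0 => /(_ _ e0); apply: filterS => n /=.
rewrite sub0r normrN => hn; rewrite -normrN opprB cmodE ltcR; apply: le_lt_trans (h n) _.
exact: le_lt_trans (ler_norm _) hn.
Qed.

End complex_modulus.
Arguments cmod : simpl never.

Section majorant.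
Context {R : realType}.
Implicit Types (p q : {poly R[i]}) (rho : R).

Definition abs_poly p : {poly R} := \poly_(k < size p) cmod p`_k.

Lemma coef_abs_poly p k : (abs_poly p)`_k = cmod p`_k.
Proof.
by rewrite coef_poly; case: ltnP => // h; rewrite nth_default ?cmod0.
Qed.

Lemma le_horner (f g : {poly R}) (x : R) : 0 <= x ->
  (forall k, f`_k <= g`_k) -> f.[x] <= g.[x].
Proof.
move=> x0 fg; pose n := maxn (size f) (size g).
rewrite (@horner_coef_wide _ n f) ?leq_maxl// (@horner_coef_wide _ n g) ?leq_maxr//.
by apply: ler_sum => k _; rewrite ler_wpM2r ?exprn_ge0.
Qed.

(** This is a submultiplicative seminorm on polynomials which bounds them on the
    disc of radius [rho]; it plays the part of the norm of absolutely convergent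
    power series. *)
Definition majorant rho p : R := (abs_poly p).[rho].

Lemma majorant_ge0 rho p : 0 <= rho -> 0 <= majorant rho p.
Proof.
move=> r0; rewrite -(horner0 rho); apply: le_horner => // k.
by rewrite coef0 coef_abs_poly cmod_ge0.
Qed.

Lemma majorantD rho p q : 0 <= rho ->
  majorant rho (p + q) <= majorant rho p + majorant rho q.
Proof.
move=> r0; rewrite /majorant -hornerD; apply: le_horner => // k.
by rewrite coefD !coef_abs_poly coefD cmodD.
Qed.

Lemma majorantN rho p : majorant rho (- p) = majorant rho p.
Proof.
by congr horner; apply/polyP => k; rewrite !coef_abs_poly coefN cmodN.
Qed.

Lemma majorantM rho p q : 0 <= rho ->
  majorant rho (p * q) <= majorant rho p * majorant rho q.
Proof.
move=> r0; rewrite /majorant -hornerM; apply: le_horner => // k.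
rewrite coefM coef_abs_poly coefM; apply: le_trans (cmod_sum _ _ _) _.
by apply: ler_sum => j _; rewrite !coef_abs_poly cmodM.
Qed.

Lemma majorantC rho (c : R[i]) : majorant rho c%:P = cmod c.
Proof.
rewrite /majorant (_ : abs_poly _ = (cmod c)%:P) ?hornerC//.
by apply/polyP => k; rewrite coef_abs_poly !coefC; case: eqP; rewrite ?cmod0.
Qed.

Lemma majorantX rho : majorant rho 'X = rho.
Proof.
rewrite /majorant (_ : abs_poly _ = 'X) ?hornerX//.
by apply/polyP => k; rewrite coef_abs_poly !coefX cmod_nat.
Qed.

Lemma majorant_poly rho n (a : nat -> R[i]) :
  majorant rho (\poly_(k < n) a k) = \sum_(k < n) cmod (a k) * rho ^+ k.
Proof.
rewrite /majorant (_ : abs_poly _ = \poly_(k < n) cmod (a k)) ?horner_poly//.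
apply/polyP => k; rewrite coef_abs_poly !coef_poly; case: ifP => //.
by rewrite cmod0.
Qed.

(** Shrinking the radius by a factor [t] multiplies each term of degree at least
    [N] by at most [t ^+ N]. *)
Lemma cmod_horner_tail rho (t : R) p (h : R[i]) N : 0 <= rho -> 0 <= t <= 1 ->
    cmod h <= t * rho -> (forall k, (k < N)%N -> p`_k = 0) ->
  cmod p.[h] <= majorant rho p * t ^+ N.
Proof.
move=> r0 /andP[t0 t1] hr pN; rewrite horner_coef; apply: le_trans (cmod_sum _ _ _) _.
rewrite /majorant (@horner_coef_wide _ (size p)) ?size_poly// mulr_suml.
apply: ler_sum => k _; rewrite cmodM cmodX coef_abs_poly.
have [/pN ->|kN] := ltnP k N; first by rewrite cmod0 !mul0r.
rewrite -mulrA ler_wpM2l ?cmod_ge0//.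
apply: (@le_trans _ _ ((t * rho) ^+ k)).
  by rewrite lerXn2r// nnegrE ?cmod_ge0// mulr_ge0.
rewrite exprMn mulrC ler_wpM2l ?exprn_ge0//.
by rewrite ler_wiXn2l.
Qed.

End majorant.

Section complex_limits.
Context {R : realType}.
Implicit Types (u v : nat -> R[i]^o) (a b : R[i]^o).

Lemma cvg_seqB u v a b : u n @[n --> \oo] --> a ->
  v n @[n --> \oo] --> b -> (u n - v n) @[n --> \oo] --> a - b.
Proof. by move=> h k; have := cvgB h k; apply. Qed.

Lemma cvg_seqD u v a b : u n @[n --> \oo] --> a ->
  v n @[n --> \oo] --> b -> (u n + v n) @[n --> \oo] --> a + b.
Proof. by move=> h k; have := cvgD h k; apply. Qed.

Lemma cvg_seqM u v a b : u n @[n --> \oo] --> a ->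
  v n @[n --> \oo] --> b -> (u n * v n) @[n --> \oo] --> a * b.
Proof. by move=> h k; have := cvgM h k; apply. Qed.

Lemma cvg_seq_cst a : (fun _ : nat => a) @ \oo --> a.
Proof. exact: cvg_cst. Qed.

Lemma lim_cmod u a : u n @[n --> \oo] --> a ->
  forall e : R, 0 < e -> exists N, forall n, (N <= n)%N -> cmod (u n - a) < e.
Proof.
move=> /cvgrPdist_lt ua e e0.
have /ua : 0 < e%:C :> R[i] by rewrite ltcR.
move=> [N _ hN]; exists N => n Nn; have := hN n Nn.
by rewrite /= -normrN opprB cmodE ltcR.
Qed.

End complex_limits.
Arguments cvg_seq_cst {R} a.

(** * The cubic satisfied by the generating series of trees *)

(** Here [x n] and [y n] are the errors made in the recursions of the two blocks
    when both series are cut at [n], and [c n] is the corresponding value of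
    [b1 * A + b2 * B]. With [A = (w + x) / (1 - c)] from the first recursion, the
    second one becomes the hypothesis, from which [A] and [B] are gone. *)
Lemma cubic_limit {R : realType} (c x y : nat -> R[i]^o) (b1 b2 w G : R[i]^o) :
    c n @[n --> \oo] --> G ->
    x n @[n --> \oo] --> (0 : R[i]^o) -> y n @[n --> \oo] --> (0 : R[i]^o) ->
    (forall n, (c n * (1 - c n) - b1 * w - b1 * x n) * (1 - c n - b1 * w - b1 * x n)
       = b2 * (w + y n) * ((1 - c n) * (1 - c n))) ->
  (G * (1 - G) - b1 * w) * (1 - G - b1 * w) = b2 * w * (1 - G) ^+ 2.
Proof.
move=> lc lx ly E.
have l1c := cvg_seqB (cvg_seq_cst 1) lc.
have lax := cvg_seqM (cvg_seq_cst b1) lx.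
have lbw := cvg_seq_cst (b1 * w).
have lF := cvg_seqM (cvg_seqB (cvg_seqB (cvg_seqM lc l1c) lbw) lax) (cvg_seqB (cvg_seqB l1c lbw) lax).
have lG := cvg_seqM (cvg_seqM (cvg_seq_cst b2) (cvg_seqD (cvg_seq_cst w) ly)) (cvg_seqM l1c l1c).
move: lF; under eq_fun do rewrite E; move=> /(cvg_unique (@norm_hausdorff _ _) lG).
by rewrite mulr0 !subr0 addr0 expr2 => ->.
Qed.

Section tree_series.
Context {R : realType}.
Variables a1 a2 : nat.
Hypotheses (a1_gt0 : (0 < a1)%N) (a2_gt0 : (0 < a2)%N).
Let A := nb_long a1 a2.
Let B := nb_short a1 a2.
Let rho : R := (4 * (a1 + a2)%:R)^-1.

Let l0 : 0 < (a1 + a2)%:R :> R.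
Proof. by rewrite ltr0n addn_gt0 a1_gt0. Qed.

Let rho_gt0 : 0 < rho. Proof. by rewrite invr_gt0 mulr_gt0. Qed.

(** If the partial sums [x] and [y] at [rho] are at most [2 * rho], the recursion
    bounds the next ones by [rho + (a1 * x + a2 * y) * x] and
    [rho + a1 * x * y]. The choice of [rho] makes [a1 * x + a2 * y <= 1 / 2], so
    both are again at most [2 * rho]. *)
Lemma tree_sum_bound N :
  \sum_(k < N) (A k)%:R * rho ^+ k <= 2 * rho /\
  \sum_(k < N) (B k)%:R * rho ^+ k <= 2 * rho.
Proof.
pose pA n : {poly R} := \poly_(k < n) (A k)%:R.
pose pB n : {poly R} := \poly_(k < n) (B k)%:R.
have E (F : nat -> nat) :
    \sum_(k < N) (F k)%:R * rho ^+ k = (\poly_(k < N) (F k)%:R).[rho] :> R.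
  by rewrite horner_poly.
rewrite !E -/(pA N) -/(pB N) {E}.
elim: N => [|N [IHA IHB]].
  by rewrite /pA /pB !poly_def !big_ord0 !horner0 !mulr_ge0// ltW.
have A0 n k : 0 <= (pA n)`_k by rewrite coef_poly; case: ifP.
have B0 n k : 0 <= (pB n)`_k by rewrite coef_poly; case: ifP.
(* The cut at [N.+1] is bounded coefficientwise by the recursion applied to the
   cuts at [N], since each product involves smaller trees only. *)
have hA : (pA N.+1).[rho] <= ('X + (a1%:R *: pA N + a2%:R *: pB N) * pA N).[rho].
  apply: le_horner => [|k]; first exact: ltW.
  rewrite coefD coefX coefM coef_poly; case: ltnP => kN; last first.
    rewrite addr_ge0// sumr_ge0// => j _.
    by rewrite mulr_ge0// coefD !coefZ addr_ge0// mulr_ge0.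
  rewrite /A nb_long_rec// natrD; apply: lerD => //.
  rewrite natr_sum; apply: ler_sum => j _.
  have := ltn_ord j; rewrite ltnS => jk.
  have [->|j0] := posnP j.
    rewrite /nb_long /nb_short !nb_rooted0 !muln0 mul0n mulr_ge0//.
    by rewrite coefD !coefZ addr_ge0// mulr_ge0.
  have [jk'|jk'] := eqVneq (j : nat) k.
    rewrite jk' subnn /nb_long nb_rooted0 muln0 mulr_ge0//.
    by rewrite coefD !coefZ addr_ge0// mulr_ge0.
  rewrite natrM coefD !coefZ !coef_poly.
  have -> : (j < N)%N by clear -jk kN j0 jk'; lia.
  have -> : (k - j < N)%N by clear -jk kN j0 jk'; lia.
  by rewrite ?natrD ?natrM//.
have hB : (pB N.+1).[rho] <= ('X + a1%:R *: pA N * pB N).[rho].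
  apply: le_horner => [|k]; first exact: ltW.
  rewrite coefD coefX coefM coef_poly; case: ltnP => kN; last first.
    rewrite addr_ge0// sumr_ge0// => j _.
    by rewrite mulr_ge0// !coefZ mulr_ge0.
  rewrite /B nb_short_rec// natrD; apply: lerD => //.
  rewrite natr_sum; apply: ler_sum => j _.
  have := ltn_ord j; rewrite ltnS => jk.
  have [->|j0] := posnP j.
    rewrite /nb_long !nb_rooted0 !muln0 mul0n mulr_ge0//.
    by rewrite !coefZ mulr_ge0.
  have [jk'|jk'] := eqVneq (j : nat) k.
    rewrite jk' subnn /nb_short nb_rooted0 muln0 mulr_ge0//.
    by rewrite !coefZ mulr_ge0.
  rewrite natrM !coefZ !coef_poly.
  have -> : (j < N)%N by clear -jk kN j0 jk'; lia.
  have -> : (k - j < N)%N by clear -jk kN j0 jk'; lia.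
  by rewrite ?natrM//.
have r0 n : 0 <= (pA n).[rho] /\ 0 <= (pB n).[rho].
  split; rewrite -(horner0 rho); apply: le_horner; rewrite ?ltW// => k;
    by rewrite coef0.
have [xA xB] := r0 N; move: hA hB; rewrite !hornerE.
set x := (pA N).[rho] in IHA xA *; set y := (pB N).[rho] in IHB xB *.
have e : (a1%:R + a2%:R) * (4 * rho) = 1 :> R.
  by rewrite -natrD mulrA [_ * 4]mulrC mulfV// gt_eqF// mulr_gt0.
have b1 : 0 <= a1%:R :> R by []. have b2 : 0 <= a2%:R :> R by [].
move: (a1%:R : R) (a2%:R : R) e b1 b2 => b1 b2 e b10 b20 hA hB.
have s1 : b1 * x + b2 * y <= 2^-1.
  have : b1 * x + b2 * y <= b1 * (2 * rho) + b2 * (2 * rho).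
    by rewrite lerD// ler_wpM2l.
  lra.
have s2 : b1 * x <= 2^-1 by have := mulr_ge0 b20 xB; lra.
split; [apply: le_trans hA _|apply: le_trans hB _].
- have : (b1 * x + b2 * y) * x <= 2^-1 * (2 * rho) by rewrite ler_pM// addr_ge0// mulr_ge0.
  lra.
- have : b1 * x * y <= 2^-1 * (2 * rho) by rewrite ler_pM// mulr_ge0.
  lra.
Qed.

Lemma tree_count_bound n :
  ((a1 * A n + a2 * B n)%N%:R : R) <= 2^-1 * (4 * (a1 + a2)%:R) ^+ n.
Proof.
have hx (F : nat -> nat) : \sum_(k < n.+1) (F k)%:R * rho ^+ k <= 2 * rho ->
    (F n)%:R <= 2 * rho * (4 * (a1 + a2)%:R) ^+ n.
  rewrite big_ord_recr /= => h; rewrite -ler_pdivrMr; last first.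
    by rewrite exprn_gt0// mulr_gt0.
  rewrite -exprVn; apply: le_trans h; rewrite -/rho lerDr.
  by apply: sumr_ge0 => k _; rewrite mulr_ge0// exprn_ge0// ltW.
have [/hx hA /hx hB] := tree_sum_bound n.+1.
rewrite natrD !natrM.
have -> : 2^-1 * (4 * (a1 + a2)%:R) ^+ n =
   a1%:R * (2 * rho * (4 * (a1 + a2)%:R) ^+ n) +
   a2%:R * (2 * rho * (4 * (a1 + a2)%:R) ^+ n) :> R.
  rewrite -mulrDl -natrD /rho invfM !mulrA.
  move: ((a1 + a2)%:R : R) l0 => l hl; congr (_ * _).
  by field; rewrite gt_eqF.
by apply: lerD; apply: ler_wpM2l.
Qed.

(** The recursions are exact for the power series. For the truncations they hold
    up to polynomials that vanish to order [n] at 0 and have bounded majorants at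
    [rho], hence tend to 0 geometrically on the disc of radius [rho / 2]. *)
Lemma tree_series_cubic (w G : R[i]^o) (K : R) : cmod w <= 2^-1 * rho ->
  (forall N, cmod (G - \sum_(k < N) (a1 * A k + a2 * B k)%N%:R * w ^+ k) <= K * 2^-1 ^+ N) ->
  (G * (1 - G) - a1%:R * w) * (1 - G - a1%:R * w) = a2%:R * w * (1 - G) ^+ 2.
Proof.
move=> hw hG.
pose pA n : {poly R[i]} := \poly_(k < n) (A k)%:R.
pose pB n : {poly R[i]} := \poly_(k < n) (B k)%:R.
pose pC n := a1%:R%:P * pA n + a2%:R%:P * pB n.
pose e1 n := pA n - 'X - pC n * pA n.
pose e2 n := pB n - 'X - a1%:R%:P * pA n * pB n.
have r0 : 0 <= rho by exact: ltW.
have mA n : majorant rho (pA n) <= 2 * rho.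
  rewrite majorant_poly; have [+ _] := tree_sum_bound n.
  by under eq_bigr do rewrite -cmod_nat.
have mB n : majorant rho (pB n) <= 2 * rho.
  rewrite majorant_poly; have [_ +] := tree_sum_bound n.
  by under eq_bigr do rewrite -cmod_nat.
have mM p q x y : majorant rho p <= x -> majorant rho q <= y ->
   majorant rho (p * q) <= x * y.
  by move=> hp hq; apply: le_trans (majorantM _ _ r0) _; rewrite ler_pM ?majorant_ge0.
have mD p q x y : majorant rho p <= x -> majorant rho q <= y ->
   majorant rho (p + q) <= x + y.
  by move=> hp hq; apply: le_trans (majorantD _ _ r0) _; rewrite lerD.
have mN p x : majorant rho p <= x -> majorant rho (- p) <= x by rewrite majorantN.
have mn n : majorant rho (n%:R%:P : {poly R[i]}) <= n%:R.
  by rewrite majorantC cmod_nat.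
have mX : majorant rho ('X : {poly R[i]}) <= rho by rewrite majorantX.
have me1 : exists K1, forall n, majorant rho (e1 n) <= K1.
  by eexists => n; rewrite /e1 /pC; apply: mD (mD _ _ _ _ (mA n) (mN _ _ mX)) (mN _ _ (mM _ _ _ _ (mD _ _ _ _ (mM _ _ _ _ (mn _) (mA n)) (mM _ _ _ _ (mn _) (mB n))) (mA n))).
have me2 : exists K2, forall n, majorant rho (e2 n) <= K2.
  by eexists => n; apply: mD (mD _ _ _ _ (mB n) (mN _ _ mX)) (mN _ _ (mM _ _ _ _ (mM _ _ _ _ (mn _) (mA n)) (mB n))).
have ce1 n k : (k < n)%N -> (e1 n)`_k = 0.
  move=> kn; rewrite !coefB coefX coefM coef_poly kn /A nb_long_rec// natrD.
  rewrite [X in X - _ - _]addrC addrK; apply/eqP; rewrite subr_eq0; apply/eqP.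
  rewrite natr_sum; apply: eq_bigr => j _; have := ltn_ord j; rewrite ltnS => jk.
  rewrite /pC coefD !coefCM !coef_poly (leq_ltn_trans jk kn).
  by rewrite (leq_ltn_trans (leq_subr _ _) kn) natrM natrD !natrM.
have ce2 n k : (k < n)%N -> (e2 n)`_k = 0.
  move=> kn; rewrite !coefB coefX coefM coef_poly kn /B nb_short_rec// natrD.
  rewrite [X in X - _ - _]addrC addrK; apply/eqP; rewrite subr_eq0; apply/eqP.
  rewrite natr_sum; apply: eq_bigr => j _; have := ltn_ord j; rewrite ltnS => jk.
  rewrite !coefCM !coef_poly (leq_ltn_trans jk kn).
  by rewrite (leq_ltn_trans (leq_subr _ _) kn) !natrM.
have half : 0 <= (2^-1 : R) < 1 by lra.
have le0 (e : nat -> {poly R[i]}) : (exists K1, forall n, majorant rho (e n) <= K1) ->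
    (forall n k, (k < n)%N -> (e n)`_k = 0) ->
    ((e n).[w] : R[i]^o) @[n --> \oo] --> (0 : R[i]^o).
  move=> [K1 hK1] he; apply: (@cvg_cmod_geom _ _ _ K1 2^-1) => // n.
  rewrite subr0; apply: le_trans (cmod_horner_tail r0 _ hw (he n)) _; first by lra.
  by rewrite ler_wpM2r// exprn_ge0//; lra.
have l1 := le0 _ me1 ce1; have l2 := le0 _ me2 ce2.
have lC : ((pC n).[w] : R[i]^o) @[n --> \oo] --> G.
  apply: (@cvg_cmod_geom _ _ _ K 2^-1) => // n.
  rewrite -cmodN opprB; apply: le_trans (hG n); rewrite le_eqVlt; apply/orP; left.
  apply/eqP; congr (cmod (_ - _)).
  rewrite /pC hornerD !hornerCM !horner_poly !mulr_sumr -big_split /=.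
  by apply: eq_bigr => k _; rewrite natrD !natrM mulrDl !mulrA.
apply: (cubic_limit lC l1 l2) => n.
rewrite /e1 /e2 /pC !(hornerD, hornerN, hornerM, hornerX, hornerC).
move: (pA n).[w] (pB n).[w] => x y; ring.
Qed.

End tree_series.

(** * Integrals of complex-valued functions *)

Section complex_integral.
Context d (T : measurableType d) (R : realType).
Implicit Types (mu : {measure set T -> \bar R}) (D : set T) (f g : T -> R[i]).

Definition cint mu D f : R[i] :=
  (\int[mu]_(x in D) complex.Re (f x)) +i* (\int[mu]_(x in D) complex.Im (f x)).

Definition cintegrable mu D f :=
  mu.-integrable D (EFin \o (fun x => complex.Re (f x))) /\
  mu.-integrable D (EFin \o (fun x => complex.Im (f x))).

Definition cmeasurable D f :=
  measurable_fun D (fun x => complex.Re (f x)) /\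
  measurable_fun D (fun x => complex.Im (f x)).

Lemma complex_ReM (x y : R[i]) : complex.Re (x * y) =
  complex.Re x * complex.Re y - complex.Im x * complex.Im y.
Proof. by case: x y => a b []. Qed.

Lemma complex_ImM (x y : R[i]) : complex.Im (x * y) =
  complex.Re x * complex.Im y + complex.Im x * complex.Re y.
Proof. by case: x y => a b []. Qed.

Lemma cmeasurable_cst D (c : R[i]) : cmeasurable D (fun=> c).
Proof. by split; exact: measurable_cst. Qed.

Lemma cmeasurable_real D (f : T -> R) : measurable_fun D f ->
  cmeasurable D (fun x => (f x)%:C).
Proof. by move=> mf; split => //=; exact: measurable_cst. Qed.

Lemma cmeasurableD D f g : cmeasurable D f -> cmeasurable D g ->
  cmeasurable D (fun x => f x + g x).
Proof.
move=> [f1 f2] [g1 g2]; split.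
  rewrite (_ : (fun _ => _) = (fun x => complex.Re (f x) + complex.Re (g x))).
    exact: measurable_funD.
  by apply/funext => x; rewrite raddfD.
rewrite (_ : (fun _ => _) = (fun x => complex.Im (f x) + complex.Im (g x))).
  exact: measurable_funD.
by apply/funext => x; rewrite raddfD.
Qed.

Lemma cmeasurableN D f : cmeasurable D f -> cmeasurable D (fun x => - f x).
Proof.
move=> [f1 f2]; split.
  rewrite (_ : (fun _ => _) = (fun x => - complex.Re (f x))).
    exact: measurableT_comp.
  by apply/funext => x; rewrite raddfN.
rewrite (_ : (fun _ => _) = (fun x => - complex.Im (f x))).
  exact: measurableT_comp.
by apply/funext => x; rewrite raddfN.
Qed.

Lemma cmeasurableM D f g : cmeasurable D f -> cmeasurable D g ->
  cmeasurable D (fun x => f x * g x).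
Proof.
move=> [f1 f2] [g1 g2]; split.
  rewrite (_ : (fun _ => _) = (fun x => complex.Re (f x) * complex.Re (g x)
      - complex.Im (f x) * complex.Im (g x))).
    by apply: measurable_funB; exact: measurable_funM.
  by apply/funext => x; rewrite complex_ReM.
rewrite (_ : (fun _ => _) = (fun x => complex.Re (f x) * complex.Im (g x)
      + complex.Im (f x) * complex.Re (g x))).
  by apply: measurable_funD; exact: measurable_funM.
by apply/funext => x; rewrite complex_ImM.
Qed.

Lemma cmeasurableX D f n : cmeasurable D f -> cmeasurable D (fun x => f x ^+ n).
Proof.
move=> mf; elim: n => [|n IH]; first exact: cmeasurable_cst.
rewrite (_ : (fun _ => _) = (fun x => f x * f x ^+ n)); first exact: cmeasurableM.
by apply/funext => x; rewrite exprS.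
Qed.

Lemma cmeasurableV D f : cmeasurable D f -> cmeasurable D (fun x => (f x)^-1).
Proof.
move=> [f1 f2].
have mn : measurable_fun D
    (fun x => (complex.Re (f x) ^+ 2 + complex.Im (f x) ^+ 2)^-1).
  apply: (@measurableT_comp _ _ _ _ _ _ (@GRing.inv R)).
    exact: measurable_invr.
  by apply: measurable_funD; exact: measurable_funX.
have := cmeasurableM (cmeasurable_real mn)
  (cmeasurableD (cmeasurable_real f1) (cmeasurableN (cmeasurableM (cmeasurable_cst D 'i) (cmeasurable_real f2)))).
congr cmeasurable; apply/funext => x; rewrite invc_norm -add_Re2_Im2 fmorphV.
by congr (_ * _); case: (f x) => u v /=; simpc.
Qed.

Lemma cintegrable_bounded mu D f (K : R) : measurable D -> (mu D < +oo)%E ->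
  cmeasurable D f -> (forall x, D x -> cmod (f x) <= K) -> cintegrable mu D f.
Proof.
move=> mD muD [f1 f2] fK; split; apply: measurable_bounded_integrable => //;
  exists K; split; rewrite ?num_real// => M KM x Dx /=.
  exact: le_trans (ler_Re_cmod _) (le_trans (fK _ Dx) (ltW KM)).
exact: le_trans (ler_Im_cmod _) (le_trans (fK _ Dx) (ltW KM)).
Qed.

Lemma eq_cint mu D f g : (forall x, D x -> f x = g x) -> cint mu D f = cint mu D g.
Proof.
move=> fg; rewrite /cint; congr Complex; apply: eq_Rintegral => x /set_mem Dx;
  by rewrite fg.
Qed.

Lemma cintD mu D f g : measurable D -> cintegrable mu D f -> cintegrable mu D g ->
  cint mu D (fun x => f x + g x) = cint mu D f + cint mu D g.
Proof.
move=> mD [f1 f2] [g1 g2]; rewrite /cint.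
under [in LHS]eq_Rintegral do rewrite raddfD /=.
under [X in _ +i* X]eq_Rintegral do rewrite raddfD /=.
by rewrite !RintegralD.
Qed.

Lemma cintegrableD mu D f g : measurable D ->
  cintegrable mu D f -> cintegrable mu D g -> cintegrable mu D (fun x => f x + g x).
Proof.
move=> mD [f1 f2] [g1 g2]; split.
  rewrite (_ : _ \o _ = ((EFin \o (fun x => complex.Re (f x))) \+
     (EFin \o (fun x => complex.Re (g x))))%E); first exact: integrableD.
  by apply/funext => x; rewrite /= raddfD.
rewrite (_ : _ \o _ = ((EFin \o (fun x => complex.Im (f x))) \+
     (EFin \o (fun x => complex.Im (g x))))%E); first exact: integrableD.
by apply/funext => x; rewrite /= raddfD.
Qed.

Lemma cintegrableZ mu D (c : R[i]) f : measurable D ->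
  cintegrable mu D f -> cintegrable mu D (fun x => c * f x).
Proof.
move=> mD [f1 f2]; split.
  rewrite (_ : _ \o _ = (fun x => (complex.Re c)%:E * (complex.Re (f x))%:E
      - (complex.Im c)%:E * (complex.Im (f x))%:E)%E).
    by apply: integrableB => //; exact: integrableZl.
  by apply/funext => x; rewrite /= complex_ReM.
rewrite (_ : _ \o _ = (fun x => (complex.Re c)%:E * (complex.Im (f x))%:E
      + (complex.Im c)%:E * (complex.Re (f x))%:E)%E).
  by apply: integrableD => //; exact: integrableZl.
by apply/funext => x; rewrite /= complex_ImM.
Qed.

Lemma cintZ mu D (c : R[i]) f : measurable D -> cintegrable mu D f ->
  cint mu D (fun x => c * f x) = c * cint mu D f.
Proof.
move=> mD [f1 f2]; rewrite /cint.
have Z (k : R) (g : T -> R) : mu.-integrable D (EFin \o g) ->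
    mu.-integrable D (EFin \o (fun x => k * g x)).
  move=> ig; rewrite (_ : _ \o _ = (fun x => k%:E * (g x)%:E)%E)//.
  exact: integrableZl.
have -> : \int[mu]_(x in D) complex.Re (c * f x) =
    \int[mu]_(x in D) (complex.Re c * complex.Re (f x)
      - complex.Im c * complex.Im (f x)).
  by apply: eq_Rintegral => x _; rewrite complex_ReM.
have -> : \int[mu]_(x in D) complex.Im (c * f x) =
    \int[mu]_(x in D) (complex.Re c * complex.Im (f x)
      + complex.Im c * complex.Re (f x)).
  by apply: eq_Rintegral => x _; rewrite complex_ImM.
rewrite RintegralB ?RintegralD ?RintegralZl//; try exact: Z.
by case: c.
Qed.

Lemma cint_real mu D (f : T -> R) :
  cint mu D (fun x => (f x)%:C) = (\int[mu]_(x in D) f x)%:C.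
Proof.
by rewrite /cint /=; congr Complex; rewrite /Rintegral integral0_eq.
Qed.

(** Bounding the real and imaginary parts separately costs a factor 2, harmless in
    the sequel. *)
Lemma cint_bound mu D f (K : R) : measurable D -> (mu D < +oo)%E -> 0 <= K ->
  cintegrable mu D f -> (forall x, D x -> cmod (f x) <= K) ->
  cmod (cint mu D f) <= 2 * K * fine (mu D).
Proof.
move=> mD muD K0 [f1 f2] fK; apply: le_trans (ler_cmod_ReIm _) _ => /=.
have B (g : T -> R) : mu.-integrable D (EFin \o g) ->
    (forall x, D x -> `|g x| <= K) -> `|\int[mu]_(x in D) g x| <= K * fine (mu D).
  move=> ig gK; apply: le_trans (le_normr_Rintegral mD ig) _.
  rewrite -Rintegral_cst//; apply: le_Rintegral => //.
  - exact: integrable_norm.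
  - by apply/integrableP; split; [exact: measurable_cst|
      rewrite integral_cst//= lte_mul_pinfty ?lee_fin].
rewrite mulr2n !mulrDl mul1r; apply: lerD; apply: B => // x Dx.
  exact: le_trans (ler_Re_cmod _) (fK _ Dx).
exact: le_trans (ler_Im_cmod _) (fK _ Dx).
Qed.

Lemma cintegrable_sum mu D (F : nat -> T -> R[i]) N : measurable D ->
  (forall k, cintegrable mu D (F k)) ->
  cintegrable mu D (fun x => \sum_(k < N) F k x).
Proof.
move=> mD iF; elim: N => [|N IH].
  rewrite (_ : (fun _ => _) = fun=> 0 :> R[i]).
    by split => /=; exact: integrable0.
  by apply/funext => x; rewrite big_ord0.
rewrite (_ : (fun _ => _) = fun x => \sum_(k < N) F k x + F N x).
  exact: cintegrableD.
by apply/funext => x; rewrite big_ord_recr.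
Qed.

Lemma cint_sum mu D (F : nat -> T -> R[i]) N : measurable D ->
  (forall k, cintegrable mu D (F k)) ->
  cint mu D (fun x => \sum_(k < N) F k x) = \sum_(k < N) cint mu D (F k).
Proof.
move=> mD iF; elim: N => [|N IH].
  rewrite big_ord0 (@eq_cint _ _ _ (fun=> (0 : R)%:C)); last by move=> x _; rewrite big_ord0.
  by rewrite cint_real /Rintegral integral0_eq.
rewrite big_ord_recr /= -IH -cintD//; last exact: cintegrable_sum.
by apply: eq_cint => x _; rewrite big_ord_recr.
Qed.

End complex_integral.

Section cauchy_expansion.
Context {R : realType}.
Implicit Types (mu : {measure set (measurableTypeR R) -> \bar R}).

Lemma cmeasurable_resolvent D (z : R[i]) :
  cmeasurable D (fun x : measurableTypeR R => (z - x%:C)^-1).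
Proof.
apply: cmeasurableV; apply: cmeasurableD; first exact: cmeasurable_cst.
by apply: cmeasurableN; apply: cmeasurable_real; exact: measurable_id.
Qed.

Lemma integral_carrier mu D (f : measurableTypeR R -> \bar R) : measurable D ->
  measurable_fun setT f -> mu (~` D) = 0%E ->
  (\int[mu]_x f x = \int[mu]_(x in D) f x)%E.
Proof.
move=> mD mf mu0; rewrite [LHS]integralE [RHS]integralE.
rewrite (@ge0_negligible_integral _ _ _ mu setT (~` D) (f^\+)%E)//; last 2 first.
- exact: measurableC.
- exact: measurable_funepos.
rewrite (@ge0_negligible_integral _ _ _ mu setT (~` D) (f^\-)%E)//; last 2 first.
- exact: measurableC.
- exact: measurable_funeneg.
by rewrite setTD setCK.
Qed.

Lemma cauchy_cint mu D z : measurable D -> mu (~` D) = 0%E ->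
  cauchy_transform mu z = cint mu D (fun x => (z - x%:C)^-1).
Proof.
move=> mD mu0; have [f1 f2] := cmeasurable_resolvent setT z.
by rewrite /cauchy_transform /cint; congr Complex; rewrite /Rintegral;
  congr fine; apply: integral_carrier => //; exact/measurable_EFinP.
Qed.

(** The exact remainder makes this usable for the expansions of the resolvent both
    at infinity and at a point of the half-plane. *)
Lemma geom_inv (F : fieldType) (a h : F) N : a != 0 -> a + h != 0 ->
  (a + h)^-1 = \sum_(k < N) (- h) ^+ k * a^-1 ^+ k.+1
               + (- h) ^+ N * a^-1 ^+ N * (a + h)^-1.
Proof.
move=> a0 ah0; elim: N => [|N IH].
  by rewrite big_ord0 add0r !expr0 !mul1r.
rewrite big_ord_recr /= {1}IH -addrA; congr (_ + _).
rewrite !exprS; field; by rewrite ah0 a0.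
Qed.

End cauchy_expansion.

(** * An identity theorem for limits of polynomials *)

Section identity_theorem.
Context {R : realType}.

Lemma le0_of_geom (a K q : R) : 0 <= q < 1 -> (forall n, a <= K * q ^+ n) -> a <= 0.
Proof.
move=> /andP[q0 q1] h; rewrite leNgt; apply/negP => a0.
have h0 : (K * q ^+ n) @[n --> \oo] --> (0 : R).
  rewrite -[X in _ --> X](mulr0 K); apply: cvgMr; apply: cvg_expr; by rewrite ger0_norm.
move/cvgrPdist_lt : h0 => /(_ _ a0)[N _ /(_ N (leqnn N))] /=.
rewrite sub0r normrN => hN.
by have := lt_le_trans (le_lt_trans (ler_norm _) hN) (h N); rewrite ltxx.
Qed.

(** The polynomials [Q N] are truncations of a power series, as their low
    coefficients no longer change. If [c] is its first nonzero coefficient, of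
    degree [m], then [f h = 0] for small [h] makes [c * h ^+ m] as small as the
    tail, of order [m.+1]; letting [h] tend to 0 gives [c = 0]. Hence all
    coefficients vanish and [f] with them, on the whole disc of convergence. *)
Lemma vanishing_series (Q : nat -> {poly R[i]}) (f : R[i]^o -> R[i]^o) (T e : R) :
    0 < e -> 0 < T ->
    (forall N k, (k < N)%N -> (Q N.+1)`_k = (Q N)`_k) ->
    (forall rho, 0 < rho < T -> exists K, forall N, majorant rho (Q N) <= K) ->
    (forall h, cmod h < T -> ((Q N).[h] : R[i]^o) @[N --> \oo] --> f h) ->
    (forall h, cmod h < e -> f h = 0) ->
  forall h, cmod h < T -> f h = 0.
Proof.
move=> e0 T0 Qstab Qbound Qcvg f0.
have Qk N k : (k < N)%N -> (Q N)`_k = (Q k.+1)`_k.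
  elim: N => // N IH; rewrite ltnS leq_eqVlt => /predU1P[->//|kN].
  by rewrite Qstab// IH.
have c0 m : (Q m.+1)`_m = 0.
  elim/ltn_ind: m => m IH.
  set c := _`_m; pose rho := T / 2.
  have rhoT : 0 < rho < T by apply/andP; split; rewrite /rho; lra.
  have /andP[rho0 _] := rhoT.
  have [K HK] := Qbound _ rhoT.
  (* The point [q * rho] is in the disc where [f] vanishes; [q] tends to 0 below. *)
  have cbd q : 0 < q < 1 -> q * rho < e -> cmod c * rho ^+ m <= (K + cmod c * rho ^+ m) * q.
    move=> /andP[q0 q1] qe.
    pose h : R[i] := (q * rho)%:C.
    have ch : cmod h = q * rho by rewrite cmodR ger0_norm// mulr_ge0// ltW.
    have hT : cmod h < T by rewrite ch /rho; nra.
    have he : cmod h < e by rewrite ch.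
    have bd N : (m < N)%N -> cmod (c * h ^+ m) <=
        cmod ((Q N).[h] - f h) + (K + cmod c * rho ^+ m) * q ^+ m.+1.
      move=> mN; rewrite f0// subr0.
      have -> : c * h ^+ m = (Q N).[h] - (Q N - c *: 'X^m).[h].
        by rewrite !hornerE opprB addrC subrK.
      apply: le_trans (cmodB _ _) _; rewrite lerD2l.
      have mb : majorant rho (Q N - c *: 'X^m) <= K + cmod c * rho ^+ m.
        apply: le_trans (majorantD _ _ (ltW rho0)) _; rewrite majorantN lerD ?HK//.
        rewrite /majorant (_ : abs_poly _ = cmod c *: 'X^m) ?hornerE//.
        apply/polyP => k; rewrite coef_abs_poly !coefZ !coefXn cmodM.
        by rewrite cmod_nat.
      apply: le_trans (cmod_horner_tail (t := q) (N := m.+1) (ltW rho0) _ _ _) _.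
      - by rewrite ltW// ltW.
      - by rewrite ch.
      - move=> k; rewrite ltnS leq_eqVlt coefB coefZ coefXn => /predU1P[->|km].
          by rewrite eqxx mulr1 Qk// subrr.
        by rewrite (ltn_eqF km) mulr0 subr0 Qk ?IH// (ltn_trans km).
      - by rewrite ler_wpM2r// exprn_ge0// ltW.
    have : cmod (c * h ^+ m) <= (K + cmod c * rho ^+ m) * q ^+ m.+1.
      apply/ler_addgt0Pr => d d0.
      have [N HN] := lim_cmod (Qcvg _ hT) d0.
      apply: le_trans (bd (maxn N m.+1) _) _; first by rewrite leq_maxr.
      by rewrite addrC lerD2l ltW// HN// leq_maxl.
    rewrite cmodM cmodX ch exprMn exprSr => H.
    rewrite -(ler_pM2r (exprn_gt0 m q0)) -mulrA [rho ^+ m * _]mulrC.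
    by rewrite -[leRHS]mulrA [q * _]mulrC.
  apply/eqP; rewrite -cmod_eq0; apply/eqP/le_anti; rewrite cmod_ge0 andbT.
  rewrite -(pmulr_lle0 _ (exprn_gt0 m rho0)).
  apply/ler_addgt0Pr => d d0; rewrite add0r.
  set x := cmod c * _ in cbd *.
  have K0 : 0 <= K by apply: le_trans (HK 0%N); exact: majorant_ge0 (ltW rho0).
  have x0 : 0 <= x by rewrite mulr_ge0 ?cmod_ge0// exprn_ge0// ltW.
  pose s := K + x + rho + 1.
  have s0 : 0 < s by rewrite /s; lra.
  pose q := Num.min (Num.min (1 / 2) (e / (2 * s))) (d / s).
  have q0 : 0 < q by rewrite /q !lt_min !divr_gt0// ?mulr_gt0.
  have q1 : q < 1.
    apply: (@le_lt_trans _ _ (1 / 2)); last by lra.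
    by rewrite /q !ge_min lexx.
  have qe : q * rho < e.
    have : q <= e / (2 * s) by rewrite /q !ge_min lexx orbT.
    rewrite ler_pdivlMr ?mulr_gt0// => h; rewrite /s in h.
    by have := mulr_ge0 (ltW q0) K0; have := mulr_ge0 (ltW q0) x0; nra.
  apply: le_trans (cbd q _ qe) _; first by rewrite q0.
  have : q <= d / s by rewrite /q !ge_min lexx !orbT.
  by rewrite ler_pdivlMr// /s; nra.
move=> h hT; apply: (cvg_unique (@norm_hausdorff _ _) (Qcvg _ hT)).
pose rho := (cmod h + T) / 2.
have h0 := cmod_ge0 h.
have rho0 : 0 < rho by rewrite /rho; lra.
have [K HK] := Qbound rho ltac:(apply/andP; split; rewrite /rho; lra).
apply: (@cvg_cmod_geom _ _ _ K (cmod h / rho)).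
  by rewrite divr_ge0 ?cmod_ge0 ?(ltW rho0)//= ltr_pdivrMr// mul1r /rho; lra.
move=> N; rewrite subr0.
apply: le_trans (cmod_horner_tail (t := cmod h / rho) (N := N) (ltW rho0) _ _ _) _.
- by rewrite divr_ge0 ?cmod_ge0 ?(ltW rho0)//= ler_pdivrMr// mul1r /rho; lra.
- by rewrite divfK// gt_eqF.
- by move=> k kN; rewrite Qk.
- by rewrite ler_wpM2r// exprn_ge0// divr_ge0 ?cmod_ge0// ltW.
Qed.

End identity_theorem.

(** * Supports and expansions of Cauchy transforms *)

Section compact_support.
Context {R : realType}.
Implicit Types (mu : {measure set (measurableTypeR R) -> \bar R}).

(** Markov's inequality for the moment of order [2 * k]: the mass outside [[- c, c]]
    is at most [K * (b / c) ^+ (2 * k)] for every [k]. *)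
Lemma compact_support_of_moments mu (K b c : R) : 0 <= b < c ->
  (forall k, (\int[mu]_x (x ^+ (2 * k))%:E <= (K * b ^+ (2 * k))%:E)%E) ->
  mu (~` `[- c, c]%classic) = 0%E.
Proof.
move=> /andP[b0 bc] h; set A := ~` _.
have c0 : 0 < c by exact: le_lt_trans bc.
have mA : measurable A by exact: measurableC.
have mX n : measurable_fun [set: measurableTypeR R] (fun x => (x ^+ n)%:E).
  by apply/measurable_EFinP; exact: measurable_funX.
have X0 k (x : measurableTypeR R) : (0 <= (x ^+ (2 * k))%:E)%E.
  by rewrite lee_fin exprM exprn_ge0// sqr_ge0.
have hA k : (mu A * (c ^+ (2 * k))%:E <= (K * b ^+ (2 * k))%:E)%E.
  apply: le_trans (h k).
  apply: (@le_trans _ _ (\int[mu]_(x in A) (x ^+ (2 * k))%:E)%E).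
    rewrite muleC -integral_cst//; apply: ge0_le_integral => //.
    - by move=> x _; rewrite /= lee_fin exprn_ge0// ltW.
    - exact: measurable_funTS.
    - move=> x; rewrite /A /= in_itv /= => /negP hx; rewrite lee_fin !exprM.
      rewrite lerXn2r ?nnegrE ?sqr_ge0// -[x ^+ 2]real_normK ?num_real//.
      rewrite lerXn2r ?nnegrE// ?(ltW c0)// leNgt; apply: contra hx.
      by move=> /ltW; rewrite ler_norml.
  by apply: ge0_subset_integral.
have Afin : mu A \is a fin_num.
  rewrite ge0_fin_numE//; have := hA 0%N; rewrite muln0 !expr0 mule1 => /le_lt_trans.
  by apply; rewrite ltry.
rewrite -(fineK Afin); congr EFin; apply/le_anti; rewrite fine_ge0// andbT.
apply: (@le0_of_geom _ _ K ((b / c) ^+ 2)).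
  rewrite sqr_ge0 /= expr_lt1 ?divr_ge0// ?(ltW c0)//.
  by rewrite ltr_pdivrMr// mul1r.
move=> k; rewrite -exprM expr_div_n mulrA ler_pdivlMr ?exprn_gt0//.
by rewrite -lee_fin EFinM fineK// hA.
Qed.

Variables (mu : {measure set (measurableTypeR R) -> \bar R}) (M : R).
Let D : set (measurableTypeR R) := `[- M, M]%classic.
Hypotheses (M0 : 0 < M) (muM : mu (~` D) = 0%E) (mufin : (mu D < +oo)%E).

Let mD : measurable D. Proof. exact: measurable_itv. Qed.
Let m := fine (mu D).

Let DM x : D x -> cmod x%:C <= M.
Proof. by rewrite cmodR ler_norml /D /= in_itv. Qed.

(** The geometric expansion of the resolvent in [x / z], of modulus at most [1 / 2]
    on the support. *)
Lemma cauchy_moment_series z N : 2 * M <= cmod z ->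
  cmod (cauchy_transform mu z
        - \sum_(k < N) (\int[mu]_(x in D) x ^+ k)%:C * z^-1 ^+ k.+1)
    <= 2 * M^-1 * m * 2^-1 ^+ N.
Proof.
move=> hz; have cz : 0 < cmod z by apply: lt_le_trans hz; rewrite mulr_gt0.
have z0 : z != 0 by rewrite -cmod_gt0.
have zx x : D x -> M <= cmod (z - x%:C).
  move=> /DM hx; apply: le_trans (ler_cmod_sub _ _); lra.
have zx0 x : D x -> z - x%:C != 0.
  by move=> /zx h; rewrite -cmod_gt0; exact: lt_le_trans h.
pose F k (x : measurableTypeR R) : R[i] := z^-1 ^+ k.+1 * (x ^+ k)%:C.
have mF n : cmeasurable D (fun x : measurableTypeR R => (x ^+ n)%:C).
  by apply: cmeasurable_real; exact: measurable_funX.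
have iX n : cintegrable mu D (fun x : measurableTypeR R => (x ^+ n)%:C).
  apply: (@cintegrable_bounded _ _ _ _ _ _ (M ^+ n)) => // x Dx.
  by rewrite rmorphXn /= cmodX lerXn2r// ?nnegrE ?cmod_ge0 ?DM// ltW.
have iF k : cintegrable mu D (F k) by exact: cintegrableZ.
pose E N (x : measurableTypeR R) : R[i] := (z^-1 * x%:C) ^+ N * (z - x%:C)^-1.
have bE x : D x -> cmod (E N x) <= 2^-1 ^+ N * M^-1.
  move=> Dx; rewrite cmodM cmodX cmodM !cmodV; apply: ler_pM.
  - by rewrite exprn_ge0// mulr_ge0 ?invr_ge0 ?cmod_ge0.
  - by rewrite invr_ge0 cmod_ge0.
  - rewrite lerXn2r ?nnegrE ?mulr_ge0 ?invr_ge0 ?cmod_ge0//.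
    by rewrite mulrC ler_pdivrMr//; have := DM Dx; lra.
  - by rewrite lef_pV2 ?posrE// ?zx// (lt_le_trans M0)// zx.
have iE : cintegrable mu D (E N).
  apply: (cintegrable_bounded _ _ _ bE) => //.
  apply: cmeasurableM; last exact: cmeasurable_resolvent.
  apply: cmeasurableX; apply: cmeasurableM; first exact: cmeasurable_cst.
  by apply: cmeasurable_real; exact: measurable_id.
rewrite (cauchy_cint _ mD)//.
rewrite (@eq_cint _ _ _ _ _ _ (fun x => \sum_(k < N) F k x + E N x)); last first.
  move=> x Dx; rewrite (@geom_inv _ z (- x%:C) N)// ?zx0// opprK.
  congr (_ + _).
    by apply: eq_bigr => k _; rewrite /F rmorphXn /= mulrC.
  by rewrite /E exprMn [z^-1 ^+ _ * _]mulrC.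
rewrite cintD//; last exact: cintegrable_sum.
rewrite cint_sum//.
rewrite (eq_bigr (fun k : 'I_N => (\int[mu]_(x in D) x ^+ k)%:C * z^-1 ^+ k.+1)); last first.
  by move=> k _; rewrite /F cintZ// cint_real mulrC.
rewrite addrC addKr; apply: le_trans (cint_bound _ _ _ iE bE) _ => //.
  by rewrite mulr_ge0 ?exprn_ge0 ?invr_ge0 ?ltW.
rewrite -/m le_eqVlt; apply/orP; left; apply/eqP; ring.
Qed.

(** Up to sign, the Taylor coefficients of the Cauchy transform at [z]. *)
Definition resolvent_coef (z : R[i]) k : R[i] :=
  cint mu D (fun x => (z - x%:C)^-1 ^+ k.+1).

Let Im_le (z : R[i]) (x : R) : `|complex.Im z| <= cmod (z - x%:C).
Proof.
by apply: le_trans (ler_Im_cmod _); case: z => a b /=; rewrite oppr0 addr0.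
Qed.

Lemma resolvent_coef_bound (z : R[i]) k (t := `|complex.Im z|) : 0 < t ->
  cmod (resolvent_coef z k) <= 2 * m * t^-1 ^+ k.+1.
Proof.
move=> t0.
have b x : D x -> cmod ((z - x%:C)^-1 ^+ k.+1) <= t^-1 ^+ k.+1.
  move=> Dx; rewrite cmodX cmodV lerXn2r ?nnegrE ?invr_ge0 ?cmod_ge0 ?(ltW t0)//.
  by rewrite lef_pV2 ?posrE// ?Im_le// (lt_le_trans t0)// Im_le.
apply: le_trans (cint_bound _ _ _ _ b) _ => //.
- by rewrite exprn_ge0// invr_ge0 ltW.
- apply: (cintegrable_bounded _ _ _ b) => //.
  by apply: cmeasurableX; exact: cmeasurable_resolvent.
- by rewrite -/m mulrAC.
Qed.

(** The distance from [z] to the real line bounds the radius of convergence from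
    below, whatever the support. *)
Lemma cauchy_taylor (z h : R[i]) N (t := `|complex.Im z|) : cmod h < t ->
  cmod (cauchy_transform mu (z + h) - \sum_(k < N) resolvent_coef z k * (- h) ^+ k)
   <= 2 * m * (t - cmod h)^-1 * (cmod h / t) ^+ N.
Proof.
move=> ht; have h0 := cmod_ge0 h; have t0 : 0 < t by exact: le_lt_trans ht.
have zx (x : R) : t <= cmod (z - x%:C) := Im_le z x.
have zx0 (x : R) : z - x%:C != 0 by rewrite -cmod_gt0; exact: lt_le_trans (zx x).
have zhx (x : R) : t - cmod h <= cmod (z - x%:C + h).
  have := ler_cmod_sub (z - x%:C) (- h); rewrite cmodN opprK; apply: le_trans.
  by rewrite lerB.
have zhx0 (x : R) : z - x%:C + h != 0.
  by rewrite -cmod_gt0; apply: lt_le_trans (zhx x); rewrite subr_gt0.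
pose F k (x : measurableTypeR R) : R[i] := (- h) ^+ k * (z - x%:C)^-1 ^+ k.+1.
have iR k : cintegrable mu D (fun x : measurableTypeR R => (z - x%:C)^-1 ^+ k.+1).
  apply: (@cintegrable_bounded _ _ _ _ _ _ (t^-1 ^+ k.+1)) => //.
    by apply: cmeasurableX; exact: cmeasurable_resolvent.
  move=> x Dx; rewrite cmodX cmodV lerXn2r ?nnegrE ?invr_ge0 ?cmod_ge0 ?(ltW t0)//.
  by rewrite lef_pV2 ?posrE// ?Im_le// (lt_le_trans t0)// Im_le.
have iF k : cintegrable mu D (F k) by exact: cintegrableZ.
pose E N (x : measurableTypeR R) : R[i] := (- h) ^+ N * (z - x%:C)^-1 ^+ N * (z - x%:C + h)^-1.
have bE x : D x -> cmod (E N x) <= (cmod h / t) ^+ N * (t - cmod h)^-1.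
  move=> Dx; rewrite cmodM -exprMn cmodX cmodM !cmodV cmodN; apply: ler_pM.
  - by rewrite exprn_ge0// mulr_ge0 ?invr_ge0 ?cmod_ge0.
  - by rewrite invr_ge0 cmod_ge0.
  - rewrite lerXn2r ?nnegrE ?mulr_ge0 ?invr_ge0 ?cmod_ge0 ?(ltW t0)//.
    by rewrite ler_wpM2l// lef_pV2 ?posrE// (lt_le_trans t0).
  - rewrite lef_pV2 ?posrE ?subr_gt0//.
    by apply: lt_le_trans (zhx x); rewrite subr_gt0.
have iE : cintegrable mu D (E N).
  apply: (cintegrable_bounded _ _ _ bE) => //.
  apply: cmeasurableM.
    apply: cmeasurableM; first exact: cmeasurable_cst.
    by apply: cmeasurableX; exact: cmeasurable_resolvent.
  have := cmeasurable_resolvent D (z + h); congr cmeasurable.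
  by apply/funext => x; rewrite addrAC.
rewrite (cauchy_cint _ mD)//.
rewrite (@eq_cint _ _ _ _ _ _ (fun x => \sum_(k < N) F k x + E N x)); last first.
  by move=> x Dx; rewrite addrAC (@geom_inv _ (z - x%:C) h N)// ?zx0 ?zhx0.
rewrite cintD//; last exact: cintegrable_sum.
rewrite cint_sum//.
rewrite (eq_bigr (fun k : 'I_N => resolvent_coef z k * (- h) ^+ k)); last first.
  by move=> k _; rewrite /F cintZ// mulrC.
rewrite addrC addKr; apply: le_trans (cint_bound _ _ _ iE bE) _ => //.
  by rewrite mulr_ge0// ?exprn_ge0// ?invr_ge0 ?subr_ge0 ?(ltW ht)// divr_ge0// ltW.
rewrite -/m le_eqVlt; apply/orP; left; apply/eqP; ring.
Qed.

End compact_support.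

(** * The cubic equation off the real axis *)

Definition hook_cubic {C : comNzRingType} (c1 c2 G z : C) : C :=
  z ^+ 2 * G ^+ 3 + z * (c1 - c2 - 2 * z) * G ^+ 2 + z * (2 * c2 + z) * G
  + (c1 ^+ 2 - z).

(** Changing [G] in high degree only changes the cubic in high degree; this makes
    the truncations in [cubic_shift] stable. *)
Lemma hook_cubicB {C : comNzRingType} (c1 c2 G d z : C) :
  hook_cubic c1 c2 (G + d) z - hook_cubic c1 c2 G z =
  d * (z ^+ 2 * (3 * G ^+ 2 + 3 * G * d + d ^+ 2)
       + z * (c1 - c2 - 2 * z) * (2 * G + d) + z * (2 * c2 + z)).
Proof. by rewrite /hook_cubic; ring. Qed.

Lemma lim_hook_cubic {R : realType} (c1 c2 z G : R[i]^o) (u : nat -> R[i]^o) :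
  u n @[n --> \oo] --> G ->
  (hook_cubic c1 c2 (u n) z : R[i]^o) @[n --> \oo] --> (hook_cubic c1 c2 G z : R[i]^o).
Proof.
move=> uG; have := cvg_seqD (cvg_seqM (cvg_seqD (cvg_seqM (cvg_seqD (cvg_seqM (cvg_seq_cst (z ^+ 2)) uG)
  (cvg_seq_cst (z * (c1 - c2 - 2 * z)))) uG) (cvg_seq_cst (z * (2 * c2 + z)))) uG)
  (cvg_seq_cst (c1 ^+ 2 - z)).
have E (x : R[i]^o) : ((z ^+ 2 * x + z * (c1 - c2 - 2 * z)) * x + z * (2 * c2 + z)) * x
    + (c1 ^+ 2 - z) = hook_cubic c1 c2 x z.
  by rewrite /hook_cubic; ring.
by rewrite E; under eq_fun do rewrite E.
Qed.

Lemma geom_sum_le {R : realType} (q : R) N : 0 <= q < 1 ->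
  \sum_(k < N) q ^+ k <= (1 - q)^-1.
Proof.
move=> /andP[q0 q1]; have p0 : 0 < 1 - q by lra.
rewrite -(ler_pM2l p0) mulfV ?gt_eqF//.
have := subrX1 q N; have := exprn_ge0 N q0; lra.
Qed.

Section continuation.
Context {R : realType}.
Variables (mu : {measure set (measurableTypeR R) -> \bar R}) (M : R) (c1 c2 : R[i]).
Let D : set (measurableTypeR R) := `[- M, M]%classic.
Hypotheses (M0 : 0 < M) (muM : mu (~` D) = 0%E) (mufin : (mu D < +oo)%E).
Hypothesis far : forall z, 2 * M <= cmod z ->
  hook_cubic c1 c2 (cauchy_transform mu z) z = 0.

(** Substituting the truncated Taylor series at [z] into the cubic gives polynomials
    in [h] that converge on the disc of radius [|Im z|]. Their limit vanishes for
    [|h| < 1], where [z + h] is still far from the support; [vanishing_series]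
    spreads this to the whole disc. *)
Lemma cubic_shift (z h : R[i]) : 2 * M + 1 <= `|complex.Im z| ->
  cmod h < `|complex.Im z| ->
  hook_cubic c1 c2 (cauchy_transform mu (z + h)) (z + h) = 0.
Proof.
have tz : `|complex.Im z| <= cmod z := ler_Im_cmod z.
have Tay h' N := @cauchy_taylor R mu M muM mufin z h' N.
have Rbd k := @resolvent_coef_bound R mu M mufin z k.
have [t tE] : exists t : R, t = `|complex.Im z| by eexists.
move: tz Tay Rbd; rewrite -tE => tz Tay Rbd Mt {tE}.
have t0 : 0 < t by apply: lt_le_trans Mt; rewrite addr_gt0// mulr_gt0.
pose m := fine (mu D).
have m0 : 0 <= m by rewrite fine_ge0.
pose P N := \poly_(k < N) ((-1) ^+ k * resolvent_coef mu M z k) : {poly R[i]}.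
pose Z : {poly R[i]} := z%:P + 'X.
pose Q N : {poly R[i]} := hook_cubic c1%:P c2%:P (P N) Z.
pose f h : R[i]^o := hook_cubic c1 c2 (cauchy_transform mu (z + h)) (z + h).
suff : forall h, cmod h < t -> f h = 0 by apply.
apply: (@vanishing_series _ Q f t 1) => // [N k kN|rho|{}h ht|{}h h1].
- rewrite /Q.
  have -> : P N.+1 = P N + ((-1) ^+ N * resolvent_coef mu M z N) *: 'X^N.
    by rewrite /P !poly_def big_ord_recr.
  apply/eqP; rewrite -subr_eq0 -coefB hook_cubicB -scalerAl coefZ.
  by rewrite coefXnM kN mulr0.
- move=> /andP[r0 rt].
  have bP : exists K, forall N, majorant rho (P N) <= K.
    exists (2 * m / t * (1 - rho / t)^-1) => N.
    rewrite majorant_poly.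
    have q0 : 0 <= rho / t by rewrite divr_ge0 ?ltW.
    have q1 : rho / t < 1 by rewrite ltr_pdivrMr// mul1r.
    apply: (@le_trans _ _ (\sum_(k < N) 2 * m / t * (rho / t) ^+ k)).
      apply: ler_sum => k _; rewrite cmodM cmodX cmodN cmod1 expr1n mul1r.
      apply: le_trans (ler_wpM2r _ (Rbd k t0)) _; first by rewrite exprn_ge0// ltW.
      rewrite -/D -/m exprS exprMn le_eqVlt; apply/orP; left; apply/eqP; ring.
    rewrite -mulr_sumr ler_wpM2l//; first by rewrite divr_ge0 ?mulr_ge0 ?(ltW t0).
    by apply: geom_sum_le; rewrite q0.
  have r0' := ltW r0.
  pose B (S : nat -> {poly R[i]}) := exists K, forall N, majorant rho (S N) <= K.
  have BC (p : {poly R[i]}) : B (fun=> p) by exists (majorant rho p).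
  have BD S S' : B S -> B S' -> B (fun N => S N + S' N).
    move=> [K hK] [K' hK']; exists (K + K') => N.
    by apply: le_trans (majorantD _ _ r0') _; rewrite lerD.
  have BM S S' : B S -> B S' -> B (fun N => S N * S' N).
    move=> [K hK] [K' hK']; exists (K * K') => N.
    by apply: le_trans (majorantM _ _ r0') _; rewrite ler_pM ?majorant_ge0.
  have BX S n : B S -> B (fun N => S N ^+ n).
    move=> bS; elim: n => [|n IH]; first exact: BC.
    have [K hK] := BM _ _ bS IH; exists K => N; rewrite exprS; exact: hK.
  have b3 := BM _ _ (BC (Z ^+ 2)) (BX _ 3 bP).
  have b2 := BM _ _ (BC (Z * (c1%:P - c2%:P - 2 * Z))) (BX _ 2 bP).
  have b1 := BM _ _ (BC (Z * (2 * c2%:P + Z))) bP.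
  exact: BD _ _ (BD _ _ (BD _ _ b3 b2) b1) (BC (c1%:P ^+ 2 - Z)).
- have <- : (fun N => hook_cubic c1 c2 (P N).[h] (z + h)) = (fun N => (Q N).[h]).
    apply/funext => N; rewrite /Q /hook_cubic /Z.
    rewrite !(hornerD, hornerN, hornerM, hornerX, hornerC, horner_exp, hornerMn).
    by [].
  apply: lim_hook_cubic.
  apply: (@cvg_cmod_geom _ _ _ (2 * m * (t - cmod h)^-1) (cmod h / t)).
    by rewrite divr_ge0 ?cmod_ge0 ?(ltW t0)//= ltr_pdivrMr// mul1r.
  move=> N; have := Tay h N ht; rewrite -cmodN opprB; apply: le_trans.
  rewrite horner_poly le_eqVlt; apply/orP; left; apply/eqP; congr (cmod (_ - _)).
  by apply: eq_bigr => k _; rewrite [in RHS]exprNn; ring.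
- rewrite /f far//.
  have := ler_cmod_sub z (- h); rewrite opprK cmodN; apply: le_trans.
  by rewrite lerBrDr; apply: le_trans tz; apply: le_trans Mt; rewrite lerD2l ltW.
Qed.

(** The discs of radius [T] around [i T], for large [T], exhaust the upper
    half-plane, and likewise in the lower one, so [cubic_shift] reaches every
    point off the real axis from the region where the cubic is already known. *)
Lemma cubic_off_axis z : complex.Im z != 0 ->
  hook_cubic c1 c2 (cauchy_transform mu z) z = 0.
Proof.
case: z => x y /= y0; have M_gt0 := M0.
have ay : 0 < `|y| by rewrite normr_gt0.
(* [x + i y] is within [T] of [+/- i T] as soon as [x^2 + y^2 < 2 |y| T]. *)
pose T := 2 * M + 1 + (x ^+ 2 + y ^+ 2) / `|y|.
have q0 : 0 <= (x ^+ 2 + y ^+ 2) / `|y| by rewrite divr_ge0// addr_ge0 ?sqr_ge0.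
have T0 : 0 < T by rewrite /T; lra.
pose z0 : R[i] := 0 +i* (Num.sg y * T).
have i0 : `|complex.Im z0| = T.
  by rewrite /= normrM normr_sg y0 mul1r gtr0_norm.
have -> : x +i* y = z0 + (x +i* (y - Num.sg y * T)).
  by rewrite /z0; simpc; rewrite addrC subrK.
apply: cubic_shift; rewrite i0 ?lerDl//.
rewrite /cmod /= -[ltRHS]gtr0_norm// -sqrtr_sqr ltr_sqrt ?exprn_gt0//.
have -> : x ^+ 2 + (y - Num.sg y * T) ^+ 2 =
    x ^+ 2 + y ^+ 2 - 2 * `|y| * T + (Num.sg y * T) ^+ 2.
  by rewrite (normrEsg y); ring.
rewrite exprMn sqr_sg y0 mul1r gtrDr subr_lt0.
have -> : x ^+ 2 + y ^+ 2 = `|y| * ((x ^+ 2 + y ^+ 2) / `|y|).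
  by rewrite mulrC divfK// gt_eqF.
rewrite [2 * _]mulrC -mulrA ltr_pM2l// /T; lra.
Qed.

End continuation.

Section hook_distribution.
Context {R : realType}.
Variables (a1 a2 : nat) (F : probability (measurableTypeR R) R).
Hypotheses (a1_gt0 : (0 < a1)%N) (a2_gt0 : (0 < a2)%N)
  (hF : is_F_lambda (fat_hook a1 a2) F).
Let l : R := (a1 + a2)%:R.
Let l0 : 0 < l. Proof. by rewrite ltr0n addn_gt0 a1_gt0. Qed.
Let C k : nat := (a1 * nb_long a1 a2 k + a2 * nb_short a1 a2 k)%N.

Let moment k : (\int[F]_x (x ^+ k)%:E)%E = ((C k.+1)%:R / l ^+ k.+1)%:E.
Proof. by rewrite (hF.2 k) size_fat_hook nb_lambda_trees_fat_hook. Qed.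

Let D : set (measurableTypeR R) := `[- 5, 5]%classic.
Let mD : measurable D. Proof. exact: measurable_itv. Qed.

(** By [tree_count_bound] the moment of order [2 * k] is at most [2 * 4 ^+ (2 * k)],
    so the support lies in [[- 4, 4]]; any larger bound, such as 5, is obtained
    from Markov's inequality. *)
Lemma hook_distribution_compact : F (~` D) = 0%E.
Proof.
apply: (@compact_support_of_moments _ _ 2 4); first lra.
move=> k; rewrite moment lee_fin ler_pdivrMr ?exprn_gt0//.
apply: le_trans (tree_count_bound a1_gt0 a2_gt0 _) _.
by rewrite -/l exprMn !exprS le_eqVlt; apply/orP; left; apply/eqP; field.
Qed.

Let FD : (F D < +oo)%E.
Proof. by apply: (le_lt_trans (probability_le1 F mD)); exact: ltry. Qed.

Let momentD k : \int[F]_(x in D) x ^+ k = (C k.+1)%:R / l ^+ k.+1.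
Proof.
rewrite /Rintegral -(integral_carrier mD _ hook_distribution_compact) ?moment//.
by apply/measurable_EFinP; exact: measurable_funX.
Qed.

Let c1 : R[i] := (a1%:R / l)%:C.
Let c2 : R[i] := (a2%:R / l)%:C.

(** Up to the substitution [w = 1 / (l * z)], the moment series of the Cauchy
    transform is the generating series of trees. It converges for [|z| >= 10],
    and [|w|] is then less than half the radius in [tree_series_cubic]. *)
Lemma hook_cubic_far z : 10 <= cmod z ->
  hook_cubic c1 c2 (cauchy_transform F z) z = 0.
Proof.
move=> hz; have cz : 0 < cmod z by lra.
have z0 : z != 0 by rewrite -cmod_gt0.
have lC : (l%:C : R[i]) != 0.
  by apply/eqP => /(congr1 (@complex.Re R)) /= e; move: l0; rewrite e ltxx.
pose w : R[i] := (l%:C * z)^-1.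
set G := cauchy_transform F z.
have key : (G * (1 - G) - a1%:R * w) * (1 - G - a1%:R * w) = a2%:R * w * (1 - G) ^+ 2.
  apply: (@tree_series_cubic R a1 a2 a1_gt0 a2_gt0 w G
    (Num.max (cmod G) (2 * (2 * 5^-1 * fine (F D))))).
    rewrite /w cmodV cmodM cmodR gtr0_norm// -invfM lef_pV2 ?posrE ?mulr_gt0//.
    by rewrite -/l mulrCA [leRHS]mulrC mulrA ler_pM2r//; lra.
  case=> [|N].
    by rewrite big_ord0 subr0 expr0 mulr1 le_max lexx.
  rewrite big_ord_recl [nb_long _ _ 0]/nb_long [nb_short _ _ 0]/nb_short.
  rewrite !nb_rooted0 !muln0 mul0r add0r.
  have five : 0 < 5 :> R by [].
  have h : 2 * 5 <= cmod z -> _ :=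
    @cauchy_moment_series R F 5 five hook_distribution_compact FD z N.
  rewrite -/D -/G in h.
  rewrite (eq_bigr (fun k : 'I_N => (\int[F]_(x in D) x ^+ k)%:C * z^-1 ^+ k.+1)); last first.
    move=> k _; rewrite momentD -/(C k.+1) rmorphM fmorphV rmorphXn /= rmorph_nat.
    by rewrite /bump leq0n add1n /w invfM exprMn !exprVn mulrA.
  apply: le_trans (h _) _; first lra.
  rewrite exprS [leRHS]mulrA ler_wpM2r ?exprn_ge0 ?invr_ge0//.
  by rewrite -ler_pdivrMr// invrK [leLHS]mulrC le_max lexx orbT.
have natC k : (k%:R / l)%:C = k%:R / l%:C :> R[i].
  by rewrite rmorphM fmorphV; congr (_ / _); exact: rmorph_nat.
have w1 : a1%:R * w = c1 / z by rewrite /w /c1 invfM mulrA natC.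
have w2 : a2%:R * w = c2 / z by rewrite /w /c2 invfM mulrA natC.
have c12 : c1 + c2 = 1.
  by rewrite /c1 /c2 -rmorphD -mulrDl -natrD divff// gt_eqF.
move: key; rewrite w1 w2 => /eqP; rewrite -subr_eq0 => /eqP key.
have gen (c g : R[i]) : hook_cubic c (1 - c) g z =
    z ^+ 2 * ((g * (1 - g) - c / z) * (1 - g - c / z) - (1 - c) / z * (1 - g) ^+ 2).
  by rewrite /hook_cubic; field.
have c2E : c2 = 1 - c1 by rewrite -c12 addrC addKr.
by rewrite c2E gen -c2E key mulr0.
Qed.

Lemma hook_cubic_off_axis z : complex.Im z != 0 ->
  hook_cubic c1 c2 (cauchy_transform F z) z = 0.
Proof.
apply: (@cubic_off_axis R F 5 c1 c2 _ hook_distribution_compact FD) => //.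
by move=> {}z hz; apply: hook_cubic_far; lra.
Qed.

End hook_distribution.

(** * Germs of analytic functions at 0 *)

Section germs.
Context {R : realType}.
Implicit Types (f g : R[i]^o -> R[i]^o) (z w : R[i]^o).

Lemma near0P (P : R[i]^o -> Prop) (e : R) : 0 < e ->
  (forall z, cmod z < e -> P z) -> \forall z \near (0 : R[i]^o), P z.
Proof.
move=> e0 h; apply/nbhs_normP; exists e%:C; first by rewrite /= ltcR.
move=> z; rewrite /ball_ /= sub0r normrN cmodE ltcR; exact: h.
Qed.

Lemma near0E (P : R[i]^o -> Prop) : (\forall z \near (0 : R[i]^o), P z) ->
  exists2 e : R, 0 < e & forall z, cmod z < e -> P z.
Proof.
move/nbhs_normP => [[e e'] /=]; rewrite ltcE /= => /andP[/eqP -> e0] h.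
exists e => // z ze; apply: h; rewrite /ball_ /= sub0r normrN cmodE.
by rewrite -[X in _ < X]/(e%:C) ltcR.
Qed.

Lemma dnear0E (P : R[i]^o -> Prop) : (\forall z \near (0 : R[i]^o)^', P z) ->
  exists2 e : R, 0 < e & forall z, z != 0 -> cmod z < e -> P z.
Proof.
rewrite /dnbhs /within => /near0E[e e0 h]; exists e => // z z0 ze; exact: h.
Qed.

Lemma dnear0P (P : R[i]^o -> Prop) (e : R) : 0 < e ->
  (forall z, z != 0 -> cmod z < e -> P z) -> \forall z \near (0 : R[i]^o)^', P z.
Proof.
move=> e0 h; rewrite /dnbhs /within; apply: (near0P e0) => z ze z0; exact: h.
Qed.

(** Typing the functions over the field [R[i]], and not over the module [R[i]^o] of
    the topological theory, keeps field arithmetic available on their values. *)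
Definition cdiff (f : R[i] -> R[i]) (z : R[i]) : Prop :=
  derivable (f : R[i]^o -> R[i]^o) z 1.

Lemma cdiff_cst (c z : R[i]) : cdiff (fun=> c) z.
Proof. exact: (@derivable_cst _ R[i]^o R[i]^o). Qed.

Lemma cdiff_id (z : R[i]) : cdiff id z.
Proof. exact: (@derivable_id _ R[i]^o). Qed.

Lemma cdiffD (f g : R[i] -> R[i]) (z : R[i]) :
  cdiff f z -> cdiff g z -> cdiff (fun x => f x + g x) z.
Proof. exact: (@derivableD _ R[i]^o R[i]^o). Qed.

Lemma cdiffB (f g : R[i] -> R[i]) (z : R[i]) :
  cdiff f z -> cdiff g z -> cdiff (fun x => f x - g x) z.
Proof. exact: (@derivableB _ R[i]^o R[i]^o). Qed.

Lemma cdiffM (f g : R[i] -> R[i]) (z : R[i]) :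
  cdiff f z -> cdiff g z -> cdiff (fun x => f x * g x) z.
Proof. exact: (@derivableM _ R[i]^o). Qed.

Lemma cdiffV (f : R[i] -> R[i]) (z : R[i]) :
  cdiff f z -> f z != 0 -> cdiff (fun x => (f x)^-1) z.
Proof. by move=> df fz; exact: (@derivableV _ R[i]^o). Qed.

Lemma cdiff_comp (f g : R[i] -> R[i]) (z : R[i]) :
  cdiff f z -> cdiff g (f z) -> cdiff (fun x => g (f x)) z.
Proof.
move=> /derivable1_diffP df /derivable1_diffP dg; apply/derivable1_diffP.
exact: (differentiable_comp df dg).
Qed.

Lemma cdiff_near f z (e : R) : cdiff f z -> 0 < e ->
  \forall x \near z, cmod (f x - f z) < e.
Proof.
move=> /derivable1_diffP/differentiable_continuous cf e0.
have /cvgrPdist_lt/(_ e%:C) := cf; rewrite ltcR => /(_ e0).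
by apply: filterS => x; rewrite -normrN opprB cmodE ltcR.
Qed.

Lemma sqrtc_Re_ge0 (w : R[i]) : 0 <= complex.Re (sqrtc w).
Proof. by case: w => a b /=; exact: sqrtr_ge0. Qed.

Lemma sqrtc_Re_gt0 (w : R[i]) : 0 < complex.Re w -> 0 < complex.Re (sqrtc w).
Proof.
case: w => a b /= a0; rewrite sqrtr_gt0 divr_gt0//.
by rewrite ltr_wpDl ?sqrtr_ge0.
Qed.

Lemma sqrtc_sqr (x : R[i]) : 0 < complex.Re x -> sqrtc (x ^+ 2) = x.
Proof.
move=> x0; have /eqP := sqr_sqrtc (x ^+ 2).
rewrite eqf_sqr => /orP[/eqP //|/eqP e].
by have := sqrtc_Re_ge0 (x ^+ 2); rewrite e raddfN /= oppr_ge0 leNgt x0.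
Qed.

Lemma Re_le_cmod_sub (x a : R[i]) : complex.Re a - cmod (x - a) <= complex.Re x.
Proof.
have := ler_Re_cmod (x - a); rewrite raddfB /= ler_norml => /andP[+ _].
by rewrite lerBrDl lerBlDl addrC.
Qed.

Lemma sqrtc_sub_le (w x : R[i]) : 0 < complex.Re (sqrtc w) ->
  cmod (sqrtc x - sqrtc w) <= cmod (x - w) / complex.Re (sqrtc w).
Proof.
move=> w0; rewrite ler_pdivlMr//.
have -> : x - w = (sqrtc x - sqrtc w) * (sqrtc x + sqrtc w).
  by rewrite -subr_sqr !sqr_sqrtc.
rewrite cmodM ler_wpM2l ?cmod_ge0//.
apply: le_trans (ler_Re_cmod _); apply: le_trans (ler_norm _).
by rewrite raddfD /= lerDr sqrtc_Re_ge0.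
Qed.

(** The difference quotient of the principal square root is
    [1 / (sqrt (h + w) + sqrt w)], and real parts of principal roots are
    nonnegative, so the denominator stays away from 0. *)
Lemma cdiff_sqrtc w : 0 < complex.Re w -> cdiff (@sqrtc R) w.
Proof.
move=> w0; pose S : R[i]^o -> R[i]^o := @sqrtc R; rewrite -/S; set s := S w.
have s0 : 0 < complex.Re s by exact: sqrtc_Re_gt0.
have sum0 x : S x + s != 0.
  apply/eqP => /(congr1 (@complex.Re R)); rewrite raddfD /=.
  by have := sqrtc_Re_ge0 x; lra.
set rho := complex.Re s in s0.
have sum_ge x : rho <= cmod (S x + s).
  apply: le_trans (ler_Re_cmod _); apply: le_trans (ler_norm _).
  by rewrite raddfD /= lerDr sqrtc_Re_ge0.
apply/cvg_ex; exists ((s + s)^-1); apply/cvgrPdist_lt => -[e e'] /=.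
rewrite ltcE /= => /andP[/eqP -> e0].
apply: (@dnear0P _ (e * rho ^+ 3)); first by rewrite mulr_gt0// exprn_gt0.
move=> h h0 he.
rewrite [h *: 1]mulr1 -/S.
have -> : h^-1 *: (S (h + w) - S w) = (S (h + w) + s)^-1.
  apply: (mulIf (sum0 (h + w))); rewrite mulVf//.
  rewrite -[_ *: _]/(h^-1 * _) -mulrA.
  have -> : (S (h + w) - S w) * (S (h + w) + s) = h.
    by rewrite -subr_sqr /S /s !sqr_sqrtc addrK.
  by rewrite mulVf.
have -> : (s + s)^-1 - (S (h + w) + s)^-1 =
    (S (h + w) - s) * ((s + s)^-1 * (S (h + w) + s)^-1).
  by have := sum0 w; have := sum0 (h + w); rewrite -/s => ? ?; field; apply/andP.
rewrite cmodE ltcR 2!cmodM !cmodV.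
apply: (@le_lt_trans _ _ (cmod h / rho * (rho^-1 * rho^-1))); last first.
  rewrite -!mulrA -!invfM -[_ * (_ * _)]/(rho ^+ 3) ltr_pdivrMr//.
  by rewrite exprn_gt0.
apply: ler_pM.
- exact: cmod_ge0.
- by rewrite mulr_ge0// invr_ge0 cmod_ge0.
- by have := @sqrtc_sub_le w (h + w) s0; rewrite addrK.
- apply: ler_pM; rewrite ?invr_ge0 ?cmod_ge0//.
    by rewrite lef_pV2 ?posrE ?sum_ge// (lt_le_trans s0)// sum_ge.
  by rewrite lef_pV2 ?posrE ?sum_ge// (lt_le_trans s0)// sum_ge.
Qed.

(** Near 0 the point [r z + 1 / z] is as far from the support as desired, so that
    only the values of the Cauchy transform far away matter. *)
Lemma R_transform_intro (mu : {measure set (measurableTypeR R) -> \bar R})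
    (r : R[i]^o -> R[i]^o) (K : R) :
    mu setT = 1%E -> compactly_supported mu -> analytic_near0 r ->
    (\forall z \near (0 : R[i]^o)^', K <= cmod (r z + z^-1) ->
       cauchy_transform mu (r z + z^-1) = z) ->
  is_R_transform mu r.
Proof.
move=> mu1 muc ar /dnear0E[e e0 h]; split => //.
have r0 : cdiff r 0 by exact: nbhs_singleton ar.
have /near0E[d d0 hd] := cdiff_near r0 (ltr01 : 0 < 1 :> R).
have K0 := normr_ge0 K.
have [a a0 ha] : exists2 a : R, 0 <= a & forall z, cmod z < d -> cmod (r z) < a + 1.
  exists (cmod (r 0)) => [|z zd]; first exact: cmod_ge0.
  by rewrite -ltrBlDl; exact: le_lt_trans (ler_cmod_sub _ _) (hd z zd).
pose B := `|K| + a + 2.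
have B0 : 0 < B by rewrite /B; lra.
pose m := Num.min (Num.min e d) B^-1.
apply: (@dnear0P _ m); first by rewrite !lt_min e0 d0 invr_gt0.
move=> z z0; rewrite !lt_min => /andP[/andP[ze zd] zB].
apply: h => //.
have := ha z zd; have := ler_cmod_sub z^-1 (- r z); rewrite opprK cmodN [z^-1 + _]addrC cmodV.
have : B <= (cmod z)^-1.
  by rewrite -[B]invrK lef_pV2 ?posrE ?invr_gt0 ?cmod_gt0// ltW.
have := ler_norm K; rewrite /B; lra.
Qed.

End germs.
Arguments cdiff_cst {R} c z.
Arguments cdiff_id {R} z.
Arguments cdiffV {R f z}.
Arguments cdiffD {R f g z}.
Arguments cdiffB {R f g z}.
Arguments cdiffM {R f g z}.

(** * The R-transform of the fat hook distribution *)

Section cauchy_bound.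
Context {R : realType}.
Variables (mu : {measure set (measurableTypeR R) -> \bar R}) (M : R).
Let D : set (measurableTypeR R) := `[- M, M]%classic.
Hypotheses (M0 : 0 < M) (muM : mu (~` D) = 0%E) (mufin : (mu D < +oo)%E).

Lemma cauchy_bound z : M < cmod z ->
  cmod (cauchy_transform mu z) <= 2 * (cmod z - M)^-1 * fine (mu D).
Proof.
move=> Mz; have mD : measurable D by exact: measurable_itv.
have zM : 0 < cmod z - M by rewrite subr_gt0.
have b x : D x -> cmod (z - x%:C)^-1 <= (cmod z - M)^-1.
  move=> Dx; have h : cmod z - M <= cmod (z - x%:C).
    apply: le_trans (ler_cmod_sub _ _); rewrite lerB// cmodR ler_norml.
    by move: Dx; rewrite /D /= in_itv.
  by rewrite cmodV lef_pV2 ?posrE// (lt_le_trans zM).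
rewrite (cauchy_cint _ mD)//; apply: cint_bound => //.
  by rewrite invr_ge0 ltW.
by apply: (cintegrable_bounded _ _ _ b) => //; exact: cmeasurable_resolvent.
Qed.
End cauchy_bound.

Section hook_germs.
Context {R : realType}.
Variables (p1 p2 : R).
Hypotheses (p1_gt0 : 0 < p1) (p2_gt0 : 0 < p2) (p12 : p1 + p2 = 1).
Let c1 : R[i] := p1%:C.
Let c2 : R[i] := p2%:C.
Let c12 : c2 = 1 - c1.
Proof. by rewrite /c1 /c2 -[X in _ = X - _](rmorph1 (real_complex R)) -rmorphB -p12 addrC addKr. Qed.
Let c1_neq0 : c1 != 0.
Proof. by rewrite -cmod_gt0 cmodR normr_gt0 gt_eqF. Qed.
Let c2_neq0 : c2 != 0.
Proof. by rewrite -cmod_gt0 cmodR normr_gt0 gt_eqF. Qed.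

Definition hook_radicand (z : R[i]) : R[i] :=
  (1 - (p2%:C - p1%:C) ^+ 2 * z) / (1 - z).
(** The second summand of the R-transform in the theorem, with the square root
    moved to the denominator: this form is analytic at 0. It is also the
    R-transform of [compressed_mp] below, whence the name. *)
Definition compressed_R (z : R[i]) : R[i] :=
  2 * p1%:C * p2%:C / ((1 - z) * (1 + sqrtc (hook_radicand z))).

Lemma sub1_neq0 (z : R[i]) : cmod z < 1 -> 1 - z != 0.
Proof.
move=> z1; rewrite subr_eq0; apply: contraTneq z1 => <-.
by rewrite cmod1 ltxx.
Qed.

Lemma sqrtcD1_neq0 (z : R[i]) : 1 + sqrtc z != 0.
Proof.
apply/eqP => /(congr1 (@complex.Re R)); rewrite raddfD /=.
have := sqrtc_Re_ge0 z; lra.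
Qed.

Lemma cdiff_hook_radicand (z : R[i]) : 1 - z != 0 -> cdiff hook_radicand z.
Proof.
move=> z1.
have d1 : cdiff (fun x : R[i] => 1 - x) z := cdiffB (cdiff_cst 1 z) (cdiff_id z).
exact: cdiffM (cdiffB (cdiff_cst 1 z)
  (cdiffM (cdiff_cst ((p2%:C - p1%:C) ^+ 2 : R[i]) z) (cdiff_id z))) (cdiffV d1 z1).
Qed.

Lemma hook_radicand_near : exists2 e : R, 0 < e &
  forall z, cmod z < e -> 1 - z != 0 /\ 0 < complex.Re (hook_radicand z).
Proof.
have d0 : cdiff hook_radicand 0 by apply: cdiff_hook_radicand; rewrite subr0 oner_neq0.
have /near0E[e e0 h] := cdiff_near d0 (ltr01 : 0 < 1 :> R).
exists (Num.min e 1); first by rewrite lt_min e0 ltr01.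
move=> z; rewrite lt_min => /andP[ze z1]; split; first exact: sub1_neq0.
have := Re_le_cmod_sub (hook_radicand z) (hook_radicand 0).
have := h _ ze.
rewrite [hook_radicand 0]/hook_radicand mulr0 !subr0 divr1 => h1 h2.
by apply: lt_le_trans h2; rewrite subr_gt0.
Qed.

Lemma compressed_R_analytic : analytic_near0 compressed_R.
Proof.
have [e e0 h] := hook_radicand_near; apply: (near0P e0) => z /h[z1 zR].
have cS : cdiff (fun z : R[i] => sqrtc (hook_radicand z)) z.
  exact: cdiff_comp (cdiff_hook_radicand z1) (cdiff_sqrtc zR).
have d1 : cdiff (fun x : R[i] => 1 - x) z := cdiffB (cdiff_cst 1 z) (cdiff_id z).
have d2 := cdiffM d1 (cdiffD (cdiff_cst 1 z) cS).
have n2 : (1 - z) * (1 + sqrtc (hook_radicand z)) != 0.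
  by rewrite mulf_neq0// sqrtcD1_neq0.
exact: cdiffM (cdiff_cst (2 * p1%:C * p2%:C : R[i]) z) (cdiffV d2 n2).
Qed.

Lemma compressed_R_sqrt (z : R[i]) : 1 - z != 0 ->
  sqrtc (hook_radicand z) = 1 + 2 * (z * compressed_R z).
Proof.
move=> z1; have s1 := sqrtcD1_neq0 (hook_radicand z).
have := sqr_sqrtc (hook_radicand z); rewrite /compressed_R.
set s := sqrtc _ in s1 *; rewrite /hook_radicand -/c1 -/c2 c12 => s2.
apply/eqP; rewrite -subr_eq0; apply/eqP.
have -> : s - (1 + 2 * (z * (2 * c1 * (1 - c1) / ((1 - z) * (1 + s))))) =
  (s ^+ 2 - (1 - (1 - c1 - c1) ^+ 2 * z) / (1 - z)) / (1 + s).
  by field; apply/andP.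
by rewrite s2 subrr mul0r.
Qed.

Lemma compressed_R_formula (z : R[i]) : z != 0 -> 1 - z != 0 ->
  compressed_R z = (sqrtc (hook_radicand z) - 1) / (2 * z).
Proof.
by move=> z0 z1; rewrite compressed_R_sqrt// [1 + _]addrC addrK; field.
Qed.

Definition hook_R (z : R[i]) : R[i] := p1%:C / (1 - z) + compressed_R z.

Lemma free_poisson_R_analytic (p : R[i]) :
  analytic_near0 (fun z : R[i] => p / (1 - z)).
Proof.
apply: (@near0P _ _ 1) => // z /sub1_neq0 z1.
have d1 : cdiff (fun x : R[i] => 1 - x) z := cdiffB (cdiff_cst 1 z) (cdiff_id z).
exact: cdiffM (cdiff_cst p z) (cdiffV d1 z1).
Qed.

Lemma analytic_near0D (f g : R[i] -> R[i]) : analytic_near0 f -> analytic_near0 g ->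
  analytic_near0 (fun z => f z + g z).
Proof.
rewrite /analytic_near0 => hf; apply: filterS2 hf => z; exact: cdiffD.
Qed.

(** As a polynomial in the square root, the cubic at [hook_R z + 1 / z] is divisible
    by the difference between the square of the root and its radicand. *)
Lemma hook_cubic_R (z : R[i]) : z != 0 -> 1 - z != 0 ->
  hook_cubic c1 c2 z (hook_R z + z^-1) = 0.
Proof.
move=> z0 z1; rewrite /hook_R compressed_R_formula//.
have := sqr_sqrtc (hook_radicand z); set s := sqrtc _.
rewrite /hook_radicand -/c1 -/c2 /hook_cubic c12 => s2.
rewrite [LHS](_ : _ = (1 - z) ^+ 2 / (4 * z) *
  (s ^+ 2 - (1 - (1 - c1 - c1) ^+ 2 * z) / (1 - z))).
  by rewrite s2 subrr mulr0.
by field; rewrite z0 z1.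
Qed.

End hook_germs.

(** The difference of the values of the cubic at [G] and [g] is
    [(G - g) * z ^+ 2 * (1 - 2 * (G + g) + ...)], with a last factor close to 1 for
    small [G] and [g] and large [z]. *)
Lemma hook_cubic_small_root {R : realType} (c1 c2 G g z : R[i]) :
    cmod c1 <= 1 -> cmod c2 <= 1 -> 100 <= cmod z -> cmod G <= 1 / 10 -> cmod g <= 1 / 10 ->
    hook_cubic c1 c2 G z = 0 -> hook_cubic c1 c2 g z = 0 -> G = g.
Proof.
move=> h1 h2 hz hG hg eG eg.
have z0 : z != 0 by rewrite -cmod_gt0; lra.
pose K := 2 * c2 / z + ((c1 - c2) / z - 2) * (G + g) + (G ^+ 2 + G * g + g ^+ 2).
have : (G - g) * (z ^+ 2 * (1 + K)) = 0.
  rewrite (_ : _ * _ = hook_cubic c1 c2 G z - hook_cubic c1 c2 g z).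
    by rewrite eG eg subrr.
  by rewrite /hook_cubic /K; field.
have zi : cmod z^-1 <= 1 / 100.
  by rewrite cmodV invf_ple ?posrE//; lra.
have dz (c : R[i]) : cmod c <= 1 -> cmod (c / z) <= 1 / 100.
  move=> hc; rewrite cmodM; have := cmod_ge0 c; have := cmod_ge0 z^-1; nra.
have hK : cmod K < 1.
  rewrite /K.
  have k1 : cmod (2 * c2 / z) <= 2 / 100.
    by rewrite -mulrA cmodM cmod_nat; have := dz _ h2; lra.
  have k2 : cmod ((c1 - c2) / z - 2) <= 2 + 2 / 100.
    apply: le_trans (cmodB _ _) _; rewrite cmod_nat mulrBl.
    have := cmodB (c1 / z) (c2 / z); have := dz _ h1; have := dz _ h2; lra.
  have k3 : cmod (G + g) <= 2 / 10 by have := cmodD G g; lra.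
  have k4 : cmod (G ^+ 2 + G * g + g ^+ 2) <= 3 / 100.
    apply: le_trans (cmodD _ _) _; have := cmodD (G ^+ 2) (G * g).
    rewrite !cmodX cmodM; have := cmod_ge0 G; have := cmod_ge0 g; nra.
  apply: le_lt_trans (cmodD _ _) _.
  have := cmodD (2 * c2 / z) (((c1 - c2) / z - 2) * (G + g)).
  rewrite (cmodM ((c1 - c2) / z - 2)).
  have : cmod ((c1 - c2) / z - 2) * cmod (G + g) <= (2 + 2 / 100) * (2 / 10).
    by apply: ler_pM => //; exact: cmod_ge0.
  lra.
move/eqP; rewrite mulf_eq0 subr_eq0 => /orP[/eqP//|].
rewrite mulf_eq0 expf_eq0 /= (negbTE z0) /= addr_eq0 => /eqP e.
by move: hK; rewrite -cmodN -e cmod1 ltxx.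
Qed.

Section hook_R_transform.
Context {R : realType}.
Variables (a1 a2 : nat) (F : probability (measurableTypeR R) R).
Hypotheses (a1_gt0 : (0 < a1)%N) (a2_gt0 : (0 < a2)%N)
  (hF : is_F_lambda (fat_hook a1 a2) F).
Let p1 : R := a1%:R / (a1 + a2)%:R.
Let p2 : R := a2%:R / (a1 + a2)%:R.

(** Both the Cauchy transform at [hook_R z + 1 / z] and [z] itself are small roots
    of the cubic there, hence they are equal. *)
Lemma hook_R_transform : is_R_transform F (hook_R p1 p2).
Proof.
have l0 : 0 < (a1 + a2)%:R :> R by rewrite ltr0n addn_gt0 a1_gt0.
have p10 : 0 < p1 by rewrite divr_gt0// ltr0n.
have p20 : 0 < p2 by rewrite divr_gt0// ltr0n.
have p12 : p1 + p2 = 1 by rewrite -mulrDl -natrD divff// gt_eqF.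
have Fc := hook_distribution_compact a1_gt0 a2_gt0 hF.
apply: (@R_transform_intro _ _ _ 105).
- exact: probability_setT.
- by exists 5.
- exact: analytic_near0D (free_poisson_R_analytic _) (compressed_R_analytic _ _).
apply: (@dnear0P _ _ (1 / 10)) => [|z z0 ze Zlarge]; first lra.
have z1 : 1 - z != 0 by apply: sub1_neq0; lra.
apply: (@hook_cubic_small_root _ p1%:C p2%:C _ _ (hook_R p1 p2 z + z^-1)).
- by rewrite cmodR ger0_norm; lra.
- by rewrite cmodR ger0_norm; lra.
- lra.
- pose D : set (measurableTypeR R) := `[- 5, 5]%classic.
  have mD : measurable D by exact: measurable_itv.
  have FD := probability_le1 F mD.
  have fD : (F D < +oo)%E by exact: le_lt_trans FD (ltry _).
  apply: le_trans (cauchy_bound Fc fD _) _; first lra.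
  rewrite -/D; have : fine (F D) <= 1 by rewrite -lee_fin fineK// ge0_fin_numE.
  have : 0 <= fine (F D) by rewrite fine_ge0.
  have : (cmod (hook_R p1 p2 z + z^-1) - 5)^-1 <= 1 / 100.
    by rewrite invf_ple ?posrE; lra.
  have : 0 <= (cmod (hook_R p1 p2 z + z^-1) - 5)^-1 by rewrite invr_ge0; lra.
  nra.
- by lra.
- by apply: hook_cubic_far => //; lra.
- exact: hook_cubic_R.
Qed.

End hook_R_transform.

(** * Integrals against densities, sums and multiples of measures *)

Section density.
Context d (T : measurableType d) (R : realType).
Variables (mu : {sigma_finite_measure set T -> \bar R})
  (nu : {measure set T -> \bar R}) (g : T -> R).
Hypothesis mg : measurable_fun setT g.
Hypothesis nuE : forall A, measurable A -> nu A = (\int[mu]_(x in A) (g x)%:E)%E.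
Hypothesis nufin : (nu setT < +oo)%E.

(** The density agrees almost everywhere with the Radon-Nikodym derivative, for
    which the change of variables is available. *)
Lemma Rintegral_density (D : set T) (f : T -> R) : measurable D ->
  nu.-integrable D (EFin \o f) ->
  \int[nu]_(x in D) f x = \int[mu]_(x in D) (f x * g x).
Proof.
move=> mD fi.
have [P eP] : exists P : {finite_measure set T -> \bar R}, nu = P :> {measure set T -> \bar R}.
  exists (mfrestr measurableT nufin); apply: eq_measure; apply/funext => A.
  by rewrite /= /mfrestr /mrestr setIT.
have PE A : P A = nu A by rewrite eP.
have dom : P `<< mu.
  apply/null_content_dominatesP => A mA A0; rewrite PE nuE//.
  by apply: null_set_integral => //; apply/measurable_EFinP; exact: measurable_funTS.
rewrite /Rintegral; congr fine; rewrite eP.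
rewrite -(@Radon_Nikodym_change_of_variables _ _ _ P mu dom (EFin \o f))//; last first.
  by move: fi; rewrite eP.
set h := Radon_Nikodym _ _.
have hi : mu.-integrable setT h by exact: Radon_Nikodym_integrable.
have ha : ae_eq mu D h (EFin \o g).
  apply: integral_ae_eq => //.
  - exact: integrableS hi.
  - by apply/measurable_EFinP; exact: measurable_funTS.
  - by move=> E _ mE; rewrite -Radon_Nikodym_integral// -nuE//; exact: PE.
apply: ae_eq_integral => //.
- apply: emeasurable_funM; first exact: measurable_int fi.
  by apply: measurable_funTS; exact: measurable_int hi.
- apply/measurable_EFinP; apply: measurable_funM; last exact: measurable_funTS.
  by apply/measurable_EFinP; exact: measurable_int fi.
- exact: ae_eqe_mul2l ha.
Qed.
End density.

Section cint_measures.
Context d (T : measurableType d) (R : realType).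
Implicit Types (mu nu : {measure set T -> \bar R}) (D : set T) (f : T -> R[i]).

Lemma cint_add mu nu D f : measurable D -> cintegrable mu D f ->
  cintegrable nu D f -> cint (measure_add mu nu) D f = cint mu D f + cint nu D f.
Proof.
move=> mD [m1 m2] [n1 n2]; rewrite /cint /Rintegral.
rewrite !integral_measure_add//; try exact: measurable_int m1; try exact: measurable_int m2.
by rewrite (fineD (integrable_fin_num mD m1) (integrable_fin_num mD n1))
  (fineD (integrable_fin_num mD m2) (integrable_fin_num mD n2)).
Qed.

Lemma cint_mscale mu D f (k : {nonneg R}) : measurable D -> cintegrable mu D f ->
  cint (mscale k mu) D f = k%:num%:C * cint mu D f.
Proof.
move=> mD [m1 m2].
have Z (g : T -> R) : mu.-integrable D (EFin \o g) ->
    \int[mscale k mu]_(x in D) g x = k%:num * \int[mu]_(x in D) g x.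
  move=> ig; have mg := measurable_int _ ig.
  rewrite /Rintegral integralE.
  rewrite !ge0_integral_mscale//; last 2 first.
  - exact: measurable_funeneg.
  - exact: measurable_funepos.
  have ip := integrable_fin_num mD (integrable_funepos mD ig).
  have iN := integrable_fin_num mD (integrable_funeneg mD ig).
  by rewrite fineB ?fin_numM// !fineM// -mulrBr -fineB// -integralE.
by rewrite /cint !Z//; simpc.
Qed.

Lemma cint_dirac (a : T) D f : measurable D -> D a -> cmeasurable D f ->
  cint (\d_a) D f = f a.
Proof.
move=> mD Da [m1 m2]; rewrite /cint /Rintegral !integral_dirac//; last 2 first.
- exact/measurable_EFinP.
- exact/measurable_EFinP.
by rewrite !diracE mem_set// !mul1e; case: (f a).
Qed.

Lemma cint_density (mu : {sigma_finite_measure set T -> \bar R}) nu (g : T -> R) D f :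
    measurable_fun setT g ->
    (forall A, measurable A -> nu A = (\int[mu]_(x in A) (g x)%:E)%E) ->
    (nu setT < +oo)%E -> measurable D -> cintegrable nu D f ->
  cint nu D f = cint mu D (fun x => f x * (g x)%:C).
Proof.
move=> mg nuE nufin mD [i1 i2]; rewrite /cint.
rewrite (Rintegral_density mg nuE nufin mD i1) (Rintegral_density mg nuE nufin mD i2).
by congr Complex; apply: eq_Rintegral => x _;
  rewrite ?complex_ReM ?complex_ImM /= mulr0 ?subr0 ?add0r.
Qed.

End cint_measures.

(** * A trigonometric integral *)

Section trigonometric_integrals.
Context {R : realType}.
Let mu := @lebesgue_measure R.
Let I0 : set (measurableTypeR R) := `[0, pi]%classic.
Let mI : measurable I0. Proof. exact: measurable_itv. Qed.
Let muI : mu I0 = (pi : R)%:E.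
Proof. by rewrite /mu /I0 lebesgue_measure_itv /= lte_fin pi_gt0 sube0. Qed.
Let muIfin : (mu I0 < +oo)%E. Proof. by rewrite muI ltry. Qed.

Lemma sin_natpi n : sin (n%:R * pi : R) = 0.
Proof.
elim: n => [|n IH]; first by rewrite mul0r sin0.
by rewrite -natr1 mulrDl mul1r sinDpi IH oppr0.
Qed.

Lemma continuous_cosM (k : R) : continuous (fun x : R => cos (k * x)).
Proof.
move=> x; apply: (@continuous_comp _ _ _ (fun x => k * x) cos).
  exact: mulrl_continuous.
exact: continuous_cos.
Qed.

Lemma continuous_sinM (k : R) : continuous (fun x : R => sin (k * x)).
Proof.
move=> x; apply: (@continuous_comp _ _ _ (fun x => k * x) sin).
  exact: mulrl_continuous.
exact: continuous_sin.
Qed.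

Lemma integral_cos_nat k : \int[mu]_(x in I0) cos (k%:R * x) = if k == 0%N then pi else 0.
Proof.
case: eqP => [->|/eqP k0].
  under eq_Rintegral do rewrite mul0r cos0.
  rewrite Rintegral_cst// mul1r. exact: (congr1 fine muI).
have k0' : (k%:R : R) != 0 by rewrite pnatr_eq0.
have der (x : R) : is_derive x 1 (fun x => k%:R^-1 * sin (k%:R * x)) (cos (k%:R * x)).
  apply: is_derive_eq.
  by rewrite /GRing.scale /= mulr1 mulrCA mulVf// mulr1.
rewrite /Rintegral (@continuous_FTC2 _ _ (fun x => k%:R^-1 * sin (k%:R * x))).
- by rewrite mulr0 sin0 sin_natpi !mulr0 sube0.
- exact: pi_gt0.
- by apply: continuous_subspaceT; exact: continuous_cosM.
- have cF : continuous (fun x : R => k%:R^-1 * sin (k%:R * x)).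
    by move=> x; apply: cvgMr; exact: continuous_sinM.
  split.
  + by move=> x _; have [] := der x.
  + by apply: cvg_at_right_filter; exact: cF.
  + by apply: cvg_at_left_filter; exact: cF.
- by move=> x _; rewrite derive1E; have [_ ->] := der x.
Qed.

Lemma integrable_continuous (f : R -> R) : continuous f ->
  mu.-integrable I0 (EFin \o f).
Proof.
move=> cf; apply: continuous_compact_integrable; first exact: segment_compact.
exact: continuous_subspaceT.
Qed.

Lemma integral_sin_sin n :
  \int[mu]_(x in I0) (sin x * sin (n.+1%:R * x)) = if n == 0%N then pi / 2 else 0.
Proof.
have E (x : R) : sin x * sin (n.+1%:R * x) =
    2^-1 * (cos (n%:R * x) - cos (n.+2%:R * x)).
  have -> : n.+2%:R * x = n.+1%:R * x + x by rewrite -[n.+2%:R]natr1 mulrDl mul1r.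
  have -> : n%:R * x = n.+1%:R * x - x by rewrite -[n.+1%:R]natr1 mulrDl mul1r addrK.
  by rewrite cosB cosD; field.
under eq_Rintegral do rewrite E.
have ic k := integrable_continuous (@continuous_cosM k%:R).
rewrite RintegralZl//; last first.
  by apply: integrable_continuous => x; apply: cvgB; exact: continuous_cosM.
rewrite RintegralB//; try exact: ic.
by rewrite !integral_cos_nat; case: n {E} => [|n] /=; rewrite subr0 ?mulr0// mulrC.
Qed.

Definition poisson_denominator (v : R[i]) (x : R) : R[i] :=
  1 - 2 * v * (cos x)%:C + v ^+ 2.

(** The denominator factors as [(1 - v * e^(i x)) * (1 - v * e^(- i x))]. *)
Lemma poisson_ge (v : R[i]) x : cmod v < 1 -> (1 - cmod v) ^+ 2 <= cmod (poisson_denominator v x).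
Proof.
move=> v1; pose e : R[i] := cos x +i* sin x; pose e' : R[i] := cos x -i* sin x.
have ce : cmod e = 1 by rewrite /cmod /= cos2Dsin2 sqrtr1.
have ce' : cmod e' = 1 by rewrite /cmod /= sqrrN cos2Dsin2 sqrtr1.
have -> : poisson_denominator v x = (1 - v * e) * (1 - v * e').
  have ee : e * e' = 1.
    rewrite /e /e'; simpc; rewrite -!expr2 cos2Dsin2.
    by rewrite [sin x * cos x]mulrC addNr.
  have es : e + e' = 2 * (cos x)%:C.
    by rewrite mulr_natl mulr2n /e /e'; simpc.
  transitivity (1 - v * (e + e') + v ^+ 2 * (e * e')); last by ring.
  by rewrite ee es /poisson_denominator; ring.
rewrite cmodM expr2; have b w : cmod w = 1 -> 1 - cmod v <= cmod (1 - v * w).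
  by move=> w1; have := ler_cmod_sub 1 (v * w); rewrite cmodM w1 mulr1 cmod1.
by apply: ler_pM; rewrite ?subr_ge0 ?(ltW v1)// b.
Qed.

Lemma poisson_neq0 (v : R[i]) x : cmod v < 1 -> poisson_denominator v x != 0.
Proof.
move=> v1; rewrite -cmod_gt0; apply: lt_le_trans (poisson_ge x v1).
by rewrite exprn_gt0// subr_gt0.
Qed.

Let s (x : R) n : R[i] := (sin (n%:R * x))%:C.

(** Truncation of the expansion of [sin x / (1 - 2 v cos x + v^2)] as the sum of the
    [v ^+ n * sin ((n + 1) x)], with its exact remainder. *)
Lemma poisson_telescope (v : R[i]) (x : R) N :
  (\sum_(n < N) v ^+ n * s x n.+1) * poisson_denominator v x =
  s x 1 - v ^+ N * s x N.+1 + v ^+ N.+1 * s x N.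
Proof.
elim: N => [|N IH].
  by rewrite big_ord0 mul0r expr0 mul1r subrr add0r /s mul0r sin0 mulr0.
rewrite big_ord_recr /= mulrDl IH /poisson_denominator.
have -> : s x N.+2 = 2 * (cos x)%:C * s x N.+1 - s x N.
  rewrite /s -[N.+2%:R]natr1 -[N.+1%:R]natr1 -(rmorph_nat (real_complex R) 2) -!rmorphM -rmorphB.
  congr (_ %:C); rewrite mulrDl mul1r mulrDl mul1r.
  set t := N%:R * x; rewrite !sinD cosD.
  apply/eqP; rewrite -subr_eq0.
  rewrite [X in X == 0](_ : _ = sin t * (1 - (cos x ^+ 2 + sin x ^+ 2))).
    by rewrite cos2Dsin2 subrr mulr0.
  by ring.
by rewrite !exprS; ring.
Qed.

Let cmeasurable_cont (f : R -> R) : continuous f -> cmeasurable I0 (fun x => (f x)%:C).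
Proof.
move=> cf; apply: cmeasurable_real; apply: measurable_funTS.
exact: continuous_measurable_fun.
Qed.

Let cmeasurable_poissonV (v : R[i]) : cmeasurable I0 (fun x => (poisson_denominator v x)^-1).
Proof.
apply: cmeasurableV; apply: cmeasurableD; last exact: cmeasurable_cst.
apply: cmeasurableD; first exact: cmeasurable_cst.
apply: cmeasurableN; apply: cmeasurableM; first exact: cmeasurable_cst.
by apply: cmeasurable_cont; exact: continuous_cos.
Qed.

Let poissonV_le (v : R[i]) x : cmod v < 1 ->
  cmod (poisson_denominator v x)^-1 <= ((1 - cmod v) ^+ 2)^-1.
Proof.
move=> v1; have d0 : 0 < (1 - cmod v) ^+ 2 by rewrite exprn_gt0// subr_gt0.
rewrite cmodV lef_pV2 ?posrE ?poisson_ge//.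
by apply: lt_le_trans (poisson_ge x v1).
Qed.

Lemma poisson_integrable (v : R[i]) : cmod v < 1 ->
  cintegrable mu I0 (fun x => ((sin x) ^+ 2)%:C / poisson_denominator v x).
Proof.
move=> v1; apply: (@cintegrable_bounded _ _ _ _ _ _ (1 * ((1 - cmod v) ^+ 2)^-1)) => //.
  apply: cmeasurableM; last exact: cmeasurable_poissonV.
  by apply: cmeasurable_cont => x; have := cvgM (@continuous_sin R x) (@continuous_sin R x); apply.
move=> x _; rewrite cmodM; apply: ler_pM; rewrite ?cmod_ge0 ?poissonV_le//.
by rewrite cmodR normrX expr_le1 ?sin_max.
Qed.

(** In the expansion of [poisson_telescope], multiplied by [sin x], only the term
    [n = 0] has a nonzero integral by orthogonality of the sines. *)
Lemma poisson_integral (v : R[i]) : cmod v < 1 ->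
  cint mu I0 (fun x => ((sin x) ^+ 2)%:C / poisson_denominator v x) = (pi / 2)%:C.
Proof.
move=> v1; have v0 := cmod_ge0 v.
have d0 : 0 < (1 - cmod v) ^+ 2 by rewrite exprn_gt0// subr_gt0.
have cm := cmeasurable_cont.
have Pinv x := poissonV_le x v1.
have sin1 (n : nat) (x : R) : cmod (s x n) <= 1 by rewrite /s cmodR sin_max.
pose F n (x : R) : R[i] := v ^+ n * (sin x * sin (n.+1%:R * x))%:C.
have iF n : cintegrable mu I0 (F n).
  apply: cintegrableZ => //.
  apply: (@cintegrable_bounded _ _ _ _ _ _ 1) => //.
    by apply: cm => x; apply: cvgM; [exact: continuous_sin|exact: continuous_sinM].
  move=> x _; rewrite cmodR normrM -[leRHS]mulr1.
  by apply: ler_pM => //; exact: sin_max.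
pose E N (x : R) : R[i] :=
  (v ^+ N * s x N.+1 - v ^+ N.+1 * s x N) * (sin x)%:C * (poisson_denominator v x)^-1.
pose K := 2 * ((1 - cmod v) ^+ 2)^-1.
have bE N x : I0 x -> cmod (E N x) <= K * cmod v ^+ N.
  move=> _; rewrite /E !cmodM cmodR.
  apply: (@le_trans _ _ (2 * cmod v ^+ N * 1 * ((1 - cmod v) ^+ 2)^-1)); last first.
    by rewrite mulr1 /K mulrAC.
  apply: ler_pM; rewrite ?mulr_ge0 ?cmod_ge0//.
  apply: ler_pM; rewrite ?cmod_ge0 ?sin_max//.
  apply: le_trans (cmodB _ _) _; rewrite !cmodM !cmodX mulr2n mulrDl mul1r.
  have vN := exprn_ge0 N v0.
  apply: lerD; first by rewrite ler_piMr.
  apply: (@le_trans _ _ (cmod v ^+ N.+1)); first by rewrite ler_piMr ?exprn_ge0.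
  by rewrite exprS ler_piMl// ltW.
have iE N : cintegrable mu I0 (E N).
  apply: (cintegrable_bounded _ _ _ (bE N)) => //.
  apply: cmeasurableM => //; apply: cmeasurableM; last by apply: cm; exact: continuous_sin.
  by apply: cmeasurableD; [|apply: cmeasurableN]; apply: cmeasurableM;
    try exact: cmeasurable_cst; apply: cm; exact: continuous_sinM.
have dec N : cint mu I0 (fun x => ((sin x) ^+ 2)%:C / poisson_denominator v x) =
    \sum_(n < N) cint mu I0 (F n) + cint mu I0 (E N).
  rewrite -cint_sum// -cintD//; last exact: cintegrable_sum.
  apply: eq_cint => x _.
  have P0 := poisson_neq0 x v1.
  apply: (mulIf P0); rewrite divfK// mulrDl /E divfK//.
  have -> : \sum_(n < N) F n x = (sin x)%:C * \sum_(n < N) v ^+ n * s x n.+1.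
    rewrite mulr_sumr; apply: eq_bigr => n _; rewrite /F /s rmorphM; ring.
  rewrite -mulrA poisson_telescope {1}/s mul1r rmorphXn /=; ring.
have iF0 n : cint mu I0 (F n) = if n == 0%N then (pi / 2)%:C else 0.
  rewrite /F cintZ//; last first.
    apply: (@cintegrable_bounded _ _ _ _ _ _ 1) => //.
      by apply: cm => x; apply: cvgM; [exact: continuous_sin|exact: continuous_sinM].
    move=> x _; rewrite cmodR normrM -[leRHS]mulr1.
    by apply: ler_pM => //; exact: sin_max.
  rewrite cint_real integral_sin_sin; case: eqP => [->|_]; first by rewrite mul1r.
  by rewrite rmorph0 mulr0.
apply/eqP; rewrite -subr_eq0 -cmod_eq0; apply/eqP/le_anti; rewrite cmod_ge0 andbT.
apply: (@le0_of_geom _ _ (2 * K * fine (mu I0) * cmod v) (cmod v)); first by rewrite v0.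
move=> N; rewrite (dec N.+1) big_ord_recl iF0 eqxx big1; last first.
  by move=> n _; rewrite iF0.
rewrite addr0 addrC addKr.
apply: le_trans (cint_bound _ _ _ (iE N.+1) (bE N.+1)) _ => //.
  by rewrite mulr_ge0 ?exprn_ge0// mulr_ge0// invr_ge0 ltW.
rewrite exprS le_eqVlt; apply/orP; left; apply/eqP; ring.
Qed.

End trigonometric_integrals.

(** * The Cauchy transform of the semicircle *)

Section semicircle.
Context {R : realType}.
Variables (c d : R).
Hypothesis d0 : 0 < d.
Let mu := @lebesgue_measure R.
Let I0 : set (measurableTypeR R) := `[0, pi]%classic.
Let J : set (measurableTypeR R) := `[c - d, c + d]%classic.
Let mJ : measurable J. Proof. exact: measurable_itv. Qed.
Let phi (t : R) : R := c - d * cos t.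

Let phi_deriv (t : R) : is_derive t 1 phi (d * sin t).
Proof.
rewrite /phi; apply: is_derive_eq.
by rewrite /GRing.scale /= add0r mul1r mulrN opprK.
Qed.

Let phi_cont : continuous phi.
Proof.
by move=> t; apply: cvgB; [exact: cvg_cst|apply: cvgMr; exact: continuous_cos].
Qed.

Lemma integral_circle_subst (G : R -> R) :
  (forall x, c - d <= x <= c + d -> {for x, continuous G}) ->
  \int[mu]_(x in J) G x = \int[mu]_(t in I0) (G (phi t) * (d * sin t)).
Proof.
move=> cG.
have D1 : (phi^`())%classic = (fun t => d * sin t).
  by apply/funext => t; rewrite derive1E; have [_ ->] := phi_deriv t.
have cD : continuous (fun t : R => d * sin t).
  by move=> t; apply: cvgMr; exact: continuous_sin.
rewrite /Rintegral; congr fine.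
have := @integration_by_substitution_increasing R phi G 0 pi (pi_ge0 R).
have p0 : phi 0 = c - d by rewrite /phi cos0 mulr1.
have ppi : phi pi = c + d by rewrite /phi cospi mulrN1 opprK.
rewrite p0 ppi => -> //.
- by rewrite D1.
- move=> x y xI yI xy; rewrite /phi ltrD2l ltrN2 ltr_pM2l//.
  by rewrite ltr_cos.
- by move=> x _; rewrite D1; exact: cD.
- by rewrite D1; apply/cvg_ex; exists (d * sin 0); apply: cvg_at_right_filter; exact: cD.
- by rewrite D1; apply/cvg_ex; exists (d * sin pi); apply: cvg_at_left_filter; exact: cD.
- split.
  + by move=> x _; have [] := phi_deriv x.
  + by apply: cvg_at_right_filter; exact: phi_cont.
  + by apply: cvg_at_left_filter; exact: phi_cont.
- apply: continuous_in_subspaceT => x; rewrite inE /= in_itv /=; exact: cG.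
Qed.

Definition semicircle (x : R) : R := Num.sqrt (d ^+ 2 - (x - c) ^+ 2).

Lemma continuous_semicircle : continuous semicircle.
Proof.
move=> x; apply: continuous_comp; last exact: sqrt_continuous.
have h : (fun x : R => x - c) x @[x --> x] --> x - c.
  by apply: cvgB; [exact: cvg_id|exact: cvg_cst].
by apply: cvgB; [exact: cvg_cst|rewrite expr2; exact: cvgM].
Qed.

Lemma semicircle_le x : semicircle x <= d.
Proof.
rewrite -[leRHS](gtr0_norm d0) -sqrtr_sqr ler_wsqrtr// gerBl; exact: sqr_ge0.
Qed.

Lemma continuous_resolvent (z : R[i]) (x : R) : z - x%:C != 0 ->
  {for x, continuous (fun x : R => complex.Re (z - x%:C)^-1)} /\
  {for x, continuous (fun x : R => complex.Im (z - x%:C)^-1)}.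
Proof.
case: z => a b zx.
have n0 : (a - x) ^+ 2 + b ^+ 2 != 0.
  apply: contra zx; rewrite paddr_eq0 ?sqr_ge0// !sqrf_eq0.
  by move=> /andP[/eqP h1 /eqP h2]; rewrite eq_complex /= h1 h2 oppr0 addr0 eqxx.
have h : (fun x : R => a - x) x @[x --> x] --> a - x.
  by apply: cvgB; [exact: cvg_cst|exact: cvg_id].
have hn : ((a - t) ^+ 2 + b ^+ 2)^-1 @[t --> x] --> ((a - x) ^+ 2 + b ^+ 2)^-1.
  by apply: cvgV => //; apply: cvgD; [rewrite expr2; exact: cvgM|exact: cvg_cst].
have e1 : (fun x : R => complex.Re (a +i* b - x%:C)^-1) =
    (fun t => (a - t) * ((a - t) ^+ 2 + b ^+ 2)^-1).
  by apply/funext => t /=; rewrite oppr0 addr0.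
have e2 : (fun x : R => complex.Im (a +i* b - x%:C)^-1) =
    (fun t => (- b) * ((a - t) ^+ 2 + b ^+ 2)^-1).
  by apply/funext => t /=; rewrite oppr0 addr0 mulNr.
have hb : (fun _ : R => - b) x @[x --> x] --> - b by exact: cvg_cst.
rewrite e1 e2; split; rewrite /prop_for /continuous_at.
  by have := cvgM h hn; apply.
by have := cvgM hb hn; apply.
Qed.

Variable u : R[i].
Hypotheses (u0 : u != 0) (u1 : cmod u < 1).
(** This map sends the punctured unit disc onto the complement of the segment
    [[c - d, c + d]], and the Cauchy transform of the semicircle on that segment
    is linear in the new coordinate [u]. *)
Definition joukowski : R[i] := c%:C + (d / 2)%:C * (u + u^-1).
Let Z := joukowski.

Let dC : (d%:C : R[i]) != 0.
Proof. by rewrite -cmod_gt0 cmodR normr_gt0 gt_eqF. Qed.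

Let Zphi t : Z - (phi t)%:C = d%:C / (2 * u) * poisson_denominator (- u) t.
Proof.
rewrite /Z /joukowski /phi /poisson_denominator rmorphB rmorphM rmorphM fmorphV /= rmorph_nat.
by field.
Qed.

Let phi_onto x : J x -> exists2 t, I0 t & x = phi t.
Proof.
rewrite /J /= in_itv /= => /andP[h1 h2].
have hy : -1 <= (c - x) / d <= 1.
  by rewrite ler_pdivlMr// ler_pdivrMr//; apply/andP; split; lra.
exists (acos ((c - x) / d)).
  by rewrite /I0 /= in_itv /= acos_ge0// acos_lepi.
rewrite /phi acosK ?in_itv//= mulrC divfK ?gt_eqF//; ring.
Qed.

Let Zbound x : J x -> d / (2 * cmod u) * (1 - cmod u) ^+ 2 <= cmod (Z - x%:C).
Proof.
move=> /phi_onto[t _ ->]; rewrite Zphi cmodM cmodM cmodV cmodM cmod_nat.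
rewrite cmodR gtr0_norm// ler_wpM2l//.
  by rewrite divr_ge0// ?(ltW d0)// mulr_ge0// cmod_ge0.
by have := @poisson_ge R (- u) t; rewrite cmodN; apply.
Qed.

Let Zbound_gt0 : 0 < d / (2 * cmod u) * (1 - cmod u) ^+ 2.
Proof.
apply: mulr_gt0; last by rewrite exprn_gt0// subr_gt0.
by rewrite divr_gt0// mulr_gt0// cmod_gt0.
Qed.

Let Zneq0 x : J x -> Z - x%:C != 0.
Proof. by move=> Jx; rewrite -cmod_gt0; apply: lt_le_trans (Zbound Jx). Qed.

Let muJ : (mu J < +oo)%E.
Proof. by rewrite /mu /J lebesgue_measure_itv; case: ifP => _; rewrite ?ltry. Qed.

Lemma semicircle_integrable :
  cintegrable mu J (fun x => (Z - x%:C)^-1 * (semicircle x)%:C).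
Proof.
apply: (@cintegrable_bounded _ _ _ _ _ _
  ((d / (2 * cmod u) * (1 - cmod u) ^+ 2)^-1 * d)) => //.
  apply: cmeasurableM; first exact: cmeasurable_resolvent.
  apply: cmeasurable_real; apply: measurable_funTS.
  exact: continuous_measurable_fun continuous_semicircle.
move=> x Jx; rewrite cmodM cmodV cmodR; apply: ler_pM => //.
- by rewrite invr_ge0 cmod_ge0.
- rewrite lef_pV2 ?posrE ?Zbound//.
  exact: lt_le_trans (Zbound Jx).
- by rewrite ger0_norm ?sqrtr_ge0// semicircle_le.
Qed.

(** The substitution [x = c - d cos t] turns the resolvent at [joukowski u] into
    [2 u / d] over the Poisson denominator at [- u], and the semicircle into
    [d sin t]. *)
Lemma semicircle_cauchy :
  cint mu J (fun x => (Z - x%:C)^-1 * (semicircle x)%:C) = (pi * d)%:C * u.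
Proof.
have sphi t : I0 t -> semicircle (phi t) = d * sin t.
  rewrite /I0 /= in_itv /= => tI; have s0 := sin_ge0_pi tI.
  rewrite /semicircle /phi (_ : d ^+ 2 - _ = (d * sin t) ^+ 2).
    by rewrite sqrtr_sqr ger0_norm// mulr_ge0// ltW.
  by rewrite exprMn sin2cos2; ring.
have -> : cint mu J (fun x => (Z - x%:C)^-1 * (semicircle x)%:C) =
    cint mu I0 (fun t => (Z - (phi t)%:C)^-1 * ((d * sin t) ^+ 2)%:C).
  have sub (f : R -> R) : (forall x, J x -> {for x, continuous f}) ->
      \int[mu]_(x in J) (f x * semicircle x) =
      \int[mu]_(t in I0) (f (phi t) * (d * sin t) ^+ 2).
    move=> cf; rewrite integral_circle_subst; last first.
      move=> x xJ; apply: cvgM; last exact: continuous_semicircle.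
      by apply: cf; rewrite /J /= in_itv.
    by apply: eq_Rintegral => t /set_mem It; rewrite sphi// expr2 -mulrA.
  have eR (w : R[i]) (r : R) : complex.Re (w * r%:C) = complex.Re w * r.
    by rewrite complex_ReM /= mulr0 subr0.
  have eI (w : R[i]) (r : R) : complex.Im (w * r%:C) = complex.Im w * r.
    by rewrite complex_ImM /= mulr0 add0r.
  rewrite /cint; congr Complex.
    under eq_Rintegral do rewrite eR.
    rewrite (sub (fun x => complex.Re (Z - x%:C)^-1)).
      by apply: eq_Rintegral => t _; rewrite eR.
    by move=> x /Zneq0 /continuous_resolvent[].
  under eq_Rintegral do rewrite eI.
  rewrite (sub (fun x => complex.Im (Z - x%:C)^-1)).
    by apply: eq_Rintegral => t _; rewrite eI.
  by move=> x /Zneq0 /continuous_resolvent[].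
have vu : cmod (- u) < 1 by rewrite cmodN.
rewrite (@eq_cint _ (measurableTypeR R) R mu I0 _ (fun t : R => 2 * u * d%:C * (((sin t) ^+ 2)%:C / poisson_denominator (- u) t))); last first.
  move=> t _; rewrite Zphi exprMn rmorphM rmorphXn /=.
  have := poisson_neq0 t vu => P0.
  by field; rewrite P0 u0 dC.
have mI : measurable I0 by exact: measurable_itv.
rewrite cintZ ?poisson_integral//; last exact: poisson_integrable.
by rewrite !rmorphM fmorphV /= rmorph_nat; field.
Qed.

End semicircle.

(** * The semicircle divided by its abscissa *)

Section semicircle_over_x.
Context {R : realType}.
Variables (d v : R).
Hypotheses (d0 : 0 < d) (v0 : 0 < v) (v1 : v <= 1).
Let c : R := d / 2 * (v + v^-1).
Let mu := @lebesgue_measure R.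
Let J : set (measurableTypeR R) := `[c - d, c + d]%classic.
Let mJ : measurable J. Proof. exact: measurable_itv. Qed.

(** The point of the real line to the left of the segment with coordinate [- w];
    [c] is chosen such that [root v = 0]. *)
Let root (w : R) : R := c - d / 2 * (w + w^-1).

Lemma joukowski_ge : d <= c.
Proof.
have := d0; have := v0 => v_gt0 d_gt0; rewrite -subr_ge0 /c.
rewrite (_ : _ - d = d / 2 * ((1 - v) ^+ 2 / v)); last by field; rewrite gt_eqF.
by rewrite mulr_ge0 ?divr_ge0 ?sqr_ge0// ltW.
Qed.

Let integral_root (w : R) : 0 < w -> w < 1 ->
  (\int[mu]_(x in J) (semicircle c d x * (x - root w)^-1)%:E)%E = (pi * d * w)%:E.
Proof.
move=> w0 w1.
have u0 : (- w%:C : R[i]) != 0 by rewrite oppr_eq0 -cmod_gt0 cmodR normr_gt0 gt_eqF.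
have u1 : cmod (- w%:C : R[i]) < 1 by rewrite cmodN cmodR gtr0_norm.
have := semicircle_integrable c d0 u0 u1; have := semicircle_cauchy c d0 u0 u1.
have -> : joukowski c d (- w%:C) = (root w)%:C.
  rewrite /joukowski /root invrN -opprD mulrN rmorphB; congr (_ - _).
  by rewrite [RHS]rmorphM; congr (_ * _); rewrite rmorphD fmorphV.
have E x : (((root w)%:C - x%:C)^-1 * (semicircle c d x)%:C : R[i]) =
    (- (semicircle c d x * (x - root w)^-1))%:C.
  rewrite -rmorphB -fmorphV -rmorphM; congr (_%:C).
  by rewrite -[root w - x]opprB invrN mulNr mulrC.
rewrite (@eq_cint _ (measurableTypeR R) R mu J _ (fun x : R => (- (semicircle c d x * (x - root w)^-1))%:C)); last first.
  by move=> x _; exact: E.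
rewrite cint_real => /(congr1 (@complex.Re R)) /= I [i1 _].
have i2 : mu.-integrable J (EFin \o (fun x => - (semicircle c d x * (x - root w)^-1))).
  by move: i1; congr integrable; apply/funext => x; rewrite /comp E.
have i3 : mu.-integrable J (EFin \o (fun x => semicircle c d x * (x - root w)^-1)).
  have := integrableN i2; congr integrable; apply/funext => x.
  by rewrite /comp; exact: (congr1 EFin (opprK _)).
have N : \int[mu]_(x in J) - (semicircle c d x * (x - root w)^-1) =
   - \int[mu]_(x in J) (semicircle c d x * (x - root w)^-1).
  rewrite -[RHS]mulN1r -RintegralZl//; apply: eq_Rintegral => x _.
  by rewrite mulN1r.
rewrite -[LHS]fineK; last exact: integrable_fin_num.
congr EFin; apply: oppr_inj; rewrite -[LHS]N I; ring.
Qed.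

(** The integrand is the semicircle against [1 / (x - r)] for [r = 0], which for
    [v = 1] is the left end of the segment, out of reach of [semicircle_cauchy].
    The value there is the monotone limit of the values at points [r < 0]. *)
Lemma semicircle_over_x :
  (\int[mu]_(x in J) (semicircle c d x / x)%:E = (pi * d * v)%:E)%E.
Proof.
pose w n : R := v * (1 - n.+2%:R^-1).
have n2 n : 0 < (n.+2%:R^-1 : R) < 1.
  by rewrite invr_gt0 ltr0n /= invf_lt1 ?ltr0n// ltr1n.
have wv n : 0 < w n < v.
  have /andP[h1 h2] := n2 n.
  rewrite /w; apply/andP; split; first by rewrite mulr_gt0// subr_gt0.
  by rewrite gtr_pMr// gtrBl.
have w1 n : w n < 1 by have /andP[_ h] := wv n; exact: lt_le_trans v1.
have root_ltv (x : R) : 0 < x -> x < v -> root x < root v.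
  move=> x0 xv; have x1 := lt_le_trans xv v1.
  rewrite -subr_gt0 (_ : root v - root x = d / 2 * ((v - x) * (1 - x * v) / (x * v))).
    rewrite mulr_gt0 ?divr_gt0// mulr_gt0 ?subr_gt0// ?mulr_gt0//.
    apply: le_lt_trans x1; rewrite -[leRHS]mulr1 ler_pM// ltW//.
  by rewrite /root; field; rewrite !gt_eqF.
have root_lt (x y : R) : 0 < x -> x <= y -> y <= v -> root x <= root y.
  move=> x0 xy yv; have y0 := lt_le_trans x0 xy.
  rewrite -subr_ge0 (_ : root y - root x = d / 2 * ((y - x) * (1 - x * y) / (x * y))).
    rewrite mulr_ge0 ?divr_ge0 ?(ltW d0)// mulr_ge0 ?subr_ge0 ?(ltW x0) ?(ltW y0)//.
    have y1 : y <= 1 := le_trans yv v1.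
    have x1 : x <= 1 := le_trans xy y1.
    by rewrite -[leRHS]mulr1 ler_pM// ltW.
  by rewrite /root; field; rewrite !gt_eqF.
have root_v : root v = 0 by rewrite /root /c subrr.
have root_neg n : root (w n) <= 0.
  by have /andP[h1 h2] := wv n; rewrite -root_v root_lt// ltW.
have w0 n : 0 < w n by have /andP[] := wv n.
have w_nd m n : (m <= n)%N -> w m <= w n.
  move=> mn; rewrite /w ler_pM2l// lerD2l lerN2 lef_pV2 ?posrE ?ltr0n//.
  by rewrite ler_nat !ltnS.
have w_cvg : w n @[n --> \oo] --> v.
  have h0 : (n.+2%:R^-1 : R) @[n --> \oo] --> (0 : R).
    have h := @cvg_harmonic R; rewrite -(cvg_shiftn 1) /= in h.
    by move: h; under eq_fun do rewrite addn1.
  have h1 : (1 - n.+2%:R^-1 : R) @[n --> \oo] --> (1 - 0 : R).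
    by apply: cvgB h0; exact: cvg_cst.
  have e : v * (1 - 0) = v by rewrite subr0 mulr1.
  by rewrite -[X in _ --> X]e; apply: cvgMr.
have rw_cvg : root (w n) @[n --> \oo] --> (0 : R).
  rewrite -root_v /root; apply: cvgB; first exact: cvg_cst.
  apply: cvgMr; apply: cvgD => //; apply: cvgV => //; by rewrite gt_eqF.
have Jge x : J x -> 0 <= x.
  rewrite /J /= in_itv /= => /andP[h _]; apply: le_trans h.
  by rewrite subr_ge0 joukowski_ge.
pose g n (x : measurableTypeR R) : \bar R := (semicircle c d x * (x - root (w n))^-1)%:E.
have gl x : J x -> (semicircle c d x / x)%:E = limn (fun n => g n x).
  move=> Jx; apply/esym/cvg_lim => //; apply: cvg_EFin; first by near=> n.
  have [x0|x0] := eqVneq x 0.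
    have s0 : semicircle c d x = 0.
      rewrite /semicircle ler0_sqrtr// x0 sub0r sqrrN subr_le0.
      by rewrite lerXn2r ?nnegrE ?joukowski_ge// ltW// (lt_le_trans d0)// joukowski_ge.
    by rewrite /g /= s0 mul0r; under eq_fun do rewrite /= mul0r; exact: cvg_cst.
  apply: cvgMr; apply: cvgV => //.
  have e : x - 0 = x by rewrite subr0.
  by rewrite -[X in _ --> X]e; apply: cvgB => //; exact: cvg_cst.
rewrite (eq_integral (fun x => limn (fun n => g n x))); last first.
  by move=> x /set_mem Jx; exact: gl.
rewrite monotone_convergence//.
- apply/cvg_lim => //; rewrite /g.
  under eq_fun => n do rewrite integral_root ?w1 ?w0//.
  by apply: cvg_EFin; [near=> n|apply: cvgMr].
- move=> n; apply/measurable_EFinP; apply: measurable_funM.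
    by apply: measurable_funTS; apply: continuous_measurable_fun; exact: continuous_semicircle.
  apply: (@measurableT_comp _ _ _ _ _ _ (@GRing.inv R)).
    exact: measurable_invr.
  by apply: measurable_funB.
- move=> n x Jx; rewrite lee_fin mulr_ge0 ?sqrtr_ge0// invr_ge0 subr_ge0.
  exact: le_trans (root_neg n) (Jge _ Jx).
- move=> x Jx m n mn; rewrite lee_fin ler_wpM2l ?sqrtr_ge0//.
  have [/andP[m0 mv] /andP[n0 nv]] := (wv m, wv n).
  have pos k : 0 < x - root (w k).
    have /andP[k0 kv] := wv k.
    rewrite subr_gt0; apply: lt_le_trans (Jge _ Jx).
    by rewrite -root_v root_ltv.
  by rewrite lef_pV2 ?posrE// lerD2l lerN2 root_lt ?w_nd// ltW.
Unshelve. all: by end_near. Qed.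

End semicircle_over_x.

(** * The R-transform of the Marchenko-Pastur distributions *)

Section free_poisson_germ.
Context {R : realType}.

Lemma neq0_near (f : R[i] -> R[i]) : cdiff f 0 -> f 0 != 0 ->
  exists2 e : R, 0 < e & forall z, cmod z < e -> f z != 0.
Proof.
move=> df f0; have := cdiff_near df.
move=> /(_ (cmod (f 0))); rewrite cmod_gt0 => /(_ f0) /near0E[e e0 h].
exists e => // z /h; apply: contraTneq => ->.
by rewrite sub0r cmodN ltxx.
Qed.

Lemma mul_near (f : R[i] -> R[i]) (k : R) : cdiff f 0 -> 0 < k ->
  exists2 e : R, 0 < e & forall z, cmod z < e -> cmod (z * f z) < k.
Proof.
move=> df k0; have d2 := cdiffM (cdiff_id 0) df.
have /near0E[e e0 h] := cdiff_near d2 k0.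
by exists e => // z /h; rewrite /= mul0r subr0.
Qed.

Definition mp_R (a b : R) (z : R[i]) : R[i] := b%:C / (1 - (a * b)%:C * z).

Lemma cdiff_mp_R (a b : R) (z : R[i]) : 1 - (a * b)%:C * z != 0 -> cdiff (mp_R a b) z.
Proof.
move=> z1.
have d1 := cdiffB (cdiff_cst 1 z) (cdiffM (cdiff_cst (a * b)%:C z) (cdiff_id z)).
exact: cdiffM (cdiff_cst b%:C z) (cdiffV d1 z1).
Qed.

Lemma mp_R_near (a b : R) : exists2 e : R, 0 < e &
  forall z, cmod z < e -> 1 - (a * b)%:C * z != 0.
Proof.
apply: (@neq0_near (fun z => 1 - (a * b)%:C * z)).
  exact: cdiffB (cdiff_cst 1 0) (cdiffM (cdiff_cst (a * b)%:C 0) (cdiff_id 0)).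
by rewrite mulr0 subr0 oner_neq0.
Qed.

Lemma mp_R_analytic (a b : R) : analytic_near0 (mp_R a b).
Proof.
have [e e0 h] := mp_R_near a b; apply: (near0P e0) => z /h.
exact: cdiff_mp_R.
Qed.

End free_poisson_germ.

Section restriction.
Context d (T : measurableType d) (R : realType).
Variables (mu : {measure set T -> \bar R}) (D J : set T) (f g : T -> R[i]).
Hypotheses (mD : measurable D) (mJ : measurable J) (JD : J `<=` D).
Hypotheses (fJ : forall x, J x -> f x = g x) (f0 : forall x, ~ J x -> f x = 0).

Let restr (P : R[i] -> R) : P 0 = 0 -> (fun x => P (f x)) = (fun x => P (g x)) \_ J.
Proof.
move=> P0; apply/funext => x; rewrite patchE; case: ifPn => [/set_mem/fJ ->//|].
by rewrite notin_setE => /f0 ->.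
Qed.

Lemma cint_carrier : cint mu D f = cint mu J g.
Proof.
have rR := @restr (@complex.Re R) erefl; have rI := @restr (@complex.Im R) erefl.
by rewrite /cint rR rI -!Rintegral_mkcondr (setIidr JD).
Qed.

End restriction.

Section marchenko_pastur_transform.
Context {R : realType}.
Variables (alpha beta : {posnum R}).
Local Notation a := (alpha%:num).
Local Notation b := (beta%:num).
Let s : R := Num.sqrt a.
Let s0 : 0 < s. Proof. by rewrite sqrtr_gt0. Qed.
Let s2 : s ^+ 2 = a. Proof. by rewrite sqr_sqrtr. Qed.
Let c : R := b * (1 + a).
Let d : R := 2 * b * s.
Let d0 : 0 < d. Proof. by rewrite !mulr_gt0. Qed.
(* With this [v], the centre [c] has the form required by [semicircle_over_x];
   both [s] and its inverse solve the quadratic equation, [v] is the one up to 1. *)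
Let v : R := Num.min s s^-1.
Let v0 : 0 < v. Proof. by rewrite lt_min s0 invr_gt0. Qed.
Let v1 : v <= 1.
Proof.
rewrite /v ge_min; have [//|s1] := leP s 1.
by rewrite invf_le1// ltW.
Qed.
Let vV : v + v^-1 = s + s^-1.
Proof. by rewrite /v; case: leP => _ //; rewrite invrK addrC. Qed.
Let cE : c = d / 2 * (v + v^-1).
Proof. by rewrite vV /c /d -s2; field; rewrite gt_eqF. Qed.
Let k : R := (2 * pi * a * b)^-1.
Let k0 : 0 < k. Proof. by rewrite invr_gt0 !mulr_gt0// pi_gt0. Qed.
Let kd : k * pi * d = s^-1.
Proof.
have p0 : pi != 0 :> R by rewrite gt_eqF// pi_gt0.
have b0 : b != 0 by rewrite gt_eqF.
have sn0 : s != 0 by rewrite gt_eqF.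
rewrite /k /d -s2; move: (pi : R) p0 => q q0.
by field; rewrite q0 b0 sn0.
Qed.

Let lambda := @lebesgue_measure R.
Let J : set (measurableTypeR R) := `[c - d, c + d]%classic.
Let mJ : measurable J. Proof. exact: measurable_itv. Qed.
Let Mb : R := c + d.
Let M0 : 0 < Mb. Proof. by rewrite addr_gt0// mulr_gt0// addr_gt0. Qed.
Let D : set (measurableTypeR R) := `[- Mb, Mb]%classic.
Let mD : measurable D. Proof. exact: measurable_itv. Qed.
Let dc : d <= c. Proof. by rewrite cE; exact: joukowski_ge. Qed.
Let JD : J `<=` D.
Proof.
move=> x; rewrite /J /D /= !in_itv /= => /andP[h1 h2]; rewrite h2 andbT.
apply: le_trans h1; rewrite /Mb; have := dc; have := d0; lra.
Qed.

Let density_out x : ~ J x -> mp_density alpha beta x = 0.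
Proof.
move=> Jx; rewrite /mp_density patchE memNset//.
rewrite /mp_left /mp_right -/s => h; apply: Jx; move: h; rewrite /J /= !in_itv /=.
by rewrite /c /d -s2; congr (is_true (_ && _)); congr (_ <= _); ring.
Qed.

Let density_in x : J x -> mp_density alpha beta x = semicircle c d x / x * k.
Proof.
move=> Jx; rewrite /mp_density patchE mem_set; last first.
  rewrite /mp_left /mp_right -/s; move: Jx; rewrite /J /= !in_itv /=.
  by rewrite /c /d -s2; congr (is_true (_ && _)); congr (_ <= _); ring.
rewrite /semicircle /mp_left /mp_right -/s /k.
rewrite (_ : (_ - x) * _ = d ^+ 2 - (x - c) ^+ 2); last by rewrite /c /d -s2; ring.
by rewrite invfM [_^-1 / x]mulrC mulrA.
Qed.

Let ac := mp_abs_cont alpha beta.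

Let ac_null (A : set (measurableTypeR R)) : measurable A -> (forall x : R, A x -> x <= 0 \/ ~ J x) -> ac A = 0%E.
Proof.
move=> mA h; rewrite /ac /mp_abs_cont integral0_eq// => x Ax.
have [Jx|Jx] := pselect (J x); last by rewrite density_out.
have [x0|//] := h _ Ax.
have -> : x = 0.
  apply/le_anti; rewrite x0 /=; move: Jx; rewrite /J /= in_itv /= => /andP[+ _].
  by apply: le_trans; rewrite subr_ge0.
rewrite density_in ?invr0 ?mulr0 ?mul0r//.
suff -> : 0 = x by [].
apply/le_anti; rewrite x0 andbT; move: Jx; rewrite /J /= in_itv /= => /andP[+ _].
by apply: le_trans; rewrite subr_ge0.
Qed.

Let ac_split (A : set (measurableTypeR R)) : measurable A ->
  ac setT = (ac A + ac (~` A))%E.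
Proof.
move=> mA; rewrite -(setUv A); apply: (measureU (mp_abs_cont alpha beta)) => //.
  exact: measurableC.
by rewrite setICr.
Qed.

Let ac_mass : ac setT = (v / s)%:E.
Proof.
have -> : ac setT = ac J.
  rewrite (ac_split mJ) (ac_null (measurableC mJ)) ?adde0//.
  by move=> x; right.
transitivity (\int[lambda]_(x in J) (k%:E * (semicircle c d x / x)%:E))%E.
  by apply: eq_integral => x /set_mem Jx; rewrite density_in// mulrC EFinM.
rewrite ge0_integralZl//.
- rewrite /J cE (semicircle_over_x d0 v0 v1) -EFinM; congr EFin.
  by rewrite mulrA mulrA kd mulrC.
- apply/measurable_EFinP; apply: measurable_funM.
    by apply: measurable_funTS; apply: continuous_measurable_fun; exact: continuous_semicircle.
  by apply: measurable_funTS; exact: measurable_invr.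
- move=> x; rewrite /J /= in_itv /= => /andP[h _]; rewrite lee_fin mulr_ge0 ?sqrtr_ge0// invr_ge0.
  by apply: le_trans h; rewrite subr_ge0.
- by rewrite lee_fin ltW.
Qed.

Let w : R := Num.max (1 - a^-1) 0.
Let wE : w + v / s = 1.
Proof.
have sn0 : s != 0 by rewrite gt_eqF.
rewrite /w /v; have [s1|s1] := leP s s^-1.
  have a1 : a <= 1 by rewrite -s2 expr2 -(mulfV sn0) ler_pM2l.
  by rewrite max_r ?add0r ?divff// subr_le0 invf_ge1.
have a1 : 1 <= a by rewrite -s2 expr2 -(mulfV sn0) ler_pM2l// ltW.
rewrite max_l ?subr_ge0 ?invf_le1//.
by rewrite -invfM -expr2 s2 subrK.
Qed.

Let mpE A : marchenko_pastur alpha beta A =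
  (w%:E * @dirac _ (measurableTypeR R) 0%R R A + ac A)%E.
Proof. exact: measure_addE. Qed.

Lemma marchenko_pastur_mass : marchenko_pastur alpha beta setT = 1%E.
Proof.
by rewrite mpE diracT mule1 ac_mass -EFinD wE.
Qed.

Let mp_null (A : set (measurableTypeR R)) : measurable A -> ~ A 0 -> (forall x : R, A x -> x <= 0 \/ ~ J x) ->
  marchenko_pastur alpha beta A = 0%E.
Proof.
by move=> mA A0 h; rewrite mpE diracE memNset// mule0 add0e; exact: ac_null.
Qed.

Lemma marchenko_pastur_compact : compactly_supported (marchenko_pastur alpha beta).
Proof.
exists Mb; apply: mp_null; first exact: measurableC.
  by apply; rewrite /= in_itv /= oppr_le0 ltW.
by move=> x Dx; right => /JD.
Qed.

Lemma marchenko_pastur_nonneg : nonneg_supported (marchenko_pastur alpha beta).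
Proof.
apply: mp_null => //; first by rewrite /= in_itv /= ltxx.
by move=> x; rewrite /= in_itv /= => /ltW; left.
Qed.

Lemma marchenko_pastur_pos : marchenko_pastur alpha beta `]0, +oo[%classic != 0%E.
Proof.
have mp : measurable (`]0, +oo[%classic : set (measurableTypeR R)) by exact: measurable_itv.
have : ac setT = ac `]0, +oo[%classic.
  rewrite (ac_split mp) (ac_null (measurableC mp)) ?adde0// => x /= h; left.
  by rewrite leNgt; apply/negP => x0; apply: h; rewrite in_itv /= x0.
rewrite ac_mass => E.
rewrite mpE -E diracE memNset; last by rewrite /= in_itv /= ltxx.
by rewrite mule0 add0e eqe gt_eqF// divr_gt0.
Qed.

(** The density is a semicircle divided by [x], and
    [1 / ((Z - x) * x) = (1 / Z) * (1 / (Z - x) + 1 / x)] reduces its Cauchy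
    transform to [semicircle_cauchy] and [semicircle_over_x]; the second term
    combines with the atom at 0 to a total mass 1. The number [u] is the
    coordinate of the point with respect to [joukowski]. *)
Lemma marchenko_pastur_cauchy (z : R[i]) :
  z != 0 -> 1 - (a * b)%:C * z != 0 ->
  cmod (z * (s%:C * mp_R a b z)) < 1 ->
  2 * Mb <= cmod (mp_R a b z + z^-1) ->
  cauchy_transform (marchenko_pastur alpha beta) (mp_R a b z + z^-1) = z.
Proof.
move=> z0 z1; set u := z * _ => u1; set Z := _ + _ => ZM.
have sC : (s%:C : R[i]) != 0 by rewrite -cmod_gt0 cmodR normr_gt0 gt_eqF.
have bC : (b%:C : R[i]) != 0 by rewrite -cmod_gt0 cmodR normr_gt0 gt_eqF.
have aE : (a%:C : R[i]) = s%:C ^+ 2 by rewrite -rmorphXn /= s2.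
have abE : ((a * b)%:C : R[i]) = s%:C ^+ 2 * b%:C by rewrite rmorphM /= aE.
have q0 : 1 - s%:C ^+ 2 * b%:C * z != 0 by rewrite -abE.
have uE : u = z * (s%:C * (b%:C / (1 - s%:C ^+ 2 * b%:C * z))) by rewrite -abE.
have u0 : u != 0 by rewrite uE !mulf_neq0// invr_neq0.
have ZE : Z = joukowski c d u.
  rewrite /Z /joukowski /mp_R abE uE /c /d.
  have -> : ((2 * b * s / 2)%:C : R[i]) = b%:C * s%:C.
    by rewrite -rmorphM; congr (_%:C); field.
  have -> : ((b * (1 + a))%:C : R[i]) = b%:C * (1 + s%:C ^+ 2).
    by rewrite -aE rmorphM rmorphD rmorph1.
  by field; rewrite z0 q0 sC bC.
have Z0 : Z != 0.
  by rewrite -cmod_gt0; apply: lt_le_trans ZM; rewrite mulr_gt0.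
have DM x : D x -> cmod (x%:C : R[i]) <= Mb by rewrite cmodR ler_norml /D /= in_itv.
have ZxM x : D x -> Mb <= cmod (Z - x%:C).
  move=> /DM hx; apply: le_trans (ler_cmod_sub _ _).
  by have := M0; have := ZM; lra.
have Zx0 x : D x -> Z - x%:C != 0.
  by move=> /ZxM h; rewrite -cmod_gt0; apply: lt_le_trans h.
pose f (x : measurableTypeR R) : R[i] := (Z - x%:C)^-1.
have fM x : D x -> cmod (f x) <= Mb^-1.
  move=> Dx; rewrite cmodV lef_pV2 ?posrE ?ZxM//.
  exact: lt_le_trans (ZxM _ Dx).
have mf : cmeasurable D f by exact: cmeasurable_resolvent.
pose g1 (x : measurableTypeR R) : R[i] := (Z - x%:C)^-1 * (semicircle c d x)%:C.
pose g2 (x : measurableTypeR R) : R[i] := (semicircle c d x / x)%:C.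
pose g (x : measurableTypeR R) : R[i] := (k%:C / Z) * (g1 x + g2 x).
have gE x : J x -> f x * (mp_density alpha beta x)%:C = g x.
  move=> Jx; rewrite density_in// /g /g1 /g2 /f.
  have [x0|x0] := eqVneq x 0.
    have -> : semicircle c d x = 0.
      rewrite /semicircle ler0_sqrtr// x0 sub0r sqrrN subr_le0.
      by rewrite lerXn2r ?nnegrE// ltW// (lt_le_trans d0).
    by rewrite !mul0r !mulr0 addr0 mulr0.
  have xC : (x%:C : R[i]) != 0 by rewrite -cmod_gt0 cmodR normr_gt0.
  have Zx := Zx0 _ (JD Jx).
  rewrite !rmorphM fmorphV /=; move: (semicircle c d x) => t.
  by field; rewrite Zx xC Z0.
have g0 x : ~ J x -> f x * (mp_density alpha beta x)%:C = 0.
  by move=> Jx; rewrite density_out// mulr0.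
have ig1 : cintegrable lambda J g1 by rewrite /g1 ZE; exact: semicircle_integrable.
have sx : (\int[lambda]_(x in J) (semicircle c d x / x)%:E = (pi * d * v)%:E)%E.
  by rewrite /J cE; exact: semicircle_over_x.
have msx : measurable_fun J (fun x => semicircle c d x / x).
  apply: measurable_funM.
    by apply: measurable_funTS; apply: continuous_measurable_fun; exact: continuous_semicircle.
  by apply: measurable_funTS; exact: measurable_invr.
have sx0 x : J x -> 0 <= semicircle c d x / x.
  rewrite /J /= in_itv /= => /andP[h _]; rewrite mulr_ge0 ?sqrtr_ge0// invr_ge0.
  by apply: le_trans h; rewrite subr_ge0.
have ig2 : cintegrable lambda J g2.
  split; last by rewrite /g2; apply: integrable0.
  apply/integrableP; split; first exact/measurable_EFinP.
  apply: (@le_lt_trans _ _ (pi * d * v)%:E); last exact: ltry.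
  rewrite -sx le_eqVlt; apply/orP; left; apply/eqP; apply: eq_integral => x.
  by move=> /set_mem /sx0 h; rewrite /= ger0_norm.
have ig : cintegrable lambda J g by apply: cintegrableZ => //; exact: cintegrableD.
have acfin : (ac setT < +oo)%E by rewrite ac_mass ltry.
have iac : cintegrable (mp_abs_cont alpha beta) D f.
  apply: (cintegrable_bounded _ _ _ fM) => //.
  by apply: le_lt_trans acfin; apply: le_measure; rewrite ?inE.
have acE : cint (mp_abs_cont alpha beta) D f = k%:C / Z * ((pi * d)%:C * u + (pi * d * v)%:C).
  rewrite (@cint_density _ _ _ lambda _ (mp_density alpha beta))//; last exact: measurable_mp_density.
  rewrite (cint_carrier lambda JD gE g0) cintZ//; last exact: cintegrableD.
  rewrite cintD// /g2 cint_real; congr (_ * (_ + _)).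
    by rewrite /g1 ZE; exact: semicircle_cauchy.
  by rewrite /Rintegral sx.
have dD : (@dirac _ (measurableTypeR R) 0%R R D < +oo)%E.
  by rewrite diracE; case: (_ \in _); rewrite ltry.
have idi : cintegrable (\d_(0 : measurableTypeR R)) D f.
  apply: (cintegrable_bounded _ _ _ fM) => //.
have D0 : D (0 : R) by rewrite /D /= in_itv /= oppr_le0 !ltW.
have isc (r : {nonneg R}) : cintegrable (mscale r (\d_(0 : measurableTypeR R))) D f.
  apply: (cintegrable_bounded _ _ _ fM) => //.
  by apply: lte_mul_pinfty.
have mu0 : marchenko_pastur alpha beta (~` D) = 0%E.
  apply: mp_null; first exact: measurableC.
    by apply.
  by move=> x Dx; right => /JD.
rewrite (cauchy_cint _ mD)// -/f /marchenko_pastur.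
rewrite (cint_add mD (isc _) iac) cint_mscale// cint_dirac// acE.
rewrite {1}/f subr0 /= -/w.
have e1 : k%:C * (pi * d)%:C = s%:C^-1 :> R[i].
  by rewrite -rmorphM -fmorphV -kd; congr (_%:C); rewrite mulrA.
have e2 : k%:C * (pi * d * v)%:C = (v / s)%:C :> R[i].
  by rewrite -rmorphM -kd; congr (_%:C); ring.
have e3 : w%:C = 1 - (v / s)%:C :> R[i].
  by rewrite -(rmorph1 (real_complex R)) -wE rmorphD addrK.
transitivity ((w%:C + k%:C * (pi * d)%:C * u + k%:C * (pi * d * v)%:C) / Z).
  by move: (w%:C) (k%:C) ((pi * d)%:C) ((pi * d * v)%:C) => w' k' x' y'; ring.
rewrite e1 e2 e3 addrAC subrK.
have -> : 1 + s%:C^-1 * u = z * Z.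
  by rewrite /u /Z mulrDr mulfV// addrC mulrCA mulKf.
by rewrite mulfK.
Qed.

Lemma marchenko_pastur_R_transform :
  is_R_transform (marchenko_pastur alpha beta) (mp_R a b).
Proof.
apply: (@R_transform_intro _ _ _ (2 * Mb)).
- exact: marchenko_pastur_mass.
- exact: marchenko_pastur_compact.
- exact: mp_R_analytic.
have [e e0 he] := mp_R_near a b.
have d1 : cdiff (fun z => s%:C * mp_R a b z) 0.
  apply: (cdiffM (cdiff_cst _ _)); apply: cdiff_mp_R.
  by rewrite mulr0 subr0 oner_neq0.
have [e' e'0 he'] := mul_near d1 ltr01.
apply: (@dnear0P _ _ (Num.min e e')); first by rewrite lt_min e0.
move=> z z0; rewrite lt_min => /andP[ze ze'] hZ.
by apply: marchenko_pastur_cauchy => //; [exact: he|exact: he'].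
Qed.

End marchenko_pastur_transform.

(** * Mixtures with an atom at 0 *)

Section atom_mixture.
Context {R : realType}.
Implicit Types (mu nu : {measure set (measurableTypeR R) -> \bar R}).

Lemma cauchy_eq mu nu z : (forall A, measurable A -> mu A = nu A) ->
  cauchy_transform mu z = cauchy_transform nu z.
Proof.
move=> mn; rewrite /cauchy_transform /Rintegral.
by congr Complex; congr fine; apply: eq_measure_integral => A mA _; exact: mn.
Qed.

Lemma is_R_transform_eq mu nu r : (forall A, measurable A -> mu A = nu A) ->
  is_R_transform mu r -> is_R_transform nu r.
Proof.
move=> mn [m1 [M mM] ra h]; split => //.
- by rewrite -mn.
- exists M.
  have mA : measurable (~` `[- M, M]%classic : set (measurableTypeR R)).
    by apply: measurableC; exact: measurable_itv.
  exact: (etrans (esym (mn _ mA)) mM).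
- by apply: filterS h => z hz; rewrite -(cauchy_eq _ mn).
Qed.

Lemma is_S_transform_eq mu nu s : (forall A, measurable A -> mu A = nu A) ->
  is_S_transform mu s -> is_S_transform nu s.
Proof.
move=> mn [m1 m2 sa [r hr rs]]; split => //.
- by rewrite /nonneg_supported -mn.
- by rewrite -mn.
- by exists r; [exact: (is_R_transform_eq mn hr)|exact: rs].
Qed.

(** Normalising a measure of mass 1 does not change it but provides the structure of
    a probability. *)
Lemma probability_of_mass mu : mu setT = 1%E ->
  exists P : probability (measurableTypeR R) R, forall A, P A = mu A.
Proof.
move=> mu1; exists (mnormalize mu (\d_(0 : measurableTypeR R))) => A.
rewrite /= /mnormalize mu1 (_ : _ || _ = false) /=.
  by rewrite invr1 mule1.
by rewrite orbF; apply/negbTE; rewrite eqe oner_neq0.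
Qed.

Variables (p p' : {nonneg R}) (nu : {measure set (measurableTypeR R) -> \bar R}).

Definition atom_mixture : {measure set (measurableTypeR R) -> \bar R} :=
  measure_add (mscale p nu) (mscale p' (\d_(0 : measurableTypeR R))).

Lemma atom_mixtureE A : atom_mixture A =
  (p%:num%:E * nu A + p'%:num%:E * @dirac _ (measurableTypeR R) 0%R R A)%E.
Proof. exact: measure_addE. Qed.

Lemma atom_mixture_mass : p%:num + p'%:num = 1 -> nu setT = 1%E ->
  atom_mixture setT = 1%E.
Proof. by move=> pp nu1; rewrite atom_mixtureE nu1 diracT !mule1 -EFinD pp. Qed.

Lemma atom_mixture_compact (M : R) : 0 < M -> nu (~` `[- M, M]%classic) = 0%E ->
  atom_mixture (~` `[- M, M]%classic) = 0%E.
Proof.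
move=> M0 nuM; rewrite atom_mixtureE nuM mule0 add0e diracE memNset ?mule0//.
by apply; rewrite /= in_itv /= oppr_le0 ltW//= ltW.
Qed.

Lemma atom_mixture_nonneg : nonneg_supported nu -> nonneg_supported atom_mixture.
Proof.
rewrite /nonneg_supported => nu0.
rewrite atom_mixtureE nu0 mule0 add0e diracE memNset ?mule0//.
by rewrite /= in_itv /= ltxx.
Qed.

Lemma atom_mixture_pos : 0 < p%:num -> nu `]0, +oo[%classic != 0%E ->
  atom_mixture `]0, +oo[%classic != 0%E.
Proof.
move=> p0 nu0; rewrite atom_mixtureE diracE memNset; last by rewrite /= in_itv /= ltxx.
by rewrite mule0 adde0 mule_neq0// eqe gt_eqF.
Qed.

Lemma atom_mixture_cauchy (M : R) z : 0 < M -> nu (~` `[- M, M]%classic) = 0%E ->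
  nu setT = 1%E -> M < cmod z ->
  cauchy_transform atom_mixture z = p%:num%:C * cauchy_transform nu z + p'%:num%:C / z.
Proof.
move=> M0 nuM nu1 Mz.
pose D : set (measurableTypeR R) := `[- M, M]%classic.
have mD : measurable D by exact: measurable_itv.
pose f (x : measurableTypeR R) : R[i] := (z - x%:C)^-1.
have mf : cmeasurable D f by exact: cmeasurable_resolvent.
have zM : 0 < cmod z - M by rewrite subr_gt0.
have fM x : D x -> cmod (f x) <= (cmod z - M)^-1.
  move=> Dx; have h : cmod z - M <= cmod (z - x%:C).
    apply: le_trans (ler_cmod_sub _ _); rewrite lerB// cmodR ler_norml.
    by move: Dx; rewrite /D /= in_itv.
  by rewrite cmodV lef_pV2 ?posrE// (lt_le_trans zM).
have nuD : (nu D < +oo)%E.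
  apply: (@le_lt_trans _ _ (nu setT)); last by rewrite nu1 ltry.
  by apply: le_measure; rewrite ?inE.
have dD : (@dirac _ (measurableTypeR R) 0%R R D < +oo)%E.
  by rewrite diracE; case: (_ \in _); rewrite ltry.
have i1 : cintegrable nu D f by exact: (cintegrable_bounded _ _ _ fM).
have i2 : cintegrable (\d_(0 : measurableTypeR R)) D f.
  exact: (cintegrable_bounded _ _ _ fM).
have j1 : cintegrable (mscale p nu) D f.
  by apply: (cintegrable_bounded _ _ _ fM) => //; apply: lte_mul_pinfty.
have j2 : cintegrable (mscale p' (\d_(0 : measurableTypeR R))) D f.
  by apply: (cintegrable_bounded _ _ _ fM) => //; apply: lte_mul_pinfty.
have D0 : D (0 : R) by rewrite /D /= in_itv /= oppr_le0 !ltW.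
have mixM := atom_mixture_compact M0 nuM.
rewrite (cauchy_cint _ mD)// (cauchy_cint _ mD)// -/f.
rewrite (cint_add mD j1 j2) !cint_mscale// cint_dirac//.
by rewrite /f subr0.
Qed.

End atom_mixture.

(** * The factors of the multiplicative convolution *)

Section factors.
Context {R : realType}.

Lemma marchenko_pastur_S_transform (alpha beta : {posnum R}) :
  is_S_transform (marchenko_pastur alpha beta)
    (fun z => (beta%:num%:C + (alpha%:num * beta%:num)%:C * z)^-1).
Proof.
have bp : 0 < beta%:num by [].
set a := alpha%:num; set b := beta%:num in bp *.
have b0 : (b%:C : R[i]) != 0 by rewrite -cmod_gt0 cmodR normr_gt0 gt_eqF.
have dd (z : R[i]) : cdiff (fun z : R[i] => b%:C + (a * b)%:C * z) z.
  exact: cdiffD (cdiff_cst b%:C z) (cdiffM (cdiff_cst (a * b)%:C z) (cdiff_id z)).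
have [e e0 he] : exists2 e : R, 0 < e &
    forall z : R[i], cmod z < e -> b%:C + (a * b)%:C * z != 0.
  apply: (@neq0_near _ (fun z => b%:C + (a * b)%:C * z)); first exact: dd.
  by rewrite mulr0 addr0.
split.
- exact: marchenko_pastur_nonneg.
- exact: marchenko_pastur_pos.
- by apply: (near0P e0) => z /he z0; exact: cdiffV (dd z) z0.
exists (mp_R a b); first exact: marchenko_pastur_R_transform.
apply: (near0P e0) => z /he; rewrite /mp_R.
move: ((a * b)%:C : R[i]) (b%:C : R[i]) b0 => ab b' b0 z0.
have -> : 1 - ab * (z * (b' + ab * z)^-1) = b' / (b' + ab * z) by field.
by field; rewrite b0 z0.
Qed.

Variable p : R.
Hypotheses (p0 : 0 < p) (p1 : p < 1).

Definition bernoulli_radicand (z : R[i]) : R[i] := (1 - z) ^+ 2 + 4 * p%:C * z.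
(** [z * bernoulli_R z] is the root that vanishes at 0 of the quadratic equation of
    [bernoulli_R_rel]; the square root is in the denominator to make the formula
    analytic at 0. *)
Definition bernoulli_R (z : R[i]) : R[i] :=
  2 * p%:C / (1 - z + sqrtc (bernoulli_radicand z)).

Let pC : (p%:C : R[i]) != 0.
Proof. by rewrite -cmod_gt0 cmodR normr_gt0 gt_eqF. Qed.

Let Re_sub1 (z : R[i]) : cmod z < 1 -> 0 < complex.Re (1 - z).
Proof.
move=> z1; rewrite raddfB /= subr_gt0; apply: le_lt_trans z1.
exact: le_trans (ler_norm _) (ler_Re_cmod _).
Qed.

Let den_neq0 (z : R[i]) : cmod z < 1 -> 1 - z + sqrtc (bernoulli_radicand z) != 0.
Proof.
move=> /Re_sub1 z1; apply/eqP => /(congr1 (@complex.Re R)); rewrite raddfD /=.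
move: z1; rewrite raddfB /= => z1.
by have := sqrtc_Re_ge0 (bernoulli_radicand z); lra.
Qed.

Let cdiff_radicand (z : R[i]) : cdiff bernoulli_radicand z.
Proof.
have d1 := cdiffB (cdiff_cst 1 z) (cdiff_id z).
exact: cdiffD (cdiffM d1 d1) (cdiffM (cdiff_cst (4 * p%:C) z) (cdiff_id z)).
Qed.

Let Re_pos_near (f : R[i] -> R[i]) : cdiff f 0 -> f 0 = 1 ->
  exists2 e : R, 0 < e & forall z, cmod z < e -> 0 < complex.Re (f z).
Proof.
move=> df f0; have /near0E[e e0 h] := cdiff_near df (ltr01 : 0 < 1 :> R).
exists e => // z /h; rewrite f0 => hz.
have := Re_le_cmod_sub (f z) 1; rewrite /= => h2.
by apply: lt_le_trans h2; rewrite subr_gt0.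
Qed.

Lemma bernoulli_R_analytic : analytic_near0 bernoulli_R.
Proof.
have [e e0 h] := Re_pos_near (@cdiff_radicand 0) ltac:(by rewrite /bernoulli_radicand mulr0 subr0 addr0 expr1n).
apply: (@near0P _ _ (Num.min e 1)); first by rewrite lt_min e0 ltr01.
move=> z; rewrite lt_min => /andP[/h zR z1].
have cS := cdiff_comp (@cdiff_radicand z) (cdiff_sqrtc zR).
have d1 := cdiffB (cdiff_cst 1 z) (cdiff_id z).
exact: cdiffM (cdiff_cst (2 * p%:C) z) (cdiffV (cdiffD d1 cS) (den_neq0 z1)).
Qed.

Lemma bernoulli_R_rel (z : R[i]) (t := z * bernoulli_R z) : cmod z < 1 ->
  t ^+ 2 + t * (1 - z) - p%:C * z = 0.
Proof.
move=> z1; rewrite /t /bernoulli_R; have := den_neq0 z1.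
have := sqr_sqrtc (bernoulli_radicand z); set v := sqrtc _ => v2 d0.
rewrite [LHS](_ : _ = p%:C * z / (1 - z + v) ^+ 2 * (bernoulli_radicand z - v ^+ 2)).
  by rewrite v2 subrr mulr0.
by rewrite /bernoulli_radicand; field.
Qed.

Lemma bernoulli_real_mixture (A : set (measurableTypeR R)) : measurable A ->
  bernoulli_real p A =
  atom_mixture (NngNum (ltW p0)) (NngNum (ltW (etrans (subr_gt0 _ _) p1)))
    (\d_(1 : measurableTypeR R)) A.
Proof.
move=> mA; rewrite atom_mixtureE /= /bernoulli_real /pushforward bernoulli_probE.
  by rewrite !diracE /=.
by rewrite !ltW.
Qed.

End factors.

Section bernoulli_transforms.
Context {R : realType}.
Variable p : R.
Hypotheses (p0 : 0 < p) (p1 : p < 1).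

Let pC : (p%:C : R[i]) != 0.
Proof. by rewrite -cmod_gt0 cmodR normr_gt0 gt_eqF. Qed.

Let delta1 : {measure set (measurableTypeR R) -> \bar R} := \d_(1 : measurableTypeR R).
Let delta1_mass : delta1 setT = 1%E. Proof. exact: diracT. Qed.
Let delta1_compact : delta1 (~` `[- 1, 1]%classic) = 0%E.
Proof.
rewrite /delta1 /= diracE memNset// => h; apply: h; rewrite /= in_itv /=.
by rewrite lexx andbT; lra.
Qed.

Let delta1_cauchy (z : R[i]) : 1 < cmod z -> cauchy_transform delta1 z = (z - 1)^-1.
Proof.
move=> z1.
pose D : set (measurableTypeR R) := `[- 1, 1]%classic.
have mD : measurable D by exact: measurable_itv.
rewrite (cauchy_cint _ mD) ?delta1_compact// cint_dirac//.
- by rewrite /D /= in_itv /= lexx andbT; lra.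
- exact: cmeasurable_resolvent.
Qed.

Let mix := atom_mixture (NngNum (ltW p0)) (NngNum (ltW (etrans (subr_gt0 _ _) p1))) delta1.
Let mixE (A : set (measurableTypeR R)) : measurable A -> mix A = bernoulli_real p A.
Proof. by move=> mA; rewrite bernoulli_real_mixture. Qed.

(** The Cauchy transform of the distribution at [Z = (1 + t) / z] is
    [p / (Z - 1) + (1 - p) / Z]; equating it with [z] is the quadratic equation for
    [t = z * bernoulli_R z]. *)
Lemma bernoulli_R_transform : is_R_transform (bernoulli_real p) (bernoulli_R p).
Proof.
apply: (is_R_transform_eq mixE).
apply: (@R_transform_intro _ _ _ 2).
- by apply: atom_mixture_mass => //=; rewrite addrC subrK.
- by exists 1; apply: atom_mixture_compact => //; exact: delta1_compact.
- exact: bernoulli_R_analytic.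
apply: (@dnear0P _ _ 1) => // z z0 z1 hZ.
rewrite (atom_mixture_cauchy _ _ ltr01 delta1_compact delta1_mass); last by lra.
rewrite delta1_cauchy; last by lra.
set Z := _ + _ in hZ *.
have Z0 : Z != 0 by rewrite -cmod_gt0; lra.
have Z1 : Z - 1 != 0.
  by rewrite -cmod_gt0; have := ler_cmod_sub Z 1; rewrite cmod1; lra.
have := bernoulli_R_rel p z1; set t := z * _ => rel.
have ZE : Z = (1 + t) / z by rewrite /Z /t; field.
rewrite /= rmorphB /= -[1%:C]/(1 : R[i]).
move: Z0 Z1; rewrite ZE => Z0 Z1.
have t1 : 1 + t != 0 by move: Z0; rewrite mulf_eq0 negb_or => /andP[].
have t2 : 1 + t - z != 0.
  apply: contra Z1 => /eqP h.
  by rewrite (_ : _ - 1 = (1 + t - z) / z); [rewrite h mul0r | field].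
apply/eqP; rewrite -subr_eq0; apply/eqP.
have -> : p%:C * ((1 + t) / z - 1)^-1 + (1 - p%:C) / ((1 + t) / z) - z =
   - z * (t ^+ 2 + t * (1 - z) - p%:C * z) / ((1 + t) * (1 + t - z)).
  by field; rewrite z0 t1 t2.
by rewrite rel mulr0 mul0r.
Qed.

(** At [y = z * s z] the radicand of [bernoulli_R] is a perfect square, so the root
    disappears. *)
Lemma bernoulli_S_transform :
  is_S_transform (bernoulli_real p) (fun z => (1 + z) / (p%:C + z)).
Proof.
apply: (is_S_transform_eq mixE).
have [e e0 he] : exists2 e : R, 0 < e & forall z : R[i], cmod z < e -> p%:C + z != 0.
  apply: (@neq0_near _ (fun z => p%:C + z)); last by rewrite addr0.
  exact: cdiffD (cdiff_cst p%:C 0) (cdiff_id 0).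
have ds (z : R[i]) : p%:C + z != 0 -> cdiff (fun z : R[i] => (1 + z) / (p%:C + z)) z.
  move=> h; apply: (cdiffM (cdiffD (cdiff_cst 1 z) (cdiff_id z))).
  exact: cdiffV (cdiffD (cdiff_cst p%:C z) (cdiff_id z)) h.
split.
- apply: atom_mixture_nonneg; rewrite /nonneg_supported /delta1 /= diracE memNset//.
  by rewrite /= in_itv /= ltNge ler01.
- apply: atom_mixture_pos => //; rewrite /delta1 /= diracE mem_set ?oner_neq0//.
  by rewrite /= in_itv /= ltr01.
- by apply: (near0P e0) => z /he; exact: ds.
exists (bernoulli_R p).
  by apply: (is_R_transform_eq (fun A mA => esym (mixE mA))); exact: bernoulli_R_transform.
pose y (z : R[i]) := z * ((1 + z) / (p%:C + z)).
have p0' : p%:C + 0 != 0 :> R[i] by rewrite addr0.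
have dy : cdiff (fun z => 1 - y z + 2 * z) 0.
  apply: cdiffD (cdiffM (cdiff_cst 2 0) (cdiff_id 0)).
  apply: cdiffB (cdiff_cst 1 0) _; exact: cdiffM (cdiff_id 0) (ds 0 p0').
have /near0E[d d0 hd] := cdiff_near dy (ltr01 : 0 < 1 :> R).
apply: (@near0P _ _ (Num.min (Num.min e d) 1)); first by rewrite !lt_min e0 d0 ltr01.
move=> z; rewrite !lt_min => /andP[/andP[/he pz /hd zd] z1].
have Rpos : 0 < complex.Re (1 - y z + 2 * z).
  have h2 := Re_le_cmod_sub (1 - y z + 2 * z) 1.
  apply: lt_le_trans h2; rewrite subr_gt0; apply: le_lt_trans zd.
  have y0 : y 0 = 0 by rewrite /y mul0r.
  by rewrite y0 subr0 mulr0 addr0.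
rewrite -/(y z) /bernoulli_R.
have -> : bernoulli_radicand p (y z) = (1 - y z + 2 * z) ^+ 2.
  by rewrite /bernoulli_radicand /y; field.
rewrite sqrtc_sqr//.
have z10 : 1 + z != 0.
  by rewrite -[z]opprK; apply: sub1_neq0; rewrite cmodN.
have -> : 1 - y z + (1 - y z + 2 * z) = 2 * p%:C * (1 + z) / (p%:C + z).
  by rewrite /y; field.
by field; rewrite pz pC z10.
Qed.

End bernoulli_transforms.

(** * The compressed Marchenko-Pastur distribution *)

Section compressed_marchenko_pastur.
Context {R : realType}.
Variables (p1 p2 : {posnum R}).
Local Notation q1 := (p1%:num).
Local Notation q2 := (p2%:num).
Hypothesis p12 : q1 + q2 = 1.

(** Compressing a free Poisson element of distribution MP(1 / p2, p2) by a free
    projection of trace [p1] gives a free Poisson element again, of R-transform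
    [p2 / (1 - p1 z)]. Seen in the whole algebra, the compression has this
    distribution with weight [p1], and an atom at 0 of weight [p2] for the kernel
    of the projection. *)
Definition compressed_mp : {measure set (measurableTypeR R) -> \bar R} :=
  atom_mixture (q1)%:nng (q2)%:nng (marchenko_pastur (q1 / q2)%:pos p2).

Let nu := marchenko_pastur (q1 / q2)%:pos p2.
Let c1 : R[i] := q1%:C.
Let c2 : R[i] := q2%:C.
Let c12 : c1 + c2 = 1.
Proof. by rewrite -rmorphD p12. Qed.
Let c1_neq0 : c1 != 0.
Proof. by rewrite -cmod_gt0 cmodR normr_gt0 gt_eqF. Qed.
Let c2_neq0 : c2 != 0.
Proof. by rewrite -cmod_gt0 cmodR normr_gt0 gt_eqF. Qed.

Lemma compressed_mp_mass : compressed_mp setT = 1%E.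
Proof. by apply: atom_mixture_mass; [exact: p12|exact: marchenko_pastur_mass]. Qed.

Lemma compressed_R_rel (z : R[i]) (t := z * compressed_R q1 q2 z) : 1 - z != 0 ->
  t + t ^+ 2 = z * (c1 * c2 + t + t ^+ 2).
Proof.
move=> z1.
have := sqr_sqrtc (hook_radicand q1 q2 z).
rewrite (compressed_R_sqrt p12 z1) -/t /hook_radicand -/c1 -/c2 => h.
have c2E : c2 = 1 - c1 by rewrite -c12 addrC addKr.
apply/eqP; rewrite -subr_eq0; apply/eqP.
have -> : t + t ^+ 2 - z * (c1 * c2 + t + t ^+ 2) =
    (1 - z) / 4 * ((1 + 2 * t) ^+ 2 - (1 - (c2 - c1) ^+ 2 * z) / (1 - z)).
  by rewrite c2E; field.
by rewrite h subrr mulr0.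
Qed.

(** With [t = z * compressed_R z], the Cauchy transform of the Marchenko-Pastur
    component at [compressed_R z + 1 / z] is [w = t / (c1 * (c2 + t))]: the equality
    of [mp_R w + 1 / w] with that point is [compressed_R_rel]. The two components
    then add up to [c1 * w + c2 / Z = z]. *)
Lemma compressed_mp_R_transform : is_R_transform compressed_mp (compressed_R q1 q2).
Proof.
have [M [M0 nuM]] : exists M : R, 0 < M /\ nu (~` `[- M, M]%classic) = 0%E.
  have [M hM] := marchenko_pastur_compact (q1 / q2)%:pos p2.
  exists (Num.max M 1); rewrite lt_max ltr01 orbT; split => //.
  apply/eqP; rewrite eq_le measure_ge0 andbT -hM; apply: le_measure; rewrite ?inE.
  - exact: measurableC.
  - exact: measurableC.
  - apply: subsetC => x /=; rewrite !in_itv /= -!ler_norml => h.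
    by rewrite le_max h.
pose s : R := Num.sqrt (q1 / q2).
have s0 : 0 < s by rewrite sqrtr_gt0 divr_gt0.
pose B := 2 * (q2 * (1 + q1 / q2) + 2 * q2 * s).
have [e e0 he] := hook_radicand_near q1 q2.
have dR : cdiff (compressed_R q1 q2) 0.
  by have := compressed_R_analytic q1 q2 => /nbhs_singleton.
have k0 : 0 < Num.min (Num.min q1 q2) (q1 / s).
  have [q1p q2p] : 0 < q1 /\ 0 < q2 by split.
  by rewrite !lt_min q1p q2p divr_gt0.
have [d d0 hd] := mul_near dR k0.
have qa : q1 / q2 * q2 = q1 by rewrite divfK// gt_eqF.
apply: (@R_transform_intro _ _ _ (Num.max B M + 1)).
- exact: compressed_mp_mass.
- by exists M; exact: (atom_mixture_compact _ _ M0 nuM).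
- exact: compressed_R_analytic.
apply: (@dnear0P _ _ (Num.min e d)); first by rewrite lt_min e0 d0.
move=> z z0; rewrite lt_min => /andP[/he[z1 _] /hd].
rewrite !lt_min => /andP[/andP[t1 t2] t3] hZ.
have [hB hM] : B <= Num.max B M /\ M <= Num.max B M by rewrite !le_max !lexx orbT.
pose Z : R[i] := compressed_R q1 q2 z + z^-1; rewrite -/Z in hZ *.
have := compressed_R_rel z1; set t := z * _ in t1 t2 t3 * => rel.
have Z0 : Z != 0 by rewrite -cmod_gt0; lra.
have ZE : Z = (1 + t) / z by rewrite /Z /t; field.
have t10 : 1 + t != 0 by move: Z0; rewrite ZE mulf_eq0 negb_or => /andP[].
have t0 : t != 0.
  by rewrite /t /compressed_R !mulf_neq0// ?pnatr_eq0// invr_neq0// mulf_neq0// sqrtcD1_neq0.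
have ct (q : {posnum R}) : cmod t < q%:num -> (q%:num)%:C + t != 0.
  move=> h; apply: contraTneq h => /eqP; rewrite addr_eq0 => /eqP h.
  by rewrite -cmodN -h cmodR ger0_norm// ltxx.
have ct1 := ct _ t1; have ct2 := ct _ t2; rewrite -/c1 -/c2 in ct1 ct2.
have c2E : c2 = 1 - c1 by rewrite -c12 addrC addKr.
have zE : z = t * (1 + t) / ((c1 + t) * (c2 + t)).
  have rel' : t * (1 + t) = z * ((c1 + t) * (c2 + t)).
    by rewrite mulrDr mulr1 -expr2 rel c2E; ring.
  by rewrite rel' mulfK// mulf_neq0.
pose w := t / (c1 * (c2 + t)).
have w0 : w != 0 by apply: mulf_neq0 => //; apply/invr_neq0/mulf_neq0.
have w1 : 1 - c1 * w = c2 / (c2 + t) by rewrite /w; field; rewrite ct2 c1_neq0.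
have mw : mp_R (q1 / q2) q2 w = c2 + t.
  by rewrite /mp_R qa -/c1 -/c2 w1; field; rewrite ct2 c2_neq0.
have ZwE : Z = mp_R (q1 / q2) q2 w + w^-1.
  by rewrite mw ZE {1}zE /w c2E; field; rewrite -c2E t0 t10 ct1 ct2 c1_neq0.
have cw : cauchy_transform nu Z = w.
  rewrite ZwE; apply: marchenko_pastur_cauchy => //=.
  - by rewrite qa -/c1 w1; apply: mulf_neq0 => //; exact: invr_neq0.
  - rewrite mw -/s /w (_ : _ * _ = s%:C * t / c1).
      rewrite 2!cmodM cmodV !cmodR !ger0_norm ?ltW// ltr_pdivrMr// mul1r.
      by rewrite mulrC -ltr_pdivlMr.
    by field; rewrite ct2 c1_neq0.
  - by rewrite -ZwE -/s -/B; lra.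
rewrite (atom_mixture_cauchy _ _ M0 nuM (marchenko_pastur_mass _ _)); last by lra.
rewrite -/nu cw /= -/c1 -/c2 ZE [LHS](_ : _ = t / (c2 + t) + c2 * z / (1 + t)).
  by rewrite {1}zE [RHS]zE c2E; field; rewrite -c2E t10 ct1 ct2.
by rewrite /w; field; rewrite t10 z0 ct2 c1_neq0.
Qed.

(** At [y = z * s z] the radicand of [compressed_R] is the square of [1 + 2 * z], so
    the root disappears. The formula is symmetric in the two parameters although
    the construction of [compressed_mp] is not. *)
Lemma compressed_mp_S_transform :
  is_S_transform compressed_mp (fun z => (1 + z) / ((c1 + z) * (c2 + z))).
Proof.
have n1 : (c1 + 0) * (c2 + 0) != 0 by rewrite !addr0 mulf_neq0.
have dd (z : R[i]) : cdiff (fun z => (c1 + z) * (c2 + z)) z.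
  exact: cdiffM (cdiffD (cdiff_cst c1 z) (cdiff_id z)) (cdiffD (cdiff_cst c2 z) (cdiff_id z)).
have [e e0 he] := neq0_near (dd 0) n1.
have ds (z : R[i]) : (c1 + z) * (c2 + z) != 0 ->
    cdiff (fun z => (1 + z) / ((c1 + z) * (c2 + z))) z.
  move=> h; apply: (cdiffM (cdiffD (cdiff_cst 1 z) (cdiff_id z))).
  exact: cdiffV (dd z) h.
split.
- exact: (atom_mixture_nonneg _ _ (marchenko_pastur_nonneg _ _)).
- apply: atom_mixture_pos; last exact: marchenko_pastur_pos.
  have q1_gt0 : 0 < q1 by [].
  exact: q1_gt0.
- by apply: (near0P e0) => z /he; exact: ds.
exists (compressed_R q1 q2); first exact: compressed_mp_R_transform.
have c2E : c2 = 1 - c1 by rewrite -c12 addrC addKr.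
apply: (@near0P _ _ (Num.min e (1 / 2))); first by rewrite lt_min e0 divr_gt0.
move=> z; rewrite lt_min => /andP[/he nz z1].
have z10 : 1 + z != 0.
  by rewrite -[z]opprK; apply: sub1_neq0; rewrite cmodN; lra.
move: nz; rewrite mulf_eq0 negb_or => /andP[nz1 nz2].
pose y := z * ((1 + z) / ((c1 + z) * (c2 + z))).
have y1 : 1 - y = c1 * c2 / ((c1 + z) * (c2 + z)).
  by rewrite /y c2E; field; rewrite -c2E nz1 nz2.
have rad : sqrtc (hook_radicand q1 q2 y) = 1 + 2 * z.
  rewrite (_ : hook_radicand _ _ y = (1 + 2 * z) ^+ 2).
    apply: sqrtc_sqr; have := Re_le_cmod_sub (1 + 2 * z) 1.
    rewrite (_ : 1 + _ - 1 = 2 * z); last by ring.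
    rewrite cmodM cmod_nat /= => h; apply: lt_le_trans h; lra.
  rewrite /hook_radicand -/c1 -/c2 y1 /y c2E; field.
  by rewrite -c2E nz1 nz2 c1_neq0 c2_neq0.
rewrite -/y /compressed_R rad -/c1 -/c2 y1.
rewrite (_ : 1 + (1 + 2 * z) = 2 * (1 + z)); last by ring.
by field; rewrite nz1 nz2 c1_neq0 c2_neq0 z10.
Qed.

End compressed_marchenko_pastur.

Theorem theorem5p5 (R : realType) (a1 a2 : nat) (p1 p2 : {posnum R})
    (F : probability (measurableTypeR R) R)
    (ha1 : (0 < a1)%N) (ha2 : (0 < a2)%N)
    (hp1 : p1%:num = a1%:R / (a1 + a2)%:R)
    (hp2 : p2%:num = a2%:R / (a1 + a2)%:R)
    (hF : is_F_lambda (fat_hook a1 a2) F) :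
  let c1 : R[i] := (p1%:num)%:C in
  let c2 : R[i] := (p2%:num)%:C in
  [/\ forall z : R[i], complex.Im z != 0 ->
        let G := cauchy_transform F z in
        z ^+ 2 * G ^+ 3 + z * (c1 - c2 - 2 * z) * G ^+ 2
          + z * (2 * c2 + z) * G + (c1 ^+ 2 - z) = 0,
      exists2 r : R[i]^o -> R[i]^o, is_R_transform F r &
        \forall z \near (0 : R[i]^o)^',
          r z = c1 / (1 - z)
                + (sqrtc ((1 - (c2 - c1) ^+ 2 * z) / (1 - z)) - 1) / (2 * z)
    & (exists2 M : probability (measurableTypeR R) R,
          is_free_mul_conv (marchenko_pastur p1%:num^-1%:pos p1)
                           (bernoulli_real p2%:num) M
        & is_free_add_conv (marchenko_pastur p1%:num^-1%:pos p1) M F)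
      /\
      (exists2 M : probability (measurableTypeR R) R,
          is_free_mul_conv (marchenko_pastur p2%:num^-1%:pos p2)
                           (bernoulli_real p1%:num) M
        & is_free_add_conv (marchenko_pastur p1%:num^-1%:pos p1) M F)].
Proof.
have l0 : 0 < (a1 + a2)%:R :> R by rewrite ltr0n addn_gt0 ha1.
have p12 : p1%:num + p2%:num = 1.
  by rewrite hp1 hp2 -mulrDl -natrD divff// gt_eqF.
have p21 : p2%:num + p1%:num = 1 by rewrite addrC.
have lt1 (p q : {posnum R}) : p%:num + q%:num = 1 -> p%:num < 1.
  by move=> <-; rewrite ltrDl.
move=> c1 c2.
have FR : is_R_transform F (hook_R p1%:num p2%:num).
  by rewrite hp1 hp2; exact: hook_R_transform.
have [M ME] := probability_of_mass (compressed_mp_mass p12).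
have mE A : measurable A -> compressed_mp p1 p2 A = M A by [].
have Madd : is_free_add_conv (marchenko_pastur p1%:num^-1%:pos p1) M F.
  exists (mp_R p1%:num^-1 p1%:num), (compressed_R p1%:num p2%:num); split.
  - exact: marchenko_pastur_R_transform.
  - exact: (is_R_transform_eq mE (compressed_mp_R_transform p12)).
  - rewrite (_ : (fun z => _) = hook_R p1%:num p2%:num)//.
    by apply/funext => z; rewrite /mp_R mulVf ?mul1r// gt_eqF.
(* The S-transform of [M] is symmetric in [p1] and [p2], hence both products. *)
have Mmul (p q : {posnum R}) : p%:num + q%:num = 1 -> 
    (forall z : R[i], (c1 + z) * (c2 + z) = ((p%:num)%:C + z) * ((q%:num)%:C + z)) ->
    is_free_mul_conv (marchenko_pastur p%:num^-1%:pos p) (bernoulli_real q%:num) M.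
  move=> pq E.
  exists (fun z => ((p%:num)%:C + (p%:num^-1 * p%:num)%:C * z)^-1).
  exists (fun z => (1 + z) / ((q%:num)%:C + z)); split.
  - exact: marchenko_pastur_S_transform.
  - by apply: bernoulli_S_transform => //; apply: (lt1 _ p); rewrite addrC.
  - rewrite (_ : (fun z => _) = fun z => (1 + z) / ((c1 + z) * (c2 + z))).
      exact: (is_S_transform_eq mE (compressed_mp_S_transform p12)).
    apply/funext => z; rewrite E mulVf ?mul1r ?gt_eqF// invfM.
    by rewrite mulrCA mulrA.
split.
- move=> z z0 G; rewrite /c1 /c2 hp1 hp2.
  exact: (hook_cubic_off_axis ha1 ha2 hF z0).
- exists (hook_R p1%:num p2%:num) => //.
  apply: (@dnear0P _ _ 1) => // z z0 /sub1_neq0 z1.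
  by rewrite /hook_R compressed_R_formula.
- split; exists M => //; first exact: Mmul.
  by apply: Mmul => // z; rewrite mulrC.
Qed.
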